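(* Consider a sequence, indexed by $n=1,2,\dots$, of heterogeneous $k$-server queues with $k$ fixed, such that for each $n$: (i) $\mathbb{P}(T^{(n)}_i>0)>0$ for all $i\in\overline{K}$; (ii) the Markov process $X^{(n)}(\cdot)$ has a stationary distribution; and $\lambda^{(n)}_0<\sum_{i\in K}\lambda^{(n)}_i$. Assume that there are finite constants $\lambda_i>0$ and nonnegative constants $\sigma_i$, $i\in\overline{K}$, such that $$\lim_{n\to\infty}\lambda^{(n)}_i=\lambda_i,\quad i\in\overline{K},$$ $$0<\rho^{(n)}<1\ \text{ for all } n\ge1,\qquad \lim_{n\to\infty}\rho^{(n)}=1,$$ $$\lim_{n\to\infty}\sigma^{(n)}_i=\sigma_i\ge0,\quad i\in\overline{K},\qquad \sum_{i\in\overline{K}}\sigma_i>0,$$ $$\lim_{a\to\infty}\sup_{n\ge1}\mathbb{E}\big((T^{(n)}_i)^2\,1(T^{(n)}_i>a)\big)=0,\quad i\in\overline{K}.$$ Let $L^{(n)}$ be a random variable with the stationary distribution of $L^{(n)}(\cdot)$. Then $$\lim_{n\to\infty}\mathbb{P}\big((1-\rho^{(n)})L^{(n)}\le x\big)=1-\exp\Big(-\frac{2\lambda_0}{\sum_{i\in\overline{K}}\lambda_i^3\sigma_i^2}\,x\Big),\qquad x\ge0.$$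
   Context: Model. Fix an integer $k\ge1$, $K=\{1,\dots,k\}$, $\overline{K}=\{0\}\cup K$. In a heterogeneous $k$-server queue, customers arrive according to a renewal process with i.i.d. inter-arrival times of distribution $F_0$ with finite positive mean $1/\lambda_0$, join a single waiting line, and are served in first-come first-served order by $k$ servers; server $i\in K$ has i.i.d. service times with distribution $F_i$ of finite positive mean $1/\lambda_i$. All these sequences are independent. $T_i$ denotes a random variable with distribution $F_i$, $i\in\overline{K}$; $\mathbb{P}(T_i=0)>0$ is allowed. No server idles while customers wait. At each arrival or service completion instant, an arriving customer is put in the waiting line, servers completing service are added to the set $A$ of available servers, and if $j$ customers are waiting then the first $\min(j,|A|)$ of them start service at the servers of a (possibly random) subset $D(A,j)\subset A$ with $|D(A,j)|=\min(j,|A|)$; for each fixed $(A,j)$ the sets $D(A,j)$ used at different times are identically distributed and independent of everything else. The rule is reapplied, arrival by arrival, if new inter-arrival or service times equal to $0$ occur. State process. $L(t)$ is the number of customers in system, $J(t)\subset K$ the set of busy servers, and $\boldsymbol{R}(t)=(R_0(t),\dots,R_k(t))$, where $R_0(t)$ is the residual time to the next arrival, $R_i(t)$ is the residual service time at server $i\in J(t)$ and $R_i(t)=0$ for $i\in K\setminus J(t)$; $X(t)=(L(t),J(t),\boldsymbol{R}(t))$ is a right-continuous Markov process. The superscript $(n)$ denotes the quantities of the $n$-th system; the server selection rule may depend on $n$. $\lambda^{(n)}_i=1/\mathbb{E}(T^{(n)}_i)$, $(\sigma^{(n)}_i)^2$ is the variance of $T^{(n)}_i$, assumed finite, and $\rho^{(n)}=\lambda^{(n)}_0/\sum_{i\in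 K}\lambda^{(n)}_i$. *)

(* Defs.v *)
From HB Require Import structures.
From mathcomp Require Import all_boot all_order all_algebra.
From mathcomp Require Import all_classical all_reals all_analysis.

Set Implicit Arguments.
Unset Strict Implicit.
Unset Printing Implicit Defensive.

Import Order.TTheory GRing.Theory Num.Theory.
Import numFieldNormedType.Exports.

Local Open Scope classical_set_scope.
Local Open Scope ring_scope.

(* Servers are the elements of 'I_k.  Clocks are indexed by 'I_k.+1: ord0 is
   the arrival clock, and lift ord0 i is the service clock of server i. *)

(* X = (L, J, (R_0, ..., R_k)) *)
Record state (R : realType) (k : nat) := State {
  customers : nat;
  busy : {set 'I_k};
  residual : 'I_k.+1 -> R }.

HB.instance Definition _ (R : realType) k := gen_eqMixin (state R k).
HB.instance Definition _ (R : realType) k := gen_choiceMixin (state R k).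
HB.instance Definition _ (R : realType) k :=
  isPointed.Build (state R k) (State 0 finset.set0 (fun=> 0)).

Definition state_gen (R : realType) (k : nat) : set (set (state R k)) :=
  [set A | [\/ exists B : set nat, A = @customers R k @^-1` B,
               exists B : set {set 'I_k}, A = @busy R k @^-1` B
             | exists (i : 'I_k.+1) (B : set R),
                 measurable B /\ A = [set x | B (residual x i)]]].

(* The state space with the product sigma-algebra (discrete on L and J, Borel
   on each R_i). *)
Notation mstate R k := (g_sigma_algebraType (@state_gen R k)).

Section states.
Variables (R : realType) (k : nat).
Implicit Types x : state R k.

Definition active x : pred 'I_k.+1 :=
  fun i => if unlift ord0 i is Some j then j \in busy x else true.

(* Right-continuous version: at every time all events at that time have been
   processed, so that running clocks are strictly positive. *)
Definition state_space : set (state R k) :=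
  [set x | [/\ #|busy x| = minn (customers x) k,
               forall i, active x i -> 0 < residual x i
             & forall i, ~~ active x i -> residual x i = 0]].

Definition next_event x : R :=
  \big[Num.min/residual x ord0]_(i in busy x) residual x (lift ord0 i).

Definition elapse (s : R) x : state R k :=
  State (customers x) (busy x)
        (fun i => if active x i then residual x i - s else 0).

End states.

Section independence.
Context d (T : measurableType d) (R : realType) (P : probability T R).

Definition mutually_independent (I : eqType) (E : I -> set (set T)) : Prop :=
  forall (s : seq I) (A : I -> set T), uniq s ->
    (forall i, i \in s -> E i (A i)) ->
    P (\bigcap_(i in [set` s]) A i) = (\prod_(i <- s) P (A i))%E.

End independence.

Section queue.
Context d (T : measurableType d) (R : realType) (P : probability T R).
Variable k : nat.

(* Events generated by the primitives: inl (i, m) is the m-th time of clock i,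
   and inr (A, j, m) is the selection set D(A, j) of the m-th instant. *)
Definition primitive_events (tm : 'I_k.+1 -> nat -> {RV P >-> R})
    (sel : {set 'I_k} -> nat -> nat -> T -> {set 'I_k})
    (p : ('I_k.+1 * nat) + ({set 'I_k} * nat * nat)) : set (set T) :=
  match p with
  | inl (i, m) => preimage_set_system setT (tm i m) measurable
  | inr (A, j, m) => preimage_set_system setT (sel A j m) setT
  end.

Record hetero_queue := HeteroQueue {
  time : 'I_k.+1 -> nat -> {RV P >-> R};
  select : {set 'I_k} -> nat -> nat -> T -> {set 'I_k};
  time_ge0 : forall i m w, 0 <= time i m w;
  time_ident : forall i m (B : set R), measurable B ->
    distribution P (time i m) B = distribution P (time i 0) B;
  time_mean_fin : forall i, ('E_P[time i 0])%E \is a fin_num;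
  time_mean_gt0 : forall i, (0 < 'E_P[time i 0])%E;
  select_measurable : forall A j m S, measurable [set w | select A j m w = S];
  select_sub : forall A j m w, select A j m w \subset A;
  select_card : forall A j m w, #|select A j m w| = minn j #|A|;
  select_ident : forall A j m S,
    P [set w | select A j m w = S] = P [set w | select A j 0 w = S];
  primitive_independent :
    mutually_independent P (primitive_events time select) }.

Variable Q : hetero_queue.

(* T_i, a random variable with distribution F_i *)
Definition gtime (i : 'I_k.+1) : {RV P >-> R} := time Q i 0.

Definition rate (i : 'I_k.+1) : R := (fine 'E_P[gtime i]%E)^-1.

Definition stddev (i : 'I_k.+1) : R := Num.sqrt (fine 'V_P[gtime i]%E).

Definition load : R := rate ord0 / \sum_(i < k) rate (lift ord0 i).

(* The m-th event, applied to a state and to the number of times already used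
   of each clock.  A new time equal to 0 triggers a further event with no
   elapsed time. *)
Definition event (w : T) (m : nat) (p : state R k * ('I_k.+1 -> nat)) :
    state R k * ('I_k.+1 -> nat) :=
  let: (x, c) := p in
  let y := elapse (next_event x) x in
  let arrival := residual y ord0 == 0 in
  let completed := [set i in busy y | residual y (lift ord0 i) == 0] in
  let L := (customers y + arrival - #|completed|)%N in
  let serving := busy y :\: completed in
  let waiting := (L - #|serving|)%N in
  let started := select Q (~: serving) waiting m w in
  let fresh := fun i : 'I_k.+1 =>
    if unlift ord0 i is Some j then j \in started else arrival in
  let kept := fun i : 'I_k.+1 =>
    if unlift ord0 i is Some j then j \in serving else true in
  (State L (serving :|: started)
     (fun i => if fresh i then time Q i (c i) w
               else if kept i then residual y i else 0),
   fun i => (c i + fresh i)%N).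

Fixpoint chain (x : state R k) (w : T) (m : nat) :
    state R k * ('I_k.+1 -> nat) :=
  if m is m'.+1 then event w m' (chain x w m') else (x, fun=> 0%N).

Definition event_time (x : state R k) (w : T) (m : nat) : R :=
  \sum_(l < m) next_event (chain x w l).1.

(* X(t) from X(0) = x.  The default value of xget is reached only on the null
   event that infinitely many events occur before t. *)
Definition queue_process (x : state R k) (t : R) (w : T) : state R k :=
  let m := xget 0%N [set m | event_time x w m <= t < event_time x w m.+1] in
  elapse (t - event_time x w m) (chain x w m).1.

Definition transition (t : R) (x : state R k) (B : set (state R k)) : \bar R :=
  P [set w | B (queue_process x t w)].

Definition stationary_distribution (pi : probability (mstate R k) R) : Prop :=
  pi (@state_space R k) = 1%E /\
  forall (t : R) (B : set (mstate R k)), 0 <= t -> measurable B ->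
    (\int[pi]_x transition t x B = pi B)%E.

End queue.

(* Main.v *)
(* Let [f = z ^ W * \prod_i g_i(R_i)], where [W] is the number of waiting customers,
   [g_i(0) = 1], [E g_0(T_0) = 1 / z] and [E g_i(T_i) = z] for [i] in [K].  Arrivals
   lengthen the waiting line and draw [T_0], service starts shorten it and draw
   [T_i]; hence events do not change the mean of [f], and stationarity over a
   time [t -> 0] leaves [E (f(X) * \sum_i e_i(R_i)) = 0], the sum being over the
   running clocks and [e_i = - g_i' / g_i].

   Write [r] for [1 - rho], take [z = exp (- th r)] and [g_i] close to
   [u |-> exp (- eta_i min(u, 1 / r))].  The conditions on [E g_i(T_i)] determine
   [eta_i] up to [o(r^2)] from the first two moments of [T_i].  Moreover
   [1 - P(server i is busy) = O(r)], and the residual times exceed [ep / r] with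
   negligible probability, so the equation becomes
   [(th lambda_0 + th^2 S / 2) E z^L = th lambda_0 + o(1)] after division by [r^2],
   with [S = \sum_i lambda_i^3 sigma_i^2].  Thus [E exp (- th r L)] tends to the
   Laplace transform of the exponential law of rate [2 lambda_0 / S], which
   gives the limit of the distribution functions since indicators of
   half-lines are limits of polynomials in [exp (- th s)]. *)
Require Import Defs.
From HB Require Import structures.
From mathcomp Require Import all_boot all_order all_algebra.
From mathcomp Require Import all_classical all_reals all_analysis.
From mathcomp Require Import measurable_realfun.
From mathcomp Require Import ring lra zify.

Set Implicit Arguments.
Unset Strict Implicit.
Unset Printing Implicit Defensive.

Import Order.TTheory GRing.Theory Num.Theory.
Import numFieldNormedType.Exports.

Local Open Scope classical_set_scope.
Local Open Scope ring_scope.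


(** * The event map *)

(** The waiting line, rather than the number in system, is weighted because it moves exactly when a
    time is drawn: each change of [z ^ W] is compensated by the mean of the new clock, whichever
    servers are selected, and completions are invisible since [g_i(0) = 1]. As times may be 0,
    infinitely many events in finite time must be excluded before the jumps can be summed; a second
    test function of product form does this. The cap at [1 / r] keeps [f] bounded although
    [eta_0 < 0] for small [r] and only second moments exist; beyond it a clock has no slope, which
    costs a probability [o(r)]. The bound on the idle probabilities and the law of the residual
    times come from the same stationary equation at first order in [1 - z], with arbitrary caps. The
    first-order parts of the [eta_i] sum to [th r (\sum_(i in K) lambda_i - lambda_0)], itself of
    order [r ^ 2]. All retained terms are thus of order [r ^ 2] and every error has to be
    [o(r ^ 2)]; the means of the clocks are therefore prescribed exactly, by a linear correction to
    the exponentials. *)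

Section dynamics.
Variables (R : realType) (k : nat).
Implicit Types (x : state R k) (D : {set 'I_k}) (tm : 'I_k.+1 -> nat -> R)
  (sel : {set 'I_k} -> nat -> nat -> {set 'I_k}) (T : 'I_k.+1 -> R).

Notation config := (state R k * ('I_k.+1 -> nat))%type.

Definition hit x : state R k := elapse (next_event x) x.

Definition arrived x : bool := residual (hit x) ord0 == 0.

Definition completed x : {set 'I_k} :=
  [set i in busy x | residual (hit x) (lift ord0 i) == 0].

Definition serving x : {set 'I_k} := busy x :\: completed x.

Definition total x : nat := (customers x + arrived x - #|completed x|)%N.

Definition queue x : nat := (total x - #|serving x|)%N.

Definition fresh x D : pred 'I_k.+1 := fun i =>
  if unlift ord0 i is Some j then j \in D else arrived x.

Definition kept x (i : 'I_k.+1) : R :=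
  if (if unlift ord0 i is Some j then j \in serving x else true)
  then residual (hit x) i else 0.

Definition restart (T : 'I_k.+1 -> R) x D : state R k :=
  State (total x) (serving x :|: D)
    (fun i => if fresh x D i then T i else kept x i).

Definition step (tm : 'I_k.+1 -> nat -> R)
    (sel : {set 'I_k} -> nat -> {set 'I_k}) (p : config) : config :=
  let D := sel (~: serving p.1) (queue p.1) in
  (restart (fun i => tm i (p.2 i)) p.1 D,
   fun i => (p.2 i + fresh p.1 D i)%N).

(** Times and selections are arguments so that a single time can later be replaced; [chain] is the
    instance at the primitives of the queue ([chain_run]). *)
Fixpoint run (tm : 'I_k.+1 -> nat -> R)
    (sel : {set 'I_k} -> nat -> nat -> {set 'I_k}) x (m : nat) : config :=
  if m is m'.+1 then step tm (fun A j => sel A j m') (run tm sel x m')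
  else (x, fun=> 0%N).

Definition run_time tm sel x m : R :=
  \sum_(l < m) next_event (run tm sel x l).1.

Lemma run_timeS tm sel x m :
  run_time tm sel x m.+1
  = run_time tm sel x m + next_event (run tm sel x m).1.
Proof. by rewrite /run_time big_ord_recr. Qed.

Lemma run_time0 tm sel x : run_time tm sel x 0 = 0.
Proof. by rewrite /run_time big_ord0. Qed.

Lemma run_counter_leS tm sel x m i :
  ((run tm sel x m).2 i <= (run tm sel x m.+1).2 i)%N.
Proof. by rewrite /= leq_addr. Qed.

Lemma run_counter_le tm sel x m i : ((run tm sel x m).2 i <= m)%N.
Proof.
elim: m => //= m IHm.
by rewrite -[m.+1]addn1 leq_add// leq_b1.
Qed.

(** The first [m] events read only times of index below the counters they reach, and counters never
    decrease. Only the counters of the unprimed run enter, so having counters [c] after [m] events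
    is a property insensitive to the times of index [c i] and above. *)
Lemma run_ext tm tm' sel sel' x m c :
  (run tm sel x m).2 = c ->
  (forall i l, (l < c i)%N -> tm' i l = tm i l) ->
  (forall A j l, (l < m)%N -> sel' A j l = sel A j l) ->
  run tm' sel' x m = run tm sel x m.
Proof.
elim: m c => //= m IHm c cE tmE selE.
have IH : run tm' sel' x m = run tm sel x m.
  apply: (IHm _ erefl) => [i l lc|A j l lm].
    by apply: tmE; rewrite -cE; apply: leq_trans lc _; rewrite leq_addr.
  by apply: selE; exact: ltnW.
rewrite /step IH selE//; congr (_, _).
congr State; apply: funext => i; case: ifPn => // fi.
by apply: tmE; rewrite -cE /= fi addn1.
Qed.

Lemma run_ext_le tm tm' sel sel' x m c n :
  (run tm sel x m).2 = c ->
  (forall i l, (l < c i)%N -> tm' i l = tm i l) ->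
  (forall A j l, (l < m)%N -> sel' A j l = sel A j l) ->
  (n <= m)%N -> run tm' sel' x n = run tm sel x n.
Proof.
move=> cE tmE selE nm; apply: (run_ext erefl) => [i l lc|A j l ln].
  apply: tmE; rewrite -cE; apply: leq_trans lc _.
  move/subnK : nm => <-; elim: (m - n)%N => // p IHp.
  by apply: leq_trans IHp _; rewrite addSn run_counter_leS.
by apply: selE; exact: leq_trans ln nm.
Qed.

Lemma run_time_ext tm tm' sel sel' x m c :
  (run tm sel x m).2 = c ->
  (forall i l, (l < c i)%N -> tm' i l = tm i l) ->
  (forall A j l, (l < m)%N -> sel' A j l = sel A j l) ->
  run_time tm' sel' x m = run_time tm sel x m.
Proof.
move=> cE tmE selE; apply: eq_bigr => l _.
by rewrite (run_ext_le cE tmE selE)// ltnW.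
Qed.

Lemma active0 x : active x ord0.
Proof. by rewrite /active unlift_none. Qed.

Lemma active_lift x j : active x (lift ord0 j) = (j \in busy x).
Proof. by rewrite /active liftK. Qed.

Lemma next_event_le x i : active x i -> next_event x <= residual x i.
Proof.
case: (unliftP ord0 i) => [j ->|->].
  rewrite active_lift /next_event => jb.
  by rewrite (bigD1 j)//= ge_min lexx.
by move=> _; rewrite /next_event; elim/big_rec: _ => // j y _; rewrite ge_min orbC => ->.
Qed.

Lemma next_event_attained x : exists2 i, active x i & next_event x = residual x i.
Proof.
rewrite /next_event; elim/big_rec: _ => [|j y jb [i ai ->]].
  by exists ord0 => //; exact: active0.
rewrite /Num.min; case: ifPn => _; last by exists i.
by exists (lift ord0 j) => //; rewrite active_lift.
Qed.

(** Weaker than [state_space]: it survives events that draw a time equal to 0 and any selection of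
    at most [queue] servers. *)
Definition valid x : Prop :=
  [/\ (#|busy x| <= customers x)%N, forall i, 0 <= residual x i
    & forall i, ~~ active x i -> residual x i = 0].

Lemma state_space_valid x : state_space x -> valid x.
Proof.
move=> [bE pos zero]; split=> //; first by rewrite bE geq_minl.
move=> i; have [ai|/zero->//] := boolP (active x i); exact/ltW/pos.
Qed.

Lemma next_event_ge0 x : valid x -> 0 <= next_event x.
Proof. by move=> [_ p _]; have [i _ ->] := next_event_attained x. Qed.

Lemma elapse_valid s x : s <= next_event x -> valid x -> valid (elapse s x).
Proof.
move=> sn [bL p z]; split=> // [i|i]; rewrite /elapse /=.
  case: ifPn => // ai; rewrite subr_ge0 (le_trans sn)//; exact: next_event_le.
by rewrite /active/= -/(active x i) => /negPf ->.
Qed.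

Lemma completed_sub x : completed x \subset busy x.
Proof. by apply/fintype.subsetP => i; rewrite inE => /andP[]. Qed.

Lemma card_serving x : #|serving x| = (#|busy x| - #|completed x|)%N.
Proof. by rewrite cardsD (finset.setIidPr _)//; exact: completed_sub. Qed.

Lemma card_completed_le x : (#|completed x| <= #|busy x|)%N.
Proof. exact: subset_leq_card (completed_sub x). Qed.

(** The clock attaining the minimum reads 0 after [elapse]. This makes every event cost at least one
    factor in [restart_contract]. *)
Lemma event_occurs x : (0 < arrived x + #|completed x|)%N.
Proof.
have [i ai nE] := next_event_attained x.
have h0 : residual (hit x) i == 0 by rewrite /hit/= ai nE subrr.
case: (unliftP ord0 i) h0 ai => [j ->|->] h0 ai; last by rewrite /arrived h0.
rewrite addn_gt0; apply/orP; right; apply/card_gt0P; exists j.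
by rewrite inE h0 andbT -active_lift.
Qed.

Lemma active_restart T x D i :
  active (restart T x D) i =
  fresh x D i || (if unlift ord0 i is Some j then j \in serving x else true).
Proof.
rewrite /active/fresh; case: unliftP => [j _|_]; last by rewrite orbT.
by rewrite inE orbC.
Qed.

Lemma kept_ge0 x : valid x -> forall i, 0 <= kept x i.
Proof.
move=> vx i; rewrite /kept.
have [_ p _] := elapse_valid (lexx _) vx.
by case: ifP => // _; exact: p.
Qed.

Lemma restart_valid T x D : valid x -> (forall i, 0 <= T i) ->
  (#|D| <= queue x)%N -> valid (restart T x D).
Proof.
move=> vx T0 Dq; split=> [|i|i].
- rewrite /=; apply: leq_trans (leq_card_setU _ _) _.
  move: Dq; rewrite /queue /total card_serving.
  case: vx => bL _ _; have := card_completed_le x; lia.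
- by rewrite /=; case: ifP => // _; exact: kept_ge0.
- rewrite active_restart negb_or => /andP[/negPf nf /negPf ns] /=.
  by rewrite nf /kept ns.
Qed.

Lemma run_valid tm sel x : valid x -> (forall i l, 0 <= tm i l) ->
  (forall A j m, (#|sel A j m| <= j)%N) ->
  forall m, valid (run tm sel x m).1.
Proof. by move=> vx t0 s0; elim=> // m IHm; exact: restart_valid. Qed.

Lemma run_time_le tm sel x m1 m2 : valid x -> (forall i l, 0 <= tm i l) ->
  (forall A j m, (#|sel A j m| <= j)%N) -> (m1 <= m2)%N ->
  run_time tm sel x m1 <= run_time tm sel x m2.
Proof.
move=> vx t0 s0 /subnK <-; elim: (m2 - m1)%N => // n IHn.
rewrite addSn run_timeS (le_trans IHn)// lerDl; apply: next_event_ge0.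
exact: run_valid.
Qed.

(** A completion removes one customer and one busy server, so the number of waiting customers
    changes only through arrivals and service starts. *)
Lemma restart_waiting T x D : valid x -> D \subset ~: serving x ->
  (#|D| <= queue x)%N ->
  (customers (restart T x D) - #|busy (restart T x D)| + #|D| =
   customers x - #|busy x| + arrived x)%N.
Proof.
move=> [bL _ _] /fintype.subsetP DS Dq /=.
have -> : #|serving x :|: D| = (#|serving x| + #|D|)%N.
  rewrite cardsU (_ : _ :&: _ = finset.set0) ?cards0 ?subn0//.
  apply/setP => i; rewrite finset.in_setI finset.in_set0; apply/negP => /andP[iS iD].
  by have := DS i iD; rewrite finset.in_setC iS.
move: Dq; rewrite /queue /total card_serving.
have := card_completed_le x.
move: bL; move: #|busy x| #|completed x| #|D| (nat_of_bool (arrived x)) => b c e a.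
lia.
Qed.

End dynamics.

(** * Means of bounded functions *)

Section bounded_measurable.
Context d (T : measurableType d) (R : realType).
Implicit Types f g : T -> R.

(** Under a probability this implies integrability, so the rules for means below carry no other side
    condition. *)
Definition bounded_mfun f : Prop :=
  measurable_fun setT f /\ exists M : R, forall x, `|f x| <= M.

Lemma bounded_mfun_cst (c : R) : bounded_mfun (fun=> c).
Proof. by split; [exact: measurable_cst|exists `|c|]. Qed.

Lemma bounded_mfunD f g :
  bounded_mfun f -> bounded_mfun g -> bounded_mfun (fun x => f x + g x).
Proof.
move=> [mf [M fM]] [mg [N gN]]; split; first exact: measurable_funD.
by exists (M + N) => x; rewrite (le_trans (ler_normD _ _))// lerD.
Qed.

Lemma bounded_mfunM f g :
  bounded_mfun f -> bounded_mfun g -> bounded_mfun (fun x => f x * g x).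
Proof.
move=> [mf [M fM]] [mg [N gN]]; split; first exact: measurable_funM.
by exists (M * N) => x; rewrite normrM ler_pM.
Qed.

Lemma bounded_mfunN f : bounded_mfun f -> bounded_mfun (fun x => - f x).
Proof.
move=> [mf [M fM]]; split; first exact: measurableT_comp.
by exists M => x; rewrite normrN.
Qed.

Lemma bounded_mfunB f g :
  bounded_mfun f -> bounded_mfun g -> bounded_mfun (fun x => f x - g x).
Proof. by move=> bf bg; apply: bounded_mfunD => //; exact: bounded_mfunN. Qed.

Lemma bounded_mfun_norm f : bounded_mfun f -> bounded_mfun (fun x => `|f x|).
Proof.
move=> [mf [M fM]]; split; first exact: measurableT_comp.
by exists M => x; rewrite normr_id.
Qed.

Lemma bounded_mfun_sum I (s : seq I) (Q : pred I) (h : I -> T -> R) :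
  (forall i, bounded_mfun (h i)) ->
  bounded_mfun (fun x => \sum_(i <- s | Q i) h i x).
Proof.
move=> hb; elim: s => [|i s IHs].
  by under eq_fun do rewrite big_nil; exact: bounded_mfun_cst.
under eq_fun do rewrite big_cons; case: (Q i) => //.
exact: bounded_mfunD.
Qed.

Lemma bounded_mfun_prod I (s : seq I) (Q : pred I) (h : I -> T -> R) :
  (forall i, bounded_mfun (h i)) ->
  bounded_mfun (fun x => \prod_(i <- s | Q i) h i x).
Proof.
move=> hb; elim: s => [|i s IHs].
  by under eq_fun do rewrite big_nil; exact: bounded_mfun_cst.
under eq_fun do rewrite big_cons; case: (Q i) => //.
exact: bounded_mfunM.
Qed.

Lemma bounded_mfun_bool (b : T -> bool) :
  measurable [set x | b x] -> bounded_mfun (fun x => (b x)%:R).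
Proof.
move=> mb; split; last first.
  by exists 1 => x; case: (b x); rewrite ?normr1 ?normr0.
rewrite (_ : (fun x => _) = \1_[set x | b x]); first exact: measurable_indic.
by apply/funext => x; rewrite indicE mem_setE.
Qed.

Variable P : probability T R.

Lemma bounded_mfun_integrable f :
  bounded_mfun f -> P.-integrable setT (EFin \o f).
Proof.
move=> [mf [M fM]]; apply: measurable_bounded_integrable => //.
  by rewrite (le_lt_trans (probability_le1 _ _))// ltry.
exists M; split; first exact: num_real.
by move=> y My x _; apply: le_trans (fM x) _; exact: ltW.
Qed.

Lemma mean_cst (c : R) : \int[P]_x c = c.
Proof.
rewrite Rintegral_cst//; transitivity (c * fine (1%E : \bar R)).
  by congr (c * fine _); exact: probability_setT.
by rewrite /= mulr1.
Qed.

Lemma meanD f g : bounded_mfun f -> bounded_mfun g ->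
  \int[P]_x (f x + g x) = \int[P]_x f x + \int[P]_x g x.
Proof. by move=> bf bg; rewrite RintegralD//; exact: bounded_mfun_integrable. Qed.

Lemma meanB f g : bounded_mfun f -> bounded_mfun g ->
  \int[P]_x (f x - g x) = \int[P]_x f x - \int[P]_x g x.
Proof. by move=> bf bg; rewrite RintegralB//; exact: bounded_mfun_integrable. Qed.

Lemma meanZ f c : bounded_mfun f -> \int[P]_x (c * f x) = c * \int[P]_x f x.
Proof. by move=> bf; rewrite RintegralZl//; exact: bounded_mfun_integrable. Qed.

Lemma mean_sum I (s : seq I) (Q : pred I) (h : I -> T -> R) :
  (forall i, bounded_mfun (h i)) ->
  \int[P]_x (\sum_(i <- s | Q i) h i x) = \sum_(i <- s | Q i) \int[P]_x h i x.
Proof.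
move=> hb; elim: s => [|i s IHs].
  by under eq_Rintegral do rewrite big_nil; rewrite mean_cst big_nil.
under eq_Rintegral do rewrite big_cons; rewrite big_cons; case: (Q i) => //.
by rewrite meanD ?IHs//; exact: bounded_mfun_sum.
Qed.

Lemma le_mean f g : bounded_mfun f -> bounded_mfun g ->
  (forall x, f x <= g x) -> \int[P]_x f x <= \int[P]_x g x.
Proof.
by move=> bf bg fg; apply: le_Rintegral => //; exact: bounded_mfun_integrable.
Qed.

Lemma norm_mean_le f g : bounded_mfun f -> bounded_mfun g ->
  (forall x, `|f x| <= g x) -> `|\int[P]_x f x| <= \int[P]_x g x.
Proof.
move=> bf bg fg.
rewrite (le_trans (le_normr_Rintegral _ (bounded_mfun_integrable bf)))//.
by apply: le_mean => //; exact: bounded_mfun_norm.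
Qed.

Lemma mean_bool (b : T -> bool) : measurable [set x | b x] ->
  \int[P]_x (b x)%:R = fine (P [set x | b x]).
Proof.
move=> mb; rewrite /Rintegral; congr fine.
transitivity (\int[P]_x (\1_[set x | b x] x)%:E)%E.
  by apply: eq_integral => x _; rewrite indicE mem_setE.
by rewrite integral_indic// setIT.
Qed.

Lemma mean_ae_eq f g (A : set T) : bounded_mfun f -> bounded_mfun g ->
  measurable A -> P A = 1%E -> (forall x, A x -> f x = g x) ->
  \int[P]_x f x = \int[P]_x g x.
Proof.
move=> bf bg mA PA fg; rewrite /Rintegral; congr fine.
apply: ae_eq_integral => //.
- by apply/measurable_EFinP; case: bf.
- by apply/measurable_EFinP; case: bg.
- exists (~` A); split; first exact: measurableC.
    by apply: (etrans (probability_setC P mA)); rewrite PA subee.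
  by move=> x /= nfg Ax; apply: nfg => _; rewrite fg.
Qed.

End bounded_measurable.

Lemma bounded_mfun_comp d1 d2 (T1 : measurableType d1) (T2 : measurableType d2)
    (R : realType) (f : T2 -> R) (h : T1 -> T2) :
  measurable_fun setT h -> bounded_mfun f -> bounded_mfun (fun x => f (h x)).
Proof.
move=> mh [mf [M fM]]; split; first exact: measurableT_comp.
by exists M.
Qed.

(** * Independence *)

Section independent_product.
Context d (T : measurableType d) (R : realType) (P : probability T R).

(** The condition on rectangles makes the joint law the product of the two marginal laws; Fubini
    then splits the integral of the product. *)
Lemma mean_independentM (U V : T -> R) :
  bounded_mfun U -> bounded_mfun V ->
  (forall A B : set R, measurable A -> measurable B ->
     (P (U @^-1` A `&` V @^-1` B) = P (U @^-1` A) * P (V @^-1` B))%E) ->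
  \int[P]_x (U x * V x) = \int[P]_x U x * \int[P]_x V x.
Proof.
move=> bU bV UV; have [mU _] := bU; have [mV _] := bV.
pose U' : {RV P >-> R} :=
  HB.pack U (isMeasurableFun.Build _ _ _ _ _ mU).
pose V' : {RV P >-> R} :=
  HB.pack V (isMeasurableFun.Build _ _ _ _ _ mV).
have mUV : measurable_fun setT (fun x => (U x, V x)).
  exact: measurable_fun_pair.
pose W : {RV P >-> (R * R)%type} :=
  HB.pack (fun x => (U x, V x)) (isMeasurableFun.Build _ _ _ _ _ mUV).
have lawE X : measurable X ->
    (distribution P U' \x distribution P V')%E X = distribution P W X.
  by apply: product_measure_unique => A B mA mB; exact: UV.
have mM : measurable_fun setT (fun p : R * R => (p.1 * p.2)%:E).
  apply/measurable_EFinP; exact: measurable_funM.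
have iUV : P.-integrable setT ((fun p : R * R => (p.1 * p.2)%:E) \o W).
  exact: (bounded_mfun_integrable P (bounded_mfunM bU bV)).
rewrite /Rintegral.
have -> : (\int[P]_x (U x * V x)%:E =
    \int[distribution P W]_p (p.1 * p.2)%:E)%E.
  by rewrite integral_distribution.
have -> : (\int[distribution P W]_p (p.1 * p.2)%:E =
   \int[(distribution P U' \x distribution P V')%E]_p (p.1 * p.2)%:E)%E.
  by apply: eq_measure_integral => A mA _; exact/esym/lawE.
rewrite -integral12_prod_meas1; last first.
  have /integrableP[_ iW] := integrable_pushforward mUV mM iUV measurableT.
  apply/integrableP; split => //; rewrite (le_lt_trans _ iW)//.
  rewrite le_eqVlt; apply/orP; left; apply/eqP.
  by apply: eq_measure_integral => A mA _; exact: lawE.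
have mE : measurable_fun [set: R] (EFin \o id) by exact/measurable_EFinP.
have iV : (distribution P V').-integrable setT (EFin \o id).
  exact: (integrable_pushforward mV mE (bounded_mfun_integrable P bV)).
have iU : (distribution P U').-integrable setT (EFin \o id).
  exact: (integrable_pushforward mU mE (bounded_mfun_integrable P bU)).
transitivity (fine (\int[distribution P U']_x (x%:E *
    \int[distribution P V']_y y%:E))%E).
  by congr fine; apply: eq_integral => x _; rewrite -integralZl.
have EV : (\int[distribution P V']_y y%:E = \int[P]_x (V x)%:E)%E.
  rewrite (integral_distribution (X := V') (f := EFin))//.
  exact: (bounded_mfun_integrable P bV).
have EU : (\int[distribution P U']_y y%:E = \int[P]_x (U x)%:E)%E.
  rewrite (integral_distribution (X := U') (f := EFin))//.
  exact: (bounded_mfun_integrable P bU).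
rewrite EV.
have Vf := integrable_fin_num measurableT (bounded_mfun_integrable P bV).
have Uf := integrable_fin_num measurableT (bounded_mfun_integrable P bU).
rewrite -[X in (\int[_]_x (_ * X))%E]fineK// integralZr// EU.
by rewrite fineM.
Qed.

End independent_product.

Section independent_families.
Context d (T : measurableType d) (R : realType) (P : probability T R).
Variables (I : choiceType) (E : I -> set (set T)).
Hypothesis E_measurable : forall i, E i `<=` measurable.
Hypothesis E_setT : forall i, E i setT.
Hypothesis E_setI : forall i, setI_closed (E i).
Hypothesis E_indep : mutually_independent P E.

Definition other_events (i : I) : set (set T) := \bigcup_(j in [set~ i]) E j.

(** Finite intersections of events with indices other than [i] are stable under intersection and
    generate the sigma-algebra, so two measures that agree on them coincide. *)
Lemma independent_of_others i A B :
  <<s other_events i >> A -> E i B -> (P (A `&` B) = P A * P B)%E.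
Proof.
move=> sA EB.
pose C : set (set T) := [set A | exists s (F : I -> set T),
  [/\ uniq s, i \notin s, forall j, E j (F j)
    & A = \bigcap_(j in [set` s]) F j]].
have subC : other_events i `<=` C.
  move=> X [j /= ji EX]; exists [:: j], (fun l => if l == j then X else setT).
  split=> //.
  - by rewrite inE eq_sym; exact/eqP.
  - by move=> l; case: eqP => [->//|_]; exact: E_setT.
  - apply/seteqP; split=> [x Xx l /=|x /(_ j) /=].
      by rewrite inE => ->.
    by rewrite inE eqxx; exact.
have {}sA : <<s C >> A.
  by apply: sub_sigma_algebra2 sA.
have mB : measurable B by exact: E_measurable EB.
have PB0 : (0 <= fine (P B))%R by exact: fine_ge0.
rewrite muleC -[P B]fineK ?fin_num_measure//.
(* Both sides are finite measures in [A]: the restriction of [P] to [B], and [P] scaled by the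
   constant [P B]. *)
have -> : P (A `&` B) = mrestr P mB A by [].
rewrite -[RHS]/(mscale (NngNum PB0) P A).
apply: (g_sigma_algebra_measure_unique C _ (fun=> setT)) => //.
- move=> X [s [F [_ _ EF ->]]]; apply: fin_bigcap_measurable.
    exact: finite_seq.
  by move=> j _; exact/E_measurable/EF.
- move=> _; exists [::], (fun=> setT); split=> //.
  by rewrite set_nil bigcap_set0.
- by rewrite bigcup_const//; exists 0%N.
(* Stability under intersection: the two index lists are merged, with [setT] for an index absent
   from one of them. *)
- move=> _ _ [s [F [us is_ EF ->]]] [s' [F' [us' is_' EF' ->]]].
  exists (undup (s ++ s')), (fun j => (if j \in s then F j else setT) `&`
    (if j \in s' then F' j else setT)); split.
  + exact: undup_uniq.
  + by rewrite mem_undup mem_cat negb_or is_.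
  + by move=> j; apply: E_setI; case: ifP => // _; exact: E_setT.
  + apply/seteqP; split=> [x [xF xF'] j /= _|x xFF].
      split; case: ifPn => // js; [exact: xF|exact: xF'].
    split=> j /= js.
      by have := xFF j; rewrite /= mem_undup mem_cat js => /(_ isT)[].
    by have := xFF j; rewrite /= mem_undup mem_cat js orbT => /(_ isT)[].
- move=> _ [s [F [us is_ EF ->]]].
  suff : (P (\bigcap_(j in [set` s]) F j `&` B) =
      P B * P (\bigcap_(j in [set` s]) F j))%E.
    move=> PE; apply: (etrans PE).
    change (P B * P (\bigcap_(j in [set` s]) F j) =
      (fine (P B))%:E * P (\bigcap_(j in [set` s]) F j))%E.
    by rewrite fineK// fin_num_measure.
  have -> : \bigcap_(j in [set` s]) F j `&` B =
     \bigcap_(j in [set` i :: s]) (if j == i then B else F j).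
    apply/seteqP; split=> [x [Fx Bx] j /=|x FBx].
      rewrite inE; case: eqVneq => [//|ji /=]; exact: Fx.
    split; last by have := FBx i; rewrite /= inE eqxx => /(_ isT).
    move=> j /= js; have := FBx j; rewrite /= inE js orbT => /(_ isT).
    by case: eqP => // ji; rewrite -ji js in is_.
  rewrite E_indep/= ?is_//; last first.
    by move=> j _; case: eqP => [->//|_].
  rewrite big_cons eqxx; congr (_ * _)%E; rewrite E_indep//.
  rewrite big_seq [RHS]big_seq; apply: eq_bigr => j js.
  by case: eqP => // ji; rewrite -ji js in is_.
- move=> _; have PB1 : (P (setT `&` B) < +oo)%E.
    by rewrite setTI (le_lt_trans (probability_le1 P mB))// ltry.
  exact: PB1.
Qed.

End independent_families.

(** * Measurability of the dynamics *)

Section discrete_measurable.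
Context d (Om : measurableType d).

Lemma bigcup_countType_measurable (T : countType) (S : set T) (F : T -> set Om) :
  (forall t, S t -> measurable (F t)) -> measurable (\bigcup_(t in S) F t).
Proof.
move=> mF; rewrite (_ : \bigcup_(t in S) F t = \bigcup_(n in
    [set n | exists2 t, S t & unpickle n = Some t])
    (if unpickle n is Some t then F t else set0)).
  by apply: bigcup_measurable => n [t St ->]; exact: mF.
apply/seteqP; split=> [w [t St Ft]|w [n [t St /= ->] Ft]]; last by exists t.
by exists (pickle t); rewrite /= ?pickleK//; exists t.
Qed.

(** For a countable target measurability is stated on fibers, so that no sigma-algebra has to be
    chosen there. *)
Definition discrete_mfun (T : countType) (h : Om -> T) : Prop :=
  forall t, measurable (h @^-1` [set t]).

Lemma discrete_mfun_preimage (T : countType) (h : Om -> T) (S : set T) :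
  discrete_mfun h -> measurable (h @^-1` S).
Proof.
move=> mh; rewrite (_ : h @^-1` S = \bigcup_(t in S) (h @^-1` [set t])).
  by apply: bigcup_countType_measurable.
by apply/seteqP; split=> [w Sw|w [t St /= ->]//]; exists (h w).
Qed.

Lemma discrete_mfun_cst (T : countType) (t : T) : discrete_mfun (fun=> t).
Proof.
move=> s; have [->|ts] := eqVneq t s.
  by rewrite (_ : _ @^-1` _ = setT)//; apply/seteqP; split.
rewrite (_ : _ @^-1` _ = set0)//; apply/seteqP; split=> // w /= /eqP.
by rewrite (negPf ts).
Qed.

Lemma discrete_mfun_comp (T T' : countType) (h : Om -> T) (phi : T -> T') :
  discrete_mfun h -> discrete_mfun (fun w => phi (h w)).
Proof. by move=> mh t; exact: (discrete_mfun_preimage (phi @^-1` [set t]) mh). Qed.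

(** Cutting the space along the countably many values of [h] reduces random counters, busy sets and
    selections to fixed ones. *)
Lemma discrete_mfun_glue (T T' : countType) (h : Om -> T) (F : T -> Om -> T') :
  discrete_mfun h -> (forall t, discrete_mfun (F t)) ->
  discrete_mfun (fun w => F (h w) w).
Proof.
move=> mh mF s; rewrite (_ : _ @^-1` _ =
    \bigcup_(t in setT) (h @^-1` [set t] `&` F t @^-1` [set s])).
  apply: bigcup_countType_measurable => t _.
  by apply: measurableI; [exact: mh|exact: mF].
by apply/seteqP; split=> [w /= Fw|w [t _ [/= -> ->]]//]; exists (h w).
Qed.

Lemma discrete_mfun_pair (T T' : countType) (h : Om -> T) (h' : Om -> T') :
  discrete_mfun h -> discrete_mfun h' -> discrete_mfun (fun w => (h w, h' w)).
Proof.
move=> mh mh'; apply: (discrete_mfun_glue (F := fun t w => (t, h' w)) mh) => t.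
exact: (discrete_mfun_comp (fun t' => (t, t')) mh').
Qed.

Lemma measurable_glue d' (Y : measurableType d') (T : countType)
    (h : Om -> T) (F : T -> Om -> Y) :
  discrete_mfun h -> (forall t, measurable_fun setT (F t)) ->
  measurable_fun setT (fun w => F (h w) w).
Proof.
move=> mh mF _ B mB; rewrite setTI (_ : _ @^-1` _ =
    \bigcup_(t in setT) (h @^-1` [set t] `&` F t @^-1` B)).
  apply: bigcup_countType_measurable => t _.
  apply: measurableI; first exact: mh.
  by rewrite -[X in measurable X]setTI; exact: mF.
by apply/seteqP; split=> [w /= Fw|w [t _ [/= -> ]]//]; exists (h w).
Qed.

Lemma discrete_mfun_bool (b : Om -> bool) :
  measurable [set w | b w] -> discrete_mfun b.
Proof.
move=> mb [|].
  by rewrite (_ : _ @^-1` _ = [set w | b w]).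
rewrite (_ : _ @^-1` _ = ~` [set w | b w]); first exact: measurableC.
by apply/seteqP; split=> [w /= ->//|w /= /negP/negPf].
Qed.

Lemma measurable_eq0 (R : realType) (f : Om -> R) :
  measurable_fun setT f -> measurable [set w | f w == 0].
Proof.
move=> mf; rewrite (_ : [set w | _] = setT `&` f @^-1` [set 0]).
  by apply: mf => //; exact: measurable_set1.
by rewrite setTI; apply/seteqP; split=> w /= /eqP.
Qed.

Lemma measurable_le (R : realType) (f g : Om -> R) :
  measurable_fun setT f -> measurable_fun setT g ->
  measurable [set w | f w <= g w].
Proof.
move=> mf mg; rewrite (_ : [set w | _] = setT `&` (g \- f) @^-1` `[0, +oo[).
  by apply: measurable_funB => //; exact: measurable_itv.
by rewrite setTI; apply/seteqP; split=> w /=; rewrite in_itv/= andbT subr_ge0.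
Qed.

Lemma measurable_lt (R : realType) (f g : Om -> R) :
  measurable_fun setT f -> measurable_fun setT g ->
  measurable [set w | f w < g w].
Proof.
move=> mf mg; rewrite (_ : [set w | _] = ~` [set w | g w <= f w]).
  by apply: measurableC; exact: measurable_le.
by apply/seteqP; split=> w /=; rewrite ltNge => /negP.
Qed.

End discrete_measurable.

Section run_measurable.
Context d (Om : measurableType d).
Variables (R : realType) (k : nat).
Implicit Types X : Om -> state R k.

Definition mstate_fun X : Prop :=
  [/\ discrete_mfun (fun w => customers (X w)),
      discrete_mfun (fun w => busy (X w))
    & forall i, measurable_fun setT (fun w => residual (X w) i)].

Lemma mstate_fun_cst (x : state R k) : mstate_fun (fun=> x).
Proof.
by split=> [||i]; [exact: discrete_mfun_cst|exact: discrete_mfun_cst|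
  exact: measurable_cst].
Qed.

Lemma mstate_funP X : mstate_fun X -> measurable_fun setT (X : Om -> mstate R k).
Proof.
move=> [mL mJ mR]; apply: (@measurability _ _ Om (mstate R k) setT X (@state_gen R k) erefl).
move=> _ [A [[B ->]|[B ->]|[i [B [mB ->]]]] <-]; rewrite setTI.
- exact: (discrete_mfun_preimage B mL).
- exact: (discrete_mfun_preimage B mJ).
- by rewrite -[X in measurable X]setTI; exact: (mR i).
Qed.

Lemma measurable_next_event X : mstate_fun X ->
  measurable_fun setT (fun w => next_event (X w)).
Proof.
move=> [_ mJ mR]; rewrite /next_event.
apply: (measurable_glue (F := fun (B : {set 'I_k}) w => \big[Num.min/residual (X w) ord0]_(i in B)
  residual (X w) (lift ord0 i)) mJ) => B.
elim: (index_enum _) => [|i s IHs].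
  by under eq_fun do rewrite big_nil; exact: mR.
under eq_fun do rewrite big_cons; case: (i \in B) => //.
exact: measurable_minr.
Qed.

Definition activeb (B : {set 'I_k}) (i : 'I_k.+1) : bool :=
  if unlift ord0 i is Some j then j \in B else true.

Lemma mstate_fun_elapse X (s : Om -> R) : mstate_fun X ->
  measurable_fun setT s -> mstate_fun (fun w => elapse (s w) (X w)).
Proof.
move=> [mL mJ mR] ms; split=> // i.
apply: (measurable_glue (F := fun (B : {set 'I_k}) w => if activeb B i then
  residual (X w) i - s w else 0) mJ) => B; case: activeb.
  exact: measurable_funB.
exact: measurable_cst.
Qed.

Lemma mstate_fun_hit X : mstate_fun X -> mstate_fun (fun w => hit (X w)).
Proof. by move=> mX; apply: mstate_fun_elapse => //; exact: measurable_next_event. Qed.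

Lemma discrete_arrived X : mstate_fun X -> discrete_mfun (fun w => arrived (X w)).
Proof.
move=> /mstate_fun_hit[_ _ mR]; apply: discrete_mfun_bool.
exact: (measurable_eq0 (mR ord0)).
Qed.

Lemma discrete_setb (T : finType) (p : T -> Om -> bool) :
  (forall i, discrete_mfun (p i)) ->
  discrete_mfun (fun w => [set i | p i w]%SET).
Proof.
move=> mp B; rewrite (_ : _ @^-1` _ =
    \bigcap_(i in [set: T]) (p i @^-1` [set i \in B])).
  by apply: fin_bigcap_measurable => // i _; exact: mp.
apply/seteqP; split=> [w /= <- i _ /=|w pw /=]; first by rewrite inE.
by apply/setP => i; rewrite inE; exact: pw.
Qed.

Lemma discrete_completed X : mstate_fun X ->
  discrete_mfun (fun w => completed (X w)).
Proof.
move=> mX; have [_ mJ _] := mX; have [_ _ mR] := mstate_fun_hit mX.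
apply: discrete_setb => i.
apply: (discrete_mfun_glue (F := fun (B : {set 'I_k}) w => (i \in B) &&
  (residual (hit (X w)) (lift ord0 i) == 0)) mJ) => B.
case: (i \in B) => /=; last exact: discrete_mfun_cst.
by apply: discrete_mfun_bool; exact: (measurable_eq0 (mR _)).
Qed.

Lemma discrete_serving X : mstate_fun X -> discrete_mfun (fun w => serving (X w)).
Proof.
move=> mX; have [_ mJ _] := mX.
exact: (discrete_mfun_comp (fun p : {set 'I_k} * {set 'I_k} => p.1 :\: p.2)
  (discrete_mfun_pair mJ (discrete_completed mX))).
Qed.

Lemma discrete_total X : mstate_fun X -> discrete_mfun (fun w => total (X w)).
Proof.
move=> mX; have [mL _ _] := mX.
exact: (discrete_mfun_comp
  (fun p : (nat * bool) * {set 'I_k} => (p.1.1 + p.1.2 - #|p.2|)%N)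
  (discrete_mfun_pair (discrete_mfun_pair mL (discrete_arrived mX))
    (discrete_completed mX))).
Qed.

Lemma discrete_queue X : mstate_fun X -> discrete_mfun (fun w => queue (X w)).
Proof.
move=> mX; exact: (discrete_mfun_comp
  (fun p : nat * {set 'I_k} => (p.1 - #|p.2|)%N)
  (discrete_mfun_pair (discrete_total mX) (discrete_serving mX))).
Qed.

Lemma discrete_fresh X (D : Om -> {set 'I_k}) i : mstate_fun X ->
  discrete_mfun D -> discrete_mfun (fun w => fresh (X w) (D w) i).
Proof.
move=> mX mD; rewrite /fresh; case: unlift => [j|]; last exact: discrete_arrived.
exact: (discrete_mfun_comp (fun B : {set 'I_k} => j \in B) mD).
Qed.

Lemma measurable_kept X i : mstate_fun X ->
  measurable_fun setT (fun w => kept (X w) i).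
Proof.
move=> mX; have [_ _ mR] := mstate_fun_hit mX.
apply: (measurable_glue (F := fun (B : {set 'I_k}) w => if activeb B i then
  residual (hit (X w)) i else 0) (discrete_serving mX)) => B.
by case: activeb => //; exact: measurable_cst.
Qed.

Lemma mstate_fun_restart X (D : Om -> {set 'I_k}) (T : 'I_k.+1 -> Om -> R) :
  mstate_fun X -> discrete_mfun D -> (forall i, measurable_fun setT (T i)) ->
  mstate_fun (fun w => restart (fun i => T i w) (X w) (D w)).
Proof.
move=> mX mD mT; split=> [||i].
- exact: discrete_total.
- exact: (discrete_mfun_comp (fun p : {set 'I_k} * {set 'I_k} => p.1 :|: p.2)
    (discrete_mfun_pair (discrete_serving mX) mD)).
- apply: (measurable_glue (F := fun (b : bool) w => if b then T i w
    else kept (X w) i) (discrete_fresh i mX mD)) => -[//|].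
  exact: measurable_kept.
Qed.

Variables (X : Om -> state R k) (tm : 'I_k.+1 -> nat -> Om -> R)
  (sel : {set 'I_k} -> nat -> nat -> Om -> {set 'I_k}).
Hypothesis mX : mstate_fun X.
Hypothesis mtm : forall i m, measurable_fun setT (tm i m).
Hypothesis msel : forall A j m, discrete_mfun (sel A j m).

Definition run_of w m :=
  run (fun i l => tm i l w) (fun A j l => sel A j l w) (X w) m.

Definition select_of w m :=
  sel (~: serving (run_of w m).1) (queue (run_of w m).1) m w.

Lemma discrete_select_of m : mstate_fun (fun w => (run_of w m).1) ->
  discrete_mfun (select_of ^~ m).
Proof.
move=> mY; apply: (discrete_mfun_glue (F := fun p w => sel (~: p.1) p.2 m w)
  (discrete_mfun_pair (discrete_serving mY) (discrete_queue mY))) => p.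
exact: msel.
Qed.

(** The space, the initial state and the times are arbitrary: the lemma serves on the sigma-algebra
    of all primitives but one, and on the product of the state space with the probability space. *)
Lemma run_measurable m :
  mstate_fun (fun w => (run_of w m).1) /\
  forall i, discrete_mfun (fun w => (run_of w m).2 i).
Proof.
elim: m => [|m [mY mc]]; first by split=> // i; exact: discrete_mfun_cst.
have mD := discrete_select_of mY.
split.
- apply: (mstate_fun_restart (T := fun i w => tm i ((run_of w m).2 i) w)) => // i.
  exact: (measurable_glue (F := fun c w => tm i c w) (mc i)).
- move=> i; exact: (discrete_mfun_comp (fun p : nat * bool => (p.1 + p.2)%N)
    (discrete_mfun_pair (mc i) (discrete_fresh i mY mD))).
Qed.

Lemma run_time_measurable m : measurable_fun setT (fun w =>
  run_time (fun i l => tm i l w) (fun A j l => sel A j l w) (X w) m).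
Proof.
elim: m => [|m IHm].
  by under eq_fun do rewrite run_time0; exact: measurable_cst.
under eq_fun do rewrite run_timeS.
apply: measurable_funD => //; apply: measurable_next_event.
by case: (run_measurable m).
Qed.

End run_measurable.

(** * Fresh clocks and the past *)

Section restart_mean.
Context d (Om : measurableType d) (R : realType) (P : probability Om R).
Variables (k : nat) (Q : hetero_queue P k) (x : state R k).

Definition qrun w m :=
  run (fun i l => time Q i l w) (fun A j l => select Q A j l w) x m.

Definition qtime w m :=
  run_time (fun i l => time Q i l w) (fun A j l => select Q A j l w) x m.

Definition qselect w m :=
  select Q (~: serving (qrun w m).1) (queue (qrun w m).1) m w.

Lemma chain_run w m : chain Q x w m = qrun w m.
Proof. by elim: m => // m IHm; rewrite [LHS]/= IHm /qrun /=; case: run. Qed.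

Let E := primitive_events (time Q) (select Q).

Lemma primitive_measurable p : E p `<=` measurable.
Proof.
case: p => [[i m]|[[A j] m]] _ [B mB <-]; rewrite setTI.
  by rewrite -[X in measurable X]setTI; exact: measurable_funP.
apply: (discrete_mfun_preimage B (h := select Q A j m)).
exact: select_measurable.
Qed.

Lemma primitive_setT p : E p setT.
Proof.
case: p => [[i m]|[[A j] m]]; exists setT => //; by rewrite setTI preimage_setT.
Qed.

Lemma primitive_setI p : setI_closed (E p).
Proof.
case: p => [[i m]|[[A j] m]] _ _ [B mB <-] [C mC <-].
  by exists (B `&` C); [exact: measurableI|rewrite !setTI].
by exists (B `&` C) => //; rewrite !setTI.
Qed.

Notation others i l := (other_events E (inl (i, l))).

Lemma others_measurable i l : <<s others i l >> `<=` measurable.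
Proof.
apply: smallest_sub; first exact: sigma_algebra_measurable.
by move=> A [p _ EA]; exact: primitive_measurable EA.
Qed.

Lemma others_measurable_fun i l (f : Om -> R) :
  measurable_fun setT (f : g_sigma_algebraType (others i l) -> R) ->
  measurable_fun setT f.
Proof. by move=> mf _ B mB; apply: (@others_measurable i l); exact: mf. Qed.

Lemma mean_others i l (U : Om -> R) (g : R -> R) :
  measurable_fun setT (U : g_sigma_algebraType (others i l) -> R) ->
  (exists M : R, forall w, `|U w| <= M) -> bounded_mfun g ->
  \int[P]_w (U w * g (time Q i l w)) =
  \int[P]_w U w * \int[P]_w g (time Q i l w).
Proof.
move=> mU bU bg; apply: mean_independentM.
- by split=> //; exact: others_measurable_fun mU.
- exact: bounded_mfun_comp.
- move=> A B mA mB.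
  apply: (independent_of_others primitive_measurable primitive_setT
    primitive_setI (@primitive_independent _ _ _ _ _ Q)).
    by rewrite -[U @^-1` A]setTI; exact: mU.
  exists (g @^-1` B); last by rewrite setTI.
  by rewrite -[X in measurable X]setTI; apply: bg.1.
Qed.

(* A functional of the run built on these times does not depend on [time i l],
   hence is independent of it. *)
Definition time_but i l j m w : R :=
  if (j == i) && (m == l) then 0 else time Q j m w.

Lemma time_but_measurable i l j m :
  measurable_fun setT (time_but i l j m : g_sigma_algebraType (others i l) -> R).
Proof.
rewrite /time_but; have [_|ji] := boolP ((j == i) && (m == l)).
  exact: measurable_cst.
move=> _ B mB; apply: sub_sigma_algebra; exists (inl (j, m)).
  by move=> jm; move: ji; rewrite /= in jm; case: jm => -> ->; rewrite !eqxx.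
by exists B.
Qed.

Lemma select_discrete i l A j m : discrete_mfun
  (select Q A j m : g_sigma_algebraType (others i l) -> {set 'I_k}).
Proof.
move=> B; apply: sub_sigma_algebra; exists (inr (A, j, m)) => //.
by exists [set B] => //; rewrite setTI.
Qed.

(** Measurability is required after substitution from every space, so that the same functional can
    be read on the smaller sigma-algebra of [others]. *)
Definition step_mfun (v : state R k -> R -> {set 'I_k} -> R) : Prop :=
  (exists M : R, forall y s D, `|v y s D| <= M) /\
  forall d' (Om' : measurableType d') X s D, mstate_fun X ->
    measurable_fun setT s -> discrete_mfun D ->
    measurable_fun setT (fun w : Om' => v (X w) (s w) (D w)).

Implicit Types (v : state R k -> R -> {set 'I_k} -> R) (c : 'I_k.+1 -> nat).

Definition at_count (r : state R k * ('I_k.+1 -> nat)) c :=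
  [forall i, r.2 i == c i].

Lemma at_countP r c : reflect (r.2 = c) (at_count r c).
Proof.
apply: (iffP forallP) => [rc|-> i]; last exact: eqxx.
by apply: funext => i; exact/eqP.
Qed.

Section without_one.
Variables (i : 'I_k.+1) (c : 'I_k.+1 -> nat).

Definition run_but w m :=
  run (fun j l => time_but i (c i) j l w) (fun A j l => select Q A j l w) x m.

Definition runtime_but w m := run_time (fun j l => time_but i (c i) j l w)
  (fun A j l => select Q A j l w) x m.

Lemma time_butE w j n : (n < c j)%N -> time_but i (c i) j n w = time Q j n w.
Proof.
rewrite /time_but; case: ifPn => // /andP[/eqP -> /eqP ->].
by rewrite ltnn.
Qed.

Lemma run_butE w m : at_count (qrun w m) c ->
  run_but w m = qrun w m /\ runtime_but w m = qtime w m.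
Proof.
move=> /at_countP rc; split.
  by apply: (run_ext rc) => // j l; exact: time_butE.
by apply: (run_time_ext rc) => // j l; exact: time_butE.
Qed.

(** A run with counters [c] has never read the time of index [c i] of clock [i]. So if either run
    has these counters, the two coincide. *)
Lemma at_count_but w m : at_count (run_but w m) c = at_count (qrun w m) c.
Proof.
apply/idP/idP => [/at_countP rc|rc]; last by rewrite (run_butE rc).1.
suff -> : qrun w m = run_but w m by exact/at_countP.
by apply: (run_ext rc) => // j l lc; rewrite time_butE.
Qed.

End without_one.

Lemma at_count_measurable d' (Om' : measurableType d')
    (r : Om' -> state R k * ('I_k.+1 -> nat)) c :
  (forall i, discrete_mfun (fun w => (r w).2 i)) ->
  bounded_mfun (fun w => (at_count (r w) c)%:R : R).
Proof.
move=> mr; apply: bounded_mfun_bool.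
rewrite (_ : [set w | _] = \bigcap_(i in [set: 'I_k.+1]) [set w | (r w).2 i = c i]).
  by apply: fin_bigcap_measurable => // i _; exact: mr.
apply/seteqP; split=> [w /at_countP <- //|w rc]; apply/at_countP/funext => i.
exact: rc.
Qed.

Lemma qrun_measurable m : mstate_fun (fun w => (qrun w m).1) /\
  forall i, discrete_mfun (fun w => (qrun w m).2 i).
Proof.
apply: (run_measurable (X := fun=> x)) => [|i l|A j l].
- exact: mstate_fun_cst.
- exact: measurable_funP.
- by move=> B; exact: select_measurable.
Qed.

Lemma qtime_measurable m : measurable_fun setT (qtime ^~ m).
Proof.
apply: (run_time_measurable (X := fun=> x)) => [|i l|A j l].
- exact: mstate_fun_cst.
- exact: measurable_funP.
- by move=> B; exact: select_measurable.
Qed.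

Lemma qselect_discrete m : discrete_mfun (qselect ^~ m).
Proof.
apply: (discrete_select_of (X := fun=> x)) => [A j l B|].
  exact: select_measurable.
by case: (qrun_measurable m).
Qed.

Lemma mean_time i l (g : R -> R) : bounded_mfun g ->
  \int[P]_w g (time Q i l w) = \int[P]_w g (gtime Q i w).
Proof.
move=> bg; rewrite /Rintegral; congr fine.
have mg : measurable_fun setT (EFin \o g) by apply/measurable_EFinP; case: bg.
have iT (T : {RV P >-> R}) : P.-integrable setT ((EFin \o g) \o T).
  exact: (bounded_mfun_integrable P (bounded_mfun_comp _ bg)).
rewrite -(integral_distribution mg (iT (time Q i l))).
rewrite -(integral_distribution mg (iT (gtime Q i))).
by apply: eq_measure_integral => B mB _; exact: time_ident.
Qed.

Variable g : 'I_k.+1 -> R -> R.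
Hypothesis bg : forall i, bounded_mfun (g i).

(** On the event that the counters equal [c], the next time of clock [i] is the fixed primitive
    [time Q i (c i)]. All other factors can be computed without it, hence are independent of it, and
    the clocks of [s] are integrated out one at a time. *)
Lemma mean_fresh_at v m c (s : seq 'I_k.+1) : step_mfun v -> uniq s ->
  \int[P]_w ((at_count (qrun w m) c)%:R * v (qrun w m).1 (qtime w m) (qselect w m) *
     \prod_(i <- s) g i (time Q i (c i) w)) =
  \int[P]_w ((at_count (qrun w m) c)%:R * v (qrun w m).1 (qtime w m) (qselect w m)) *
     \prod_(i <- s) \int[P]_w g i (gtime Q i w).
Proof.
move=> [[M vM] mv]; elim: s => [_|i s IHs /= /andP[is_ us]].
  by rewrite big_nil mulr1; under eq_Rintegral do rewrite big_nil mulr1.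
rewrite big_cons mulrCA -IHs// mulrC -(mean_time i (c i) (bg i)).
rewrite -(@mean_others i (c i))//.
- by apply: eq_Rintegral => w _; rewrite big_cons mulrCA mulrC.
- pose r w := run_but i c w m.
  have [mr mc] : mstate_fun (fun w : g_sigma_algebraType (others i (c i)) => (r w).1) /\
      forall j, discrete_mfun (fun w : g_sigma_algebraType (others i (c i)) => (r w).2 j).
    apply: (run_measurable (X := fun=> x)) => [|j l|A j l].
    + exact: mstate_fun_cst.
    + exact: time_but_measurable.
    + exact: select_discrete.
  rewrite (_ : (fun w => _) = fun w : g_sigma_algebraType (others i (c i)) =>
    (at_count (r w) c)%:R * v (r w).1 (runtime_but i c w m)
       (select Q (~: serving (r w).1) (queue (r w).1) m w) *
     \prod_(j <- s) g j (time_but i (c i) j (c j) w)).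
    apply: measurable_funM; first apply: measurable_funM.
    + exact: (at_count_measurable c mc).1.
    + apply: mv => //.
        apply: (run_time_measurable (X := fun=> x)) => [|j l|A j l].
        * exact: mstate_fun_cst.
        * exact: time_but_measurable.
        * exact: select_discrete.
      apply: (discrete_mfun_glue (F := fun (p : {set 'I_k} * nat)
          (w : g_sigma_algebraType (others i (c i))) =>
          select Q (~: p.1) p.2 m w)
        (discrete_mfun_pair (discrete_serving mr) (discrete_queue mr))) => p.
      exact: select_discrete.
    + have bgt j : bounded_mfun (fun w : g_sigma_algebraType (others i (c i)) =>
          g j (time_but i (c i) j (c j) w)).
        apply: (bounded_mfun_comp _ (bg j)); exact: time_but_measurable.
      exact: (bounded_mfun_prod s xpredT bgt).1.
  apply/funext => w; rewrite -(at_count_but i c w m) -/(r w).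
  (* Off the event that the counters equal [c] both sides vanish; on it the run does not notice the
     replaced time. *)
  have [rc|_] := boolP (at_count (r w) c); last by rewrite !mul0r.
  have [rE tE] : r w = qrun w m /\ runtime_but i c w m = qtime w m.
    by apply: run_butE; rewrite -(at_count_but i).
  rewrite rE tE; congr (_ * _).
  rewrite big_seq [RHS]big_seq; apply: eq_bigr => j js.
  rewrite /time_but; case: eqP => // ji.
  by rewrite -ji js in is_.
- have [_ [N gN]] : bounded_mfun (fun w => \prod_(j <- s) g j (time Q j (c j) w)).
    apply: bounded_mfun_prod => j; apply: (bounded_mfun_comp _ (bg j)).
    exact: measurable_funP.
  exists (M * N) => w; rewrite normrM.
  apply: ler_pM => //; rewrite normrM.
  case: at_count; first by rewrite normr1 mul1r.
  by rewrite normr0 mul0r (le_trans _ (vM x 0 finset.set0)).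
Qed.

End restart_mean.

Section one_step.
Context d (Om : measurableType d) (R : realType) (P : probability Om R).
Variables (k : nat) (Q : hetero_queue P k) (x : state R k).
Variable g : 'I_k.+1 -> R -> R.
Hypothesis bg : forall i, bounded_mfun (g i).

Notation qrun := (qrun Q x).
Notation qtime := (qtime Q x).
Notation qselect := (qselect Q x).
Notation gmean i := (\int[P]_w g i (gtime Q i w)).

Definition fresh_set (y : state R k) D : {set 'I_k.+1} :=
  [set i | fresh y D i]%SET.

(** Sorting by the values of the counters and by the set of fresh clocks makes the random indices
    fixed. The sum is finite because counters after [m] events are at most [m]. *)
Lemma sum_count_fresh (y : state R k) (D : {set 'I_k}) m (n : 'I_k.+1 -> nat)
    (a : R) (h : 'I_k.+1 -> nat -> R) : (forall i, n i <= m)%N ->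
  a * \prod_i (if fresh y D i then h i (n i) else 1) =
  \sum_(c : {ffun 'I_k.+1 -> 'I_m.+1}) \sum_(F : {set 'I_k.+1})
    (at_count (y, n) (fun i => c i))%:R * (a * (F == fresh_set y D)%:R) *
    \prod_(i <- enum F) h i (c i).
Proof.
move=> nm; pose c0 : {ffun 'I_k.+1 -> 'I_m.+1} := [ffun i => inord (n i)].
have c0E i : c0 i = n i :> nat by rewrite ffunE inordK// ltnS.
rewrite (bigD1 c0)//= [X in _ + X]big1 ?addr0; last first.
  move=> c cc0; rewrite big1// => F _; case: at_countP => [/= nc|]; last by rewrite !mul0r.
  case/eqP: cc0; apply/ffunP => i; apply: val_inj; rewrite /= c0E.
  by rewrite nc.
rewrite (bigD1 (fresh_set y D))//= [X in _ + X]big1 ?addr0; last first.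
  by move=> F /negPf ->; rewrite !mulr0 mul0r.
have -> : at_count (y, n) (fun i => c0 i).
  by apply/at_countP/funext => i /=; rewrite c0E.
rewrite eqxx mulr1 mul1r big_enum/= -big_mkcond /=; congr (_ * _).
by apply: eq_big => i; rewrite ?inE// => _; rewrite c0E.
Qed.

Lemma fresh_set_step_mfun v F : step_mfun v ->
  step_mfun (fun (y : state R k) s D => v y s D * (F == fresh_set y D)%:R).
Proof.
move=> [[M vM] mv]; split.
  exists M => y s D; rewrite normrM; case: eqP => _.
    by rewrite normr1 mulr1.
  by rewrite normr0 mulr0 (le_trans _ (vM y s D)).
move=> d' Om' X s D mX ms mD; apply: measurable_funM; first exact: mv.
suff : bounded_mfun (fun w => (F == fresh_set (X w) (D w))%:R : R) by case.
apply: bounded_mfun_bool.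
have mF : discrete_mfun (fun w : Om' => fresh_set (X w) (D w)).
  by apply: discrete_setb => i; exact: discrete_fresh.
rewrite (_ : [set w | _] = (fun w => fresh_set (X w) (D w)) @^-1` [set F]) //.
by apply/seteqP; split=> w /= => [/eqP ->//|->].
Qed.

Lemma bounded_step v m : step_mfun v ->
  bounded_mfun (fun w => v (qrun w m).1 (qtime w m) (qselect w m)).
Proof.
move=> [[M vM] mv]; split; last by exists M.
apply: mv; first by case: (qrun_measurable Q x m).
- exact: qtime_measurable.
- exact: qselect_discrete.
Qed.

(** The Markov property at an event: given the past and the selection, the fresh times are
    independent with their own laws. It follows from [mean_fresh_at] by summation over the counters
    and the sets of fresh clocks. *)
Lemma mean_restart v m : step_mfun v ->
  \int[P]_w (v (qrun w m).1 (qtime w m) (qselect w m) *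
     \prod_i (if fresh (qrun w m).1 (qselect w m) i
              then g i (time Q i ((qrun w m).2 i) w) else 1)) =
  \int[P]_w (v (qrun w m).1 (qtime w m) (qselect w m) *
     \prod_i (if fresh (qrun w m).1 (qselect w m) i then gmean i else 1)).
Proof.
move=> nv.
have vb c F : bounded_mfun (fun w => (at_count (qrun w m) c)%:R *
   (v (qrun w m).1 (qtime w m) (qselect w m) *
     (F == fresh_set (qrun w m).1 (qselect w m))%:R)).
  apply: bounded_mfunM.
    by apply: at_count_measurable; case: (qrun_measurable Q x m).
  exact: (bounded_step m (fresh_set_step_mfun F nv)).
transitivity (\sum_(c : {ffun 'I_k.+1 -> 'I_m.+1}) \sum_(F : {set 'I_k.+1})
  \int[P]_w ((at_count (qrun w m) (fun i => c i))%:R *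
   (v (qrun w m).1 (qtime w m) (qselect w m) *
     (F == fresh_set (qrun w m).1 (qselect w m))%:R)) *
     \prod_(i <- enum F) gmean i).
  have bt i l : bounded_mfun (fun w => g i (time Q i l w)).
    by apply: (bounded_mfun_comp _ (bg i)); exact: measurable_funP.
  transitivity (\int[P]_w (\sum_(c : {ffun 'I_k.+1 -> 'I_m.+1})
      \sum_(F : {set 'I_k.+1}) (at_count (qrun w m) (fun i => c i))%:R *
   (v (qrun w m).1 (qtime w m) (qselect w m) *
     (F == fresh_set (qrun w m).1 (qselect w m))%:R) *
     \prod_(i <- enum F) g i (time Q i (c i) w))).
    apply: eq_Rintegral => w _.
    rewrite (sum_count_fresh _ _ _ (fun i l => g i (time Q i l w)) (m := m)).
      by under eq_bigr do under eq_bigr do rewrite -surjective_pairing.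
    by move=> i; exact: run_counter_le.
  have bterm (c : {ffun 'I_k.+1 -> 'I_m.+1}) (F : {set 'I_k.+1}) : bounded_mfun (fun w =>
      (at_count (qrun w m) (fun i => c i))%:R *
      (v (qrun w m).1 (qtime w m) (qselect w m) *
      (F == fresh_set (qrun w m).1 (qselect w m))%:R) *
      \prod_(i <- enum F) g i (time Q i (c i) w)).
    apply: bounded_mfunM; first exact: vb.
    exact: bounded_mfun_prod.
  rewrite mean_sum; last by move=> c; exact: bounded_mfun_sum.
  apply: eq_bigr => c _; rewrite mean_sum//; apply: eq_bigr => F _.
  have h := (mean_fresh_at Q x bg m (fun i => c i) (fresh_set_step_mfun F nv) (enum_uniq F)).
  exact: h.
apply/esym; transitivity (\int[P]_w (\sum_(c : {ffun 'I_k.+1 -> 'I_m.+1})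
      \sum_(F : {set 'I_k.+1}) (\prod_(i <- enum F) gmean i) *
   ((at_count (qrun w m) (fun i => c i))%:R *
   (v (qrun w m).1 (qtime w m) (qselect w m) *
     (F == fresh_set (qrun w m).1 (qselect w m))%:R)))).
  apply: eq_Rintegral => w _.
  rewrite (sum_count_fresh _ _ _ (fun i l => gmean i) (m := m) (n := (qrun w m).2)).
    under eq_bigr do under eq_bigr do rewrite -surjective_pairing.
    by apply: eq_bigr => c _; apply: eq_bigr => F _; rewrite mulrC.
  by move=> i; exact: run_counter_le.
have bterm (c : {ffun 'I_k.+1 -> 'I_m.+1}) (F : {set 'I_k.+1}) : bounded_mfun (fun w =>
      (\prod_(i <- enum F) gmean i) * ((at_count (qrun w m) (fun i => c i))%:R *
      (v (qrun w m).1 (qtime w m) (qselect w m) *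
      (F == fresh_set (qrun w m).1 (qselect w m))%:R))).
  by apply: bounded_mfunM; [exact: bounded_mfun_cst|exact: vb].
rewrite mean_sum; last by move=> c; exact: bounded_mfun_sum.
apply: eq_bigr => c _; rewrite mean_sum//; apply: eq_bigr => F _.
by rewrite meanZ// mulrC.
Qed.

End one_step.

(** * Product-form test functions *)

Section test_functions.
Variables (R : realType) (k : nat).
Implicit Types (u : nat -> {set 'I_k} -> R) (g : 'I_k.+1 -> R -> R)
  (x : state R k) (D : {set 'I_k}) (T : 'I_k.+1 -> R).

Definition test_fun u g x : R :=
  u (customers x) (busy x) * \prod_i g i (residual x i).

Lemma test_fun_restart u g T x D :
  test_fun u g (restart T x D) =
  u (total x) (serving x :|: D) *
    (\prod_i (if fresh x D i then 1 else g i (kept x i))) *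
    \prod_i (if fresh x D i then g i (T i) else 1).
Proof.
rewrite /test_fun /= -mulrA -big_split/=; congr (_ * _); apply: eq_bigr => i _.
by case: ifP; rewrite ?mul1r ?mulr1.
Qed.

Lemma residual_hit_inactive x i : ~~ active x i -> residual (hit x) i = 0.
Proof. by rewrite /hit /= => /negPf ->. Qed.

Lemma residual_hit_notin_serving x j :
  j \notin serving x -> residual (hit x) (lift ord0 j) = 0.
Proof.
have [jb|jb _] := boolP (j \in busy x); last first.
  by apply: residual_hit_inactive; rewrite active_lift.
by rewrite finset.in_setD jb andbT negbK finset.inE => /andP[_ /eqP].
Qed.

(** A clock that has run out or is idle reads 0 and contributes the factor 1, so before the fresh
    times are drawn only the kept clocks count. *)
Lemma hit_kept g x D i : g i 0 = 1 -> D \subset ~: serving x ->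
  g i (residual (hit x) i) = if fresh x D i then 1 else g i (kept x i).
Proof.
move=> g0 /fintype.subsetP DS; rewrite /fresh /kept.
case: (unliftP ord0 i) g0 => [j ->|->] g0.
  case: ifPn => [/DS|_].
    by rewrite finset.in_setC => /residual_hit_notin_serving ->.
  by case: ifPn => // /residual_hit_notin_serving ->.
by rewrite /arrived; case: eqP => // ->.
Qed.

Lemma prod_fresh x D (gam : 'I_k.+1 -> R) (a b : R) :
  gam ord0 = a -> (forall j, gam (lift ord0 j) = b) ->
  \prod_i (if fresh x D i then gam i else 1) = a ^+ arrived x * b ^+ #|D|.
Proof.
move=> ga gb; rewrite big_ord_recl /= /fresh unlift_none ga; congr (_ * _).
  by case: arrived.
under eq_bigr do rewrite liftK gb.
by rewrite -big_mkcond/= big_const -Monoid.iteropE.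
Qed.

Lemma prod_hit g x D : (forall i, g i 0 = 1) -> D \subset ~: serving x ->
  \prod_i g i (residual (hit x) i) =
  \prod_i (if fresh x D i then 1 else g i (kept x i)).
Proof. by move=> g0 DS; apply: eq_bigr => i _; exact: hit_kept. Qed.

Definition waiting_weight (z : R) : nat -> {set 'I_k} -> R :=
  fun L J => z ^+ (L - #|J|).

(* An arrival lengthens the waiting line by one and draws a clock of mean
   [z^-1]; a service start shortens it by one and draws a clock of mean [z]. *)
Lemma restart_balance (z : R) g (gam : 'I_k.+1 -> R) x D : z != 0 ->
  (forall i, g i 0 = 1) ->
  gam ord0 = z^-1 -> (forall j, gam (lift ord0 j) = z) ->
  valid x -> D \subset ~: serving x -> (#|D| <= queue x)%N ->
  waiting_weight z (total x) (serving x :|: D) *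
    (\prod_i (if fresh x D i then 1 else g i (kept x i))) *
    \prod_i (if fresh x D i then gam i else 1)
  = test_fun (waiting_weight z) g (hit x).
Proof.
move=> z0 g0 ga gb vx DS Dq; rewrite /test_fun (prod_hit g0 DS) mulrAC.
congr (_ * _); rewrite (prod_fresh _ _ ga gb) /waiting_weight.
have := restart_waiting (fun=> 0) vx DS Dq; rewrite /= => Weq.
rewrite mulrCA mulrC -exprD Weq exprVn exprD mulfK// expf_neq0//.
Qed.

Definition busy_weight (a : R) : nat -> {set 'I_k} -> R := fun _ J => a ^- #|J|.

(* An arrival draws a clock of mean at most [a], a completion multiplies
   [a ^- #|J|] by [a], and a service start does not increase the mean. *)
Lemma restart_contract (a : R) g (gam : 'I_k.+1 -> R) x D : 0 < a <= 1 ->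
  (forall i, g i 0 = 1) -> (forall i r, 0 <= g i r) ->
  (forall i, 0 <= gam i <= a) ->
  D \subset ~: serving x ->
  busy_weight a (total x) (serving x :|: D) *
    (\prod_i (if fresh x D i then 1 else g i (kept x i))) *
    \prod_i (if fresh x D i then gam i else 1)
  <= a * test_fun (busy_weight a) g (hit x).
Proof.
move=> /andP[a0 a1] g0 gge0 gama DS.
rewrite /test_fun (prod_hit g0 DS) mulrAC [leRHS]mulrA.
apply: ler_wpM2r; first by apply: prodr_ge0 => i _; case: ifP.
have cardU : #|serving x :|: D| = (#|busy x| - #|completed x| + #|D|)%N.
  rewrite -card_serving cardsU (_ : _ :&: _ = finset.set0) ?cards0 ?subn0//.
  apply/setP => i; rewrite finset.in_setI finset.in_set0; apply/negP => /andP[iS iD].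
  by have := fintype.subsetP DS i iD; rewrite finset.in_setC iS.
have cb := card_completed_le x.
rewrite /busy_weight cardU -[busy (hit x)]/(busy x).
have le_gam : \prod_i (if fresh x D i then gam i else 1) <=
    a ^+ (arrived x + #|D|).
  rewrite exprD -(prod_fresh x D (gam := fun=> a) erefl (fun=> erefl)).
  by apply: ler_prod => i _; case: ifP => // _; rewrite ler01 lexx.
have ev := event_occurs x.
have -> : a * a ^- #|busy x| =
    a ^- (#|busy x| - #|completed x| + #|D|) *
    (a ^+ (#|busy x| - #|completed x| + #|D| + 1) * a ^- #|busy x|).
  rewrite addn1 exprSr -[_ * a * _]mulrA [RHS]mulrA mulVf ?mul1r//.
  by rewrite expf_neq0// gt_eqF.
apply: ler_wpM2l; first by rewrite invr_ge0 exprn_ge0// ltW.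
apply: (le_trans le_gam).
have -> : (a ^+ (#|busy x| - #|completed x| + #|D| + 1) * a ^- #|busy x| =
   a ^+ (1 + #|D|) * a ^- #|completed x|).
  rewrite -{2}(subnK cb) [a ^+ (_ - _ + #|completed x|)]exprD invfM mulrA.
  congr (_ * _).
  rewrite -addnA exprD mulrAC divff ?mul1r ?addn1 ?add1n//.
  by rewrite expf_neq0// gt_eqF.
rewrite ler_pdivlMr ?exprn_gt0// -exprD.
(* The exponents to compare are [arrived x + #|D| + #|completed x|] and [1 + #|D|]; [event_occurs]
   orders them. *)
apply: ler_wiXn2l => //; first exact: ltW.
by move: ev; move: (arrived x : nat) #|D| #|completed x| => p q r; lia.
Qed.

End test_functions.

Section positive_mean.
Context d (Om : measurableType d) (R : realType) (P : probability Om R).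

Lemma mean_gt0 (h : Om -> R) (A : set Om) : bounded_mfun h ->
  (forall w, 0 <= h w) -> measurable A -> (0 < P A)%E ->
  (forall w, A w -> 0 < h w) -> 0 < \int[P]_w h w.
Proof.
move=> bh h0 mA PA hA; rewrite lt_neqAle Rintegral_ge0// andbT eq_sym.
apply/negP => /eqP int0.
have mh : measurable_fun setT (EFin \o h) by apply/measurable_EFinP; case: bh.
have : (\int[P]_w `|(EFin \o h) w| = 0)%E.
  have -> : (\int[P]_w `|(EFin \o h) w| = \int[P]_w (h w)%:E)%E.
    by apply: eq_integral => w _ /=; rewrite ger0_norm.
  rewrite -[LHS]fineK; last first.
    exact: integrable_fin_num (bounded_mfun_integrable P bh).
  by rewrite -/(Rintegral P setT h) int0.
move/(ae_eq_integral_abs P measurableT mh) => [N [mN PN0 hN]].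
have : (P A <= P N)%E.
  apply: le_measure; rewrite ?inE//; apply: subset_trans hN => w Aw /= h0'.
  have := hA w Aw; have := h0' I; rewrite /cst /=; case=> ->.
  by rewrite ltxx.
move=> /(lt_le_trans PA); rewrite -[X in (_ < X)%E]/(P N) => PN.
by have := PN; rewrite [P N]PN0 ltxx.
Qed.

End positive_mean.

Section history_mean.
Context d (Om : measurableType d) (R : realType) (P : probability Om R).
Variables (k : nat) (Q : hetero_queue P k) (x : state R k).
Hypothesis vx : valid x.
Variable u : nat -> {set 'I_k} -> R.
Hypothesis ub : exists M : R, forall L J, `|u L J| <= M.
Variable g : 'I_k.+1 -> R -> R.
Hypothesis bg : forall i, bounded_mfun (g i).

Definition history_mfun (H : state R k -> R -> R) : Prop :=
  (exists M : R, forall y s, `|H y s| <= M) /\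
  forall d' (Om' : measurableType d') X s, mstate_fun X ->
    measurable_fun setT s -> measurable_fun setT (fun w : Om' => H (X w) (s w)).

Notation qrun := (qrun Q x).
Notation qtime := (qtime Q x).
Notation qselect := (qselect Q x).

Lemma qrun_valid w m : valid (qrun w m).1.
Proof.
apply: run_valid => // [i l|A j l]; first exact: time_ge0.
by rewrite select_card geq_minl.
Qed.

Lemma qselect_sub w m : qselect w m \subset ~: serving (qrun w m).1.
Proof. exact: select_sub. Qed.

Lemma qselect_le w m : (#|qselect w m| <= queue (qrun w m).1)%N.
Proof. by rewrite /qselect select_card geq_minl. Qed.

Lemma qtimeS w m : qtime w m.+1 = qtime w m + next_event (qrun w m).1.
Proof. exact: run_timeS. Qed.

Lemma qtime0 w : qtime w 0 = 0.
Proof. exact: run_time0. Qed.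

Lemma next_qrun_ge0 w m : 0 <= next_event (qrun w m).1.
Proof. exact/next_event_ge0/qrun_valid. Qed.

Lemma qtime_le w m1 m2 : (m1 <= m2)%N -> qtime w m1 <= qtime w m2.
Proof.
apply: run_time_le => // [i l|A j l]; first exact: time_ge0.
by rewrite select_card geq_minl.
Qed.

Lemma qtime_ge0 w m : 0 <= qtime w m.
Proof. by rewrite -(qtime0 w) qtime_le. Qed.

Lemma discrete_fun_mfun d' (Om' : measurableType d') (T : countType)
    (h : Om' -> T) (phi : T -> R) :
  discrete_mfun h -> measurable_fun setT (fun w => phi (h w)).
Proof.
move=> mh; apply: (measurable_glue (F := fun t _ => phi t) mh) => t.
exact: measurable_cst.
Qed.

Lemma mstate_test_fun d' (Om' : measurableType d') (X : Om' -> state R k) :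
  mstate_fun X -> bounded_mfun (fun w => test_fun u g (X w)).
Proof.
move=> [mL mJ mR]; apply: bounded_mfunM; last first.
  by apply: bounded_mfun_prod => i; exact: (bounded_mfun_comp (mR i) (bg i)).
split; last by have [M uM] := ub; exists M.
exact: (discrete_fun_mfun (fun p : nat * {set 'I_k} => u p.1 p.2)
  (discrete_mfun_pair mL mJ)).
Qed.

(** What remains of [H] times the test function after the event once the factors of the fresh clocks
    are taken out. It depends only on the past and the selection, as [mean_restart] requires. *)
Definition frozen_fun (H : state R k -> R -> R) (y : state R k) (s : R)
    (D : {set 'I_k}) : R :=
  H y s * (u (total y) (serving y :|: D) *
    \prod_i (if fresh y D i then 1 else g i (kept y i))).

Lemma frozen_step_mfun H : history_mfun H -> step_mfun (frozen_fun H).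
Proof.
move=> [[M HM] mH]; split.
  have [N uN] := ub.
  have gB i : exists B : R, (1 <= B) && `[<forall r, `|g i r| <= B>].
    have [_ [B gB]] := bg i; exists (Num.max 1 B); rewrite le_max lexx/=.
    by apply/asboolP => r; rewrite le_max gB orbT.
  pose B i := projT1 (cid (gB i)).
  have B1 i : 1 <= B i by rewrite /B; case: cid => ? /= /andP[].
  have BE i r : `|g i r| <= B i by rewrite /B; case: cid => ? /= /andP[_ /asboolP].
  exists (M * (N * \prod_i B i)) => y s D; rewrite /frozen_fun normrM ler_pM//.
  rewrite normrM ler_pM// normr_prod; apply: ler_prod => i _.
  by rewrite normr_ge0/=; case: ifP; rewrite ?normr1.
move=> d' Om' X s D mX ms mD; apply: measurable_funM; first exact: mH.
apply: measurable_funM.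
  exact: (discrete_fun_mfun (fun p : nat * ({set 'I_k} * {set 'I_k}) =>
      u p.1 (p.2.1 :|: p.2.2))
    (discrete_mfun_pair (discrete_total mX)
      (discrete_mfun_pair (discrete_serving mX) mD))).
suff : bounded_mfun (fun w => \prod_i (if fresh (X w) (D w) i then 1
    else g i (kept (X w) i))) by case.
apply: bounded_mfun_prod => i; split; last first.
  have [_ [B gB]] := bg i; exists (Num.max 1 B) => w.
  by case: ifP; rewrite ?normr1 le_max ?lexx// gB orbT.
apply: (measurable_glue (F := fun (b : bool) w => if b then 1
    else g i (kept (X w) i)) (discrete_fresh i mX mD)) => -[].
  exact: measurable_cst.
by apply: measurableT_comp; [case: (bg i)|exact: measurable_kept].
Qed.

Lemma mean_history H m : history_mfun H ->
  \int[P]_w (H (qrun w m).1 (qtime w m) * test_fun u g (qrun w m.+1).1) =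
  \int[P]_w (frozen_fun H (qrun w m).1 (qtime w m) (qselect w m) *
    \prod_i (if fresh (qrun w m).1 (qselect w m) i
             then \int[P]_w g i (gtime Q i w) else 1)).
Proof.
move=> nH; rewrite -(mean_restart Q x bg m (frozen_step_mfun nH)).
apply: eq_Rintegral => w _; rewrite /frozen_fun -[in RHS]mulrA; congr (_ * _).
by rewrite [LHS]test_fun_restart.
Qed.

Lemma bounded_frozen H m : history_mfun H ->
  bounded_mfun (fun w => frozen_fun H (qrun w m).1 (qtime w m) (qselect w m) *
    \prod_i (if fresh (qrun w m).1 (qselect w m) i
             then \int[P]_w g i (gtime Q i w) else 1)).
Proof.
move=> nH; apply: bounded_mfunM; first exact: (bounded_step Q x m (frozen_step_mfun nH)).
apply: bounded_mfun_prod => i; split; last first.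
  exists (Num.max 1 `|\int[P]_w g i (gtime Q i w)|) => w.
  by case: ifP; rewrite ?normr1 le_max lexx ?orbT.
have [mX _] := qrun_measurable Q x m.
apply: (discrete_fun_mfun (fun b : bool => if b then
  \int[P]_w g i (gtime Q i w) else 1)).
exact: (discrete_fresh i mX (qselect_discrete Q x m)).
Qed.

End history_mean.

(** * Nonexplosion *)

Section nonexplosion.
Context d (Om : measurableType d) (R : realType) (P : probability Om R).
Variables (k : nat) (Q : hetero_queue P k) (x : state R k).
Hypothesis vx : valid x.
Hypothesis time_pos : forall i, (0 < P [set w | (0 < gtime Q i w)%R])%E.

Notation qrun := (qrun Q x).
Notation qtime := (qtime Q x).

(* A bounded test function with all clock means below 1, which increases by at
   most a factor [expR s] during a time [s]: [m] events before time [t] have a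
   probability geometrically small in [m]. *)
Definition halving (r : R) : R := 1 - Num.min `|r| 1 / 2.

Lemma halving_bounds r : 2^-1 <= halving r <= 1.
Proof.
rewrite /halving; have : 0 <= Num.min `|r| 1 by rewrite le_min normr_ge0 ler01.
have : Num.min `|r| 1 <= 1 by rewrite ge_min lexx orbT.
by move=> h1 h2; apply/andP; split; lra.
Qed.

Lemma halving0 : halving 0 = 1.
Proof. by rewrite /halving normr0 min_l ?ler01// mul0r subr0. Qed.

Lemma halving_decay r s : 0 <= s -> s <= r -> halving (r - s) <= expR s * halving r.
Proof.
move=> s0 sr; have /andP[h1 h2] := halving_bounds r.
have e1 := expR_ge1Dx s.
apply: (@le_trans _ _ ((1 + s) * halving r)); last first.
  by apply: ler_wpM2r => //; lra.
rewrite mulrDl mul1r; apply: (@le_trans _ _ (halving r + s / 2)); last first.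
  by rewrite lerD2l; apply: ler_wpM2l.
rewrite /halving ger0_norm ?subr_ge0// ger0_norm ?(le_trans s0)//.
have [a1|a1] := leP r 1; have [b1|b1] := leP (r - s) 1; lra.
Qed.

Lemma bounded_halving : bounded_mfun halving.
Proof.
split; last first.
  exists 1 => r; have /andP[h1 h2] := halving_bounds r.
  by rewrite ger0_norm//; lra.
apply: measurable_funB; first exact: measurable_cst.
apply: measurable_funM; last exact: measurable_cst.
by apply: measurable_minr => //; exact: measurable_cst.
Qed.

Let gam i : R := \int[P]_w halving (gtime Q i w).

Lemma bounded_halving_time i : bounded_mfun (fun w => halving (gtime Q i w)).
Proof. by apply: bounded_mfun_comp bounded_halving; exact: measurable_funP. Qed.

Lemma mean_halving_lt1 i : gam i < 1.
Proof.
rewrite -subr_gt0 -[X in X - _](mean_cst P) /gam -meanB; last 2 first.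
- exact: bounded_mfun_cst.
- exact: bounded_halving_time.
apply: (@mean_gt0 _ _ _ _ _ [set w | (0 < gtime Q i w)%R]) => //.
- by apply: bounded_mfunB; [exact: bounded_mfun_cst|exact: bounded_halving_time].
- by move=> w; have /andP[h1 h2] := halving_bounds (gtime Q i w); lra.
- by apply: measurable_lt => //; exact: measurable_cst.
- move=> w /= T0; rewrite /halving opprB addrCA subrr addr0 divr_gt0//.
  by rewrite lt_min ltr01 andbT normr_gt0 gt_eqF.
Qed.

Lemma mean_halving_ge0 i : 0 <= gam i.
Proof.
apply: Rintegral_ge0 => w _.
by have /andP[h1 h2] := halving_bounds (gtime Q i w); lra.
Qed.

Let a : R := \big[Num.max/2^-1]_i gam i.

Lemma contraction_bounds : 0 < a < 1 /\ forall i, 0 <= gam i <= a.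
Proof.
split; last first.
  by move=> i; rewrite mean_halving_ge0/= le_bigmax.
apply/andP; split; last by apply: bigmax_lt => [|i _]; [lra|exact: mean_halving_lt1].
apply: (@lt_le_trans _ _ 2^-1); first by rewrite invr_gt0.
by rewrite bigmax_ge_id.
Qed.

(** Each of the [k.+1] clocks contributes a growth factor of at most [expR s] during a time [s]. *)
Let kap : R := k.+1%:R.
Let u : nat -> {set 'I_k} -> R := busy_weight a.
Let g : 'I_k.+1 -> R -> R := fun=> halving.

Let ub : exists M : R, forall L J, `|u L J| <= M.
Proof.
have [/andP[a0 a1] _] := contraction_bounds.
exists (a ^- k) => L J; rewrite /u /busy_weight ger0_norm; last first.
  by rewrite invr_ge0 exprn_ge0 ?ltW.
rewrite lef_pV2 ?posrE ?exprn_gt0//; apply: ler_wiXn2l; rewrite ?ltW//.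
by rewrite -[leqRHS](card_ord k) max_card.
Qed.

Let bg i : bounded_mfun (g i) := bounded_halving.

Let e m := \int[P]_w (expR (- (kap * `|qtime w m|)) * test_fun u g (qrun w m).1).

Lemma prod_halving_bounds (y : state R k) :
  2^-1 ^+ k.+1 <= \prod_(i < k.+1) halving (residual y i) <= 1.
Proof.
apply/andP; split.
  have -> : 2^-1 ^+ k.+1 = \prod_(i < k.+1) (2^-1 : R) by rewrite prodr_const card_ord.
  apply: ler_prod => i _; have /andP[h1 h2] := halving_bounds (residual y i).
  by rewrite h1 andbT invr_ge0.
apply: prodr_ile1 => i _; have /andP[h1 h2] := halving_bounds (residual y i).
by rewrite h2 andbT (le_trans _ h1)// invr_ge0.
Qed.

Lemma test_fun_halving_ge (y : state R k) : 2^-1 ^+ k.+1 <= test_fun u g y.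
Proof.
have [/andP[a0 a1] _] := contraction_bounds.
have /andP[h1 h2] := prod_halving_bounds y.
rewrite /test_fun -[leLHS]mul1r; apply: ler_pM => //.
rewrite /u /busy_weight -[leLHS]invr1 lef_pV2 ?posrE ?exprn_gt0//.
by rewrite exprn_ile1// ltW.
Qed.

Lemma test_fun_halving_hit (y : state R k) : valid y ->
  test_fun u g (hit y) <= expR (kap * next_event y) * test_fun u g y.
Proof.
move=> vy; have [/andP[a0 a1] _] := contraction_bounds.
rewrite /test_fun -[u (customers (hit y)) _]/(u (customers y) (busy y)) mulrCA.
apply: ler_wpM2l; first by rewrite invr_ge0 exprn_ge0// ltW.
have -> : expR (kap * next_event y) = \prod_(i < k.+1) expR (next_event y).
  by rewrite prodr_const card_ord expRM_natl.
rewrite -big_split/=; apply: ler_prod => i _; apply/andP; split.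
  by have /andP[h1 h2] := halving_bounds (residual (hit y) i); rewrite /g; lra.
have n0 := next_event_ge0 vy.
rewrite /g /hit/=; case: ifPn => ai.
  by apply: halving_decay => //; exact: next_event_le.
have [_ _ ->//] := vy; rewrite halving0 mulr1.
by rewrite -expR0 ler_expR.
Qed.

(** Discounting at rate [kap] absorbs the growth of the test function between events
    ([test_fun_halving_hit]); the event itself contributes the factor [a] of [restart_contract]. *)
Lemma e_contract m : e m.+1 <= a * e m.
Proof.
have [/andP[a0 a1] ga] := contraction_bounds.
(* The discount at event time [m.+1], written as a function of the state and time before that event.
   The absolute value makes it bounded for all arguments. *)
pose H (y : state R k) s := expR (- (kap * `|s + next_event y|)).
have nH : history_mfun H.
  split.
    exists 1 => y s; rewrite ger0_norm ?expR_ge0// -expR0 ler_expR oppr_le0.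
    by rewrite mulr_ge0// ler0n.
  move=> d' Om' X s mX ms; apply: measurableT_comp => //.
  apply: measurableT_comp => //; apply: measurable_funM; first exact: measurable_cst.
  apply: measurableT_comp => //; apply: measurable_funD => //.
  exact: measurable_next_event.
have bE m' : bounded_mfun (fun w => expR (- (kap * `|qtime w m'|))).
  split; last first.
    exists 1 => w; rewrite ger0_norm ?expR_ge0// -expR0 ler_expR oppr_le0.
    by rewrite mulr_ge0// ler0n.
  apply: measurableT_comp => //.
  apply: measurableT_comp => //; apply: measurable_funM; first exact: measurable_cst.
  by apply: measurableT_comp => //; exact: qtime_measurable.
have bT m' : bounded_mfun (fun w => test_fun u g (qrun w m').1).
  by apply: mstate_test_fun => //; case: (qrun_measurable Q x m').
have -> : e m.+1 = \int[P]_w (H (qrun w m).1 (qtime w m) * test_fun u g (qrun w m.+1).1).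
  by apply: eq_Rintegral => w _; rewrite /H -qtimeS.
rewrite mean_history// /e -meanZ; last exact: bounded_mfunM.
apply: le_mean.
- exact: bounded_frozen.
- by apply: bounded_mfunM; [exact: bounded_mfun_cst|exact: bounded_mfunM].
move=> w; rewrite /frozen_fun -mulrA.
have vy := qrun_valid Q vx w m.
have Hge0 : 0 <= H (qrun w m).1 (qtime w m) by exact: expR_ge0.
have a01 : 0 < a <= 1 by rewrite a0 ltW.
have gge0 (i : 'I_k.+1) r : 0 <= g i r.
  by rewrite /g; have /andP[h1 h2] := halving_bounds r; lra.
have := restart_contract (x := (qrun w m).1) a01 (fun i => halving0) gge0 ga
  (qselect_sub Q x w m).
move=> /(ler_wpM2l Hge0) /le_trans; apply.
rewrite mulrCA; apply: ler_wpM2l; first exact: ltW.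
apply: (le_trans (ler_wpM2l Hge0 (test_fun_halving_hit vy))).
rewrite mulrA; apply: ler_wpM2r.
  by apply: le_trans (test_fun_halving_ge _); rewrite exprn_ge0// invr_ge0.
rewrite /H -expRD ler_expR !ger0_norm ?qtime_ge0//; last first.
  by rewrite addr_ge0 ?qtime_ge0// next_event_ge0.
by rewrite mulrDr opprD -addrA addrC addNr add0r.
Qed.

(** Markov inequality: on the event that [qtime w m <= t], the discounted test function in [e m] is
    at least [expR (- (kap * t)) * 2^-1 ^+ k.+1]. *)
Lemma event_time_tail (t : R) : exists2 C : R, 0 <= C &
  exists2 b : R, 0 < b < 1 &
  forall m, \int[P]_w (qtime w m <= t)%R%:R <= C * b ^+ m.
Proof.
have [/andP[a0 a1] ga] := contraction_bounds.
have e0 m : e m <= e 0 * a ^+ m.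
  elim: m => [|m IHm]; first by rewrite expr0 mulr1.
  by rewrite (le_trans (e_contract m))// exprS mulrCA ler_wpM2l// ltW.
have e00 : 0 <= e 0%N.
  apply: Rintegral_ge0 => w _; rewrite mulr_ge0 ?expR_ge0//.
  by apply: le_trans (test_fun_halving_ge _); rewrite exprn_ge0// invr_ge0.
exists (expR (kap * t) * 2 ^+ k.+1 * e 0%N).
  by rewrite mulr_ge0// mulr_ge0// ?expR_ge0// exprn_ge0.
exists a => [|m]; first by rewrite a0.
rewrite -mulrA; apply: le_trans (_ : expR (kap * t) * 2 ^+ k.+1 * e m <= _); last first.
  by rewrite ler_wpM2l// mulr_ge0// ?expR_ge0// exprn_ge0.
have bE : bounded_mfun (fun w => expR (- (kap * `|qtime w m|))).
  split; last first.
    exists 1 => w; rewrite ger0_norm ?expR_ge0// -expR0 ler_expR oppr_le0.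
    by rewrite mulr_ge0// ler0n.
  apply: measurableT_comp => //.
  apply: measurableT_comp => //; apply: measurable_funM; first exact: measurable_cst.
  by apply: measurableT_comp => //; exact: qtime_measurable.
have bT : bounded_mfun (fun w => test_fun u g (qrun w m).1).
  by apply: mstate_test_fun => //; case: (qrun_measurable Q x m).
rewrite /e -meanZ; last exact: bounded_mfunM.
apply: le_mean.
- apply: bounded_mfun_bool; apply: measurable_le; last exact: measurable_cst.
  exact: qtime_measurable.
- by apply: bounded_mfunM; [exact: bounded_mfun_cst|exact: bounded_mfunM].
move=> w; have tf := test_fun_halving_ge (qrun w m).1.
case: (leP (qtime w m) t) => [qt|_]; last first.
  have tf0 : 0 <= test_fun u g (qrun w m).1.
    by apply: le_trans tf; rewrite exprn_ge0// invr_ge0.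
  by rewrite mulr_ge0// mulr_ge0 ?expR_ge0 ?exprn_ge0.
have -> : expR (kap * t) * 2 ^+ k.+1 * (expR (- (kap * `|qtime w m|)) * test_fun u g (qrun w m).1)
  = (expR (kap * t) * expR (- (kap * `|qtime w m|))) * (2 ^+ k.+1 * test_fun u g (qrun w m).1) by ring.
rewrite -[leLHS]mul1r; apply: ler_pM => //.
  rewrite -expRD -expR0 ler_expR ger0_norm ?qtime_ge0// subr_ge0.
  by rewrite ler_wpM2l// ler0n.
rewrite -(ler_pM2l (_ : 0 < 2^-1 ^+ k.+1)) ?exprn_gt0 ?invr_gt0//.
by rewrite mulr1 mulrA -exprMn mulVf// expr1n mul1r.
Qed.

End nonexplosion.

(** * The stationary equation *)

Section clock_index.
Context d (Om : measurableType d) (R : realType).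
Variables (S : nat -> Om -> R) (t : R).
Hypothesis S_measurable : forall m, measurable_fun setT (S m).
Hypothesis S_le : forall w m1 m2, (m1 <= m2)%N -> S m1 w <= S m2 w.

Definition clock_index w : nat := xget 0%N [set m | S m w <= t < S m.+1 w].

Lemma clock_indexE w m : S m w <= t < S m.+1 w -> clock_index w = m.
Proof.
move=> mS; apply: xget_unique => // n /= /andP[n1 n2]; case/andP: mS => m1 m2.
apply/eqP; rewrite eqn_leq; apply/andP; split; rewrite leqNgt; apply/negP => h.
  by have := le_lt_trans (le_trans (S_le w h) n1) m2; rewrite ltxx.
by have := le_lt_trans (le_trans (S_le w h) m1) n2; rewrite ltxx.
Qed.

Lemma discrete_clock_index : discrete_mfun clock_index.
Proof.
have mA m : measurable [set w | S m w <= t < S m.+1 w].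
  rewrite (_ : [set w | _] = [set w | S m w <= t] `&` [set w | t < S m.+1 w]).
    apply: measurableI; first by apply: measurable_le => //; exact: measurable_cst.
    by apply: measurable_lt => //; exact: measurable_cst.
  by apply/seteqP; split=> w /=; [move/andP|move=> h; exact/andP].
have mpos n : (0 < n)%N -> measurable (clock_index @^-1` [set n]).
  move=> n0; rewrite (_ : _ @^-1` _ = [set w | S n w <= t < S n.+1 w])//.
  apply/seteqP; split=> [w /= wn|w /= /clock_indexE//].
  move: wn n0; rewrite /clock_index; case: xgetP => [m mE mP <-//|_ <-].
  by rewrite ltnn.
move=> [|n]; last exact: mpos.
(* The value 0 is also the default of [xget], so its fiber is obtained as the complement of the
   other fibers. *)
rewrite (_ : _ @^-1` _ = ~` \bigcup_n (clock_index @^-1` [set n.+1])).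
  by apply: measurableC; apply: bigcupT_measurable => n; exact: mpos.
apply/seteqP; split=> [w /= w0 [n _ /=]|w /= nw]; first by rewrite w0.
case E: (clock_index w) => [//|n]; exfalso; apply: nw; exists n => //.
Qed.

End clock_index.

Section drift.
Context d (Om : measurableType d) (R : realType) (P : probability Om R).
Variables (k : nat) (Q : hetero_queue P k).

Lemma queue_processE (x : state R k) t w :
  queue_process Q x t w =
  let m := clock_index (fun m w => qtime Q x w m) t w in
  elapse (t - qtime Q x w m) (qrun Q x w m).1.
Proof.
have tE m : event_time Q x w m = qtime Q x w m.
  by apply: eq_bigr => l _; rewrite chain_run.
rewrite /queue_process /clock_index; under eq_set do rewrite !tE.
by rewrite tE chain_run.
Qed.

Variable x : state R k.
Hypothesis vx : valid x.

Notation qrun := (qrun Q x).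
Notation qtime := (qtime Q x).

Lemma queue_process_at t w m : qtime w m <= t < qtime w m.+1 ->
  queue_process Q x t w = elapse (t - qtime w m) (qrun w m).1.
Proof.
move=> h; rewrite queue_processE /=.
by rewrite (clock_indexE (S := fun m w => qtime w m) _ h)// => *; exact: qtime_le.
Qed.

Lemma mstate_fun_glue d' (Om' : measurableType d') (N : Om' -> nat)
    (Y : nat -> Om' -> state R k) : discrete_mfun N ->
  (forall m, mstate_fun (Y m)) -> mstate_fun (fun w => Y (N w) w).
Proof.
move=> mN mY; split=> [||i].
- by apply: (discrete_mfun_glue (F := fun m w => customers (Y m w)) mN) => m; case: (mY m).
- by apply: (discrete_mfun_glue (F := fun m w => busy (Y m w)) mN) => m; case: (mY m).
- by apply: (measurable_glue (F := fun m w => residual (Y m w) i) mN) => m; case: (mY m).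
Qed.

Lemma queue_process_measurable t : mstate_fun (queue_process Q x t).
Proof.
have mN : discrete_mfun (clock_index (fun m w => qtime w m) t).
  apply: discrete_clock_index => [m|w m1 m2]; first exact: qtime_measurable.
  exact: qtime_le.
rewrite (_ : queue_process Q x t = fun w =>
    (fun m w => elapse (t - qtime w m) (qrun w m).1)
      (clock_index (fun m w => qtime w m) t w) w); last first.
  by apply/funext => w; rewrite queue_processE.
apply: (mstate_fun_glue (Y := fun m w => elapse (t - qtime w m) (qrun w m).1) mN) => m.
apply: mstate_fun_elapse.
  by case: (qrun_measurable Q x m).
by apply: measurable_funB; [exact: measurable_cst|exact: qtime_measurable].
Qed.

Variable z : R.
Hypothesis z01 : 0 < z <= 1.
Variable g : 'I_k.+1 -> R -> R.
Hypothesis bg : forall i, bounded_mfun (g i).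
Hypothesis g0 : forall i, g i 0 = 1.
Hypothesis mean_g0 : \int[P]_w g ord0 (gtime Q ord0 w) = z^-1.
Hypothesis mean_g : forall j,
  \int[P]_w g (lift ord0 j) (gtime Q (lift ord0 j) w) = z.
Hypothesis time_pos : forall i, (0 < P [set w | (0 < gtime Q i w)%R])%E.
Variable ell : R.
Hypothesis ell_ge0 : 0 <= ell.
Hypothesis flow_lip : forall y s, valid y -> 0 <= s <= next_event y ->
  `|test_fun (waiting_weight z) g (elapse s y) -
    test_fun (waiting_weight z) g y| <= ell * s.

Notation f := (test_fun (waiting_weight z) g).

Let ub : exists M : R, forall L J, `|waiting_weight (k := k) z L J| <= M.
Proof.
case/andP: z01 => z0 z1; exists 1 => L J; rewrite /waiting_weight.
have z0' := ltW z0.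
by rewrite ger0_norm ?exprn_ge0// exprn_ile1.
Qed.

Lemma test_fun_bounded : exists2 B : R, 0 <= B & forall y, `|f y| <= B.
Proof.
have [M uM] := ub.
have gB i : exists B : R, `[<forall r, `|g i r| <= B>].
  by have [_ [B gB]] := bg i; exists B; exact/asboolP.
pose B i := projT1 (cid (gB i)).
have BE i r : `|g i r| <= B i by rewrite /B; case: cid => ? /= /asboolP.
have fB y : `|f y| <= M * \prod_i B i.
  rewrite normrM ler_pM// normr_prod; apply: ler_prod => i _.
  by rewrite normr_ge0/=.
exists (M * \prod_i B i) => //; exact: le_trans (fB x).
Qed.

(** Whether event [m.+1] occurs by time [t] is known before its times are drawn, so [mean_history]
    applies and [restart_balance] replaces the state after the event by the one just before it. *)
Lemma mean_jump t m :
  \int[P]_w ((qtime w m.+1 <= t)%R%:R * f (qrun w m.+1).1) =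
  \int[P]_w ((qtime w m.+1 <= t)%R%:R * f (hit (qrun w m).1)).
Proof.
pose H (y : state R k) s : R := (s + next_event y <= t)%R%:R.
have nH : history_mfun H.
  split; first by exists 1 => y s; rewrite /H; case: (s + _ <= t); rewrite ?normr1 ?normr0.
  move=> d' Om' X s mX ms.
  suff : bounded_mfun (fun w => (s w + next_event (X w) <= t)%R%:R : R) by case.
  apply: bounded_mfun_bool; apply: measurable_le; last exact: measurable_cst.
  by apply: measurable_funD => //; exact: measurable_next_event.
transitivity (\int[P]_w (H (qrun w m).1 (qtime w m) * f (qrun w m.+1).1)).
  by apply: eq_Rintegral => w _; rewrite /H -qtimeS.
rewrite mean_history//; apply: eq_Rintegral => w _.
rewrite /frozen_fun -!mulrA {1}/H -qtimeS; congr (_ * _).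
rewrite mulrA (restart_balance _ g0 mean_g0 mean_g)//.
- by rewrite gt_eqF//; case/andP: z01.
- exact: qrun_valid.
- exact: qselect_sub.
- exact: qselect_le.
Qed.

(** Stopping after event [M] leaves finitely many jumps, which can be integrated one by one before
    [M] tends to infinity. *)
Definition stopped t M w : state R k :=
  if qtime w M <= t then (qrun w M).1 else queue_process Q x t w.

Definition jump_part t m w : R :=
  (qtime w m.+1 <= t)%R%:R * (f (qrun w m.+1).1 - f (hit (qrun w m).1)).

Definition flow_part t m w : R :=
  (qtime w m <= t)%R%:R *
    (f (elapse (Num.min (next_event (qrun w m).1) (t - qtime w m)) (qrun w m).1)
     - f (qrun w m).1).

Lemma stopped_decomp t M w : 0 <= t ->
  f (stopped t M w) =
  f x + \sum_(m < M) (jump_part t m w + flow_part t m w).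
Proof.
move=> t0; elim: M => [|M IHM].
  by rewrite /stopped qtime0 t0 big_ord0 addr0.
rewrite big_ord_recr/= addrA -IHM /jump_part /flow_part /stopped.
have n0 := next_qrun_ge0 Q vx w M.
have [le1|lt1] := leP (qtime w M.+1) t.
  have le2 : qtime w M <= t by rewrite (le_trans _ le1)// qtime_le.
  rewrite le2 !mul1r min_l; last by rewrite lerBrDl -qtimeS.
  by rewrite -/(hit _); ring.
rewrite mul0r add0r; have [le2|lt2] := leP (qtime w M) t; last by rewrite mul0r addr0.
rewrite mul1r (queue_process_at (m := M)) ?le2//.
rewrite min_r; last by rewrite lerBlDl -qtimeS ltW.
by rewrite addrC subrK.
Qed.

(** The pieces of flow occupy disjoint time intervals inside [[0, t]], so their Lipschitz bounds add
    up to the time covered. *)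
Lemma flow_part_le t M w : 0 <= t ->
  `|\sum_(m < M) flow_part t m w| <= ell * Num.min (qtime w M) t.
Proof.
move=> t0; elim: M => [|M IHM].
  by rewrite big_ord0 normr0 qtime0 min_l// mulr0.
rewrite big_ord_recr/= (le_trans (ler_normD _ _))//.
apply: (le_trans (lerD IHM (lexx _))); rewrite /flow_part.
have n0 := next_qrun_ge0 Q vx w M.
have [le2|lt2] := leP (qtime w M) t; last first.
  rewrite mul0r normr0 addr0 min_r//; last by rewrite ltW// (lt_le_trans lt2)// qtime_le.
rewrite mul1r; apply: (le_trans (lerD (lexx _) (flow_lip _ _))).
- exact: qrun_valid.
- by rewrite le_min n0 subr_ge0 le2/= ge_min lexx.
- rewrite -mulrDr qtimeS; have -> // : qtime w M +
    Num.min (next_event (qrun w M).1) (t - qtime w M) =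
    Num.min (qtime w M + next_event (qrun w M).1) t.
  by rewrite addr_minr [in X in Num.min _ X]addrC subrK.
Qed.

(** Jumps have mean 0 and only the flow contributes. The bound is linear in [t] with a constant free
    of the initial state, which later permits dominated convergence. *)
Lemma mean_drift_le t : 0 <= t ->
  `|\int[P]_w f (queue_process Q x t w) - f x| <= ell * t.
Proof.
move=> t0; have [B B0 fB] := test_fun_bounded.
have mX m : mstate_fun (fun w => (qrun w m).1) by case: (qrun_measurable Q x m).
have bX m : bounded_mfun (fun w => f (qrun w m).1) by exact: mstate_test_fun.
have bH m : bounded_mfun (fun w => f (hit (qrun w m).1)).
  by apply: mstate_test_fun => //; exact: mstate_fun_hit.
have bI m : bounded_mfun (fun w => (qtime w m <= t)%R%:R : R).
  apply: bounded_mfun_bool; apply: measurable_le; last exact: measurable_cst.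
  exact: qtime_measurable.
have bJ m : bounded_mfun (jump_part t m).
  by apply: bounded_mfunM => //; exact: bounded_mfunB.
have bF m : bounded_mfun (flow_part t m).
  apply: bounded_mfunM => //; apply: bounded_mfunB => //.
  apply: mstate_test_fun => //; apply: mstate_fun_elapse => //.
  apply: measurable_minr; first exact: measurable_next_event.
  by apply: measurable_funB; [exact: measurable_cst|exact: qtime_measurable].
have bP : bounded_mfun (fun w => f (queue_process Q x t w)).
  by apply: mstate_test_fun => //; exact: queue_process_measurable.
have EJ m : \int[P]_w jump_part t m w = 0.
  rewrite /jump_part; under eq_Rintegral do rewrite mulrBr.
  by rewrite meanB ?mean_jump ?subrr//; exact: bounded_mfunM.
have [C C0 [b /andP[b0 b1] tail]] := event_time_tail vx time_pos t.
(* The last term is the stopping error: [f] changes by at most [2 * B], on an event of probability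
   at most [C * b ^+ M]. *)
have main M : `|\int[P]_w f (queue_process Q x t w) - f x| <=
    ell * t + 2 * B * C * b ^+ M.
  have bS : bounded_mfun (fun w => f (stopped t M w)).
    rewrite (_ : (fun w => _) = fun w => f x + \sum_(m < M) (jump_part t m w + flow_part t m w)).
      apply: bounded_mfunD; first exact: bounded_mfun_cst.
      by apply: bounded_mfun_sum => m; exact: bounded_mfunD.
    by apply/funext => w; rewrite stopped_decomp.
  have -> : \int[P]_w f (queue_process Q x t w) - f x =
      \int[P]_w (f (queue_process Q x t w) - f (stopped t M w)) +
      \int[P]_w (\sum_(m < M) flow_part t m w).
    rewrite meanB// -addrA; congr (_ + _).
    have -> : \int[P]_w f (stopped t M w) =
        \int[P]_w (f x + \sum_(m < M) (jump_part t m w + flow_part t m w)).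
      by apply: eq_Rintegral => w _; rewrite stopped_decomp.
    rewrite meanD; [|exact: bounded_mfun_cst|by apply: bounded_mfun_sum => m; exact: bounded_mfunD].
    rewrite mean_cst opprD -addrA -[LHS]addr0; congr (_ + _); rewrite !mean_sum//; last first.
      by move=> m; exact: bounded_mfunD.
    apply/esym/eqP; rewrite addrC subr_eq0; apply/eqP/eq_bigr => m _.
    by rewrite meanD// EJ add0r.
  rewrite (le_trans (ler_normD _ _))// addrC; apply: lerD.
    rewrite -[leRHS](mean_cst P); apply: norm_mean_le.
    - exact: bounded_mfun_sum.
    - exact: bounded_mfun_cst.
    - move=> w; rewrite (le_trans (flow_part_le M w t0))// ler_wpM2l //.
      by rewrite ge_min lexx orbT.
  rewrite -!mulrA; apply: (le_trans _ (ler_wpM2l _ (ler_wpM2l B0 (tail M)))) => //.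
  rewrite mulrA -meanZ//; apply: norm_mean_le.
  - exact: bounded_mfunB.
  - by apply: bounded_mfunM => //; exact: bounded_mfun_cst.
  - move=> w; rewrite /stopped; case: ifP => _; last by rewrite subrr normr0 mulr0.
    rewrite mulr1 (le_trans (ler_normB _ _))// mulrDl mul1r lerD//.
apply/ler_addgt0Pr => e e0.
have : (fun M => 2 * B * C * b ^+ M) @ \oo --> (2 * B * C * 0).
  by apply: cvgM; [exact: cvg_cst|apply: cvg_expr; rewrite ger0_norm// ltW].
rewrite mulr0 => /cvgrPdist_lt /(_ e e0) [M _ /(_ M (leqnn M))] /=.
rewrite sub0r normrN => /(le_lt_trans (ler_norm _)) /ltW Me.
by rewrite (le_trans (main M))// lerD2l.
Qed.

End drift.

Section bounded_convergence.
Context d (T : measurableType d) (R : realType) (P : probability T R).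

Lemma mean_cvg (f_ : nat -> T -> R) (f : T -> R) (M : R) :
  (forall n, measurable_fun setT (f_ n)) -> (forall n x, `|f_ n x| <= M) ->
  (forall x, f_ n x @[n --> \oo] --> f x) ->
  bounded_mfun f /\ (\int[P]_x f_ n x @[n --> \oo] --> \int[P]_x f x).
Proof.
move=> mf_ fM ff.
have mf : measurable_fun setT f.
  by apply: (measurable_fun_cvg (h := f_)) => // x _; exact: ff.
have fMl x : `|f x| <= M.
  have cn : `|f_ n x| @[n --> \oo] --> `|f x| by apply: cvg_norm; exact: ff.
  rewrite -(cvg_lim _ cn)//; apply: limr_le; first exact: cvgP cn.
  by near=> n; exact: fM.
have bf : bounded_mfun f by split=> //; exists M.
split=> //.
have bf_ n : bounded_mfun (f_ n) by split=> //; exists M.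
have [] := @dominated_convergence _ T R P setT measurableT
  (fun n x => (f_ n x)%:E) (fun x => (f x)%:E) (cst M%:E).
- by move=> n; exact/measurable_EFinP.
- exact/measurable_EFinP.
- by apply: aeW => x _; apply: cvg_EFin; [exact: nearW|exact: ff].
- exact: (bounded_mfun_integrable P (bounded_mfun_cst T M)).
- by apply: aeW => x n _; rewrite lee_fin.
move=> _ _ cE; apply: fine_cvg.
rewrite /Rintegral fineK//.
exact: integrable_fin_num (bounded_mfun_integrable P bf).
Unshelve. all: by end_near.
Qed.

End bounded_convergence.

(** * Reduction to the state space *)

Section state_space_measurable.
Variables (R : realType) (k : nat).

Lemma mstate_fun_id : mstate_fun (fun x : mstate R k => x : state R k).
Proof.
split=> [n|J|i].
- apply: sub_sigma_algebra; rewrite /state_gen/=; constructor 1; by exists [set n].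
- apply: sub_sigma_algebra; rewrite /state_gen/=; constructor 2; by exists [set J].
- move=> _ B mB; rewrite setTI; apply: sub_sigma_algebra; rewrite /state_gen/=; constructor 3.
  by exists i, B.
Qed.

Lemma discrete_active d (Om : measurableType d) (X : Om -> state R k) i :
  mstate_fun X -> discrete_mfun (fun w => active (X w) i).
Proof.
move=> [_ mJ _]; exact: (discrete_mfun_comp (fun J : {set 'I_k} => activeb J i) mJ).
Qed.

Lemma measurable_state_space : measurable (@state_space R k : set (mstate R k)).
Proof.
have [mL mJ mR] := mstate_fun_id.
rewrite (_ : @state_space R k =
  [set x | #|busy x| = minn (customers x) k] `&`
  ((\bigcap_(i in [set: 'I_k.+1]) [set x | active x i -> 0 < residual x i]) `&`
   (\bigcap_(i in [set: 'I_k.+1]) [set x | ~~ active x i -> residual x i = 0]))); last first.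
  apply/seteqP; split=> x; first by move=> [h1 h2 h3]; split=> //; split=> i _; [exact: h2|exact: h3].
  by move=> [h1 [h2 h3]]; split=> [|i|i]; [exact: h1|exact: (h2 i I)|exact: (h3 i I)].
apply: measurableI; last apply: measurableI.
- exact: (discrete_mfun_preimage
    [set p : nat * {set 'I_k} | #|p.2| = minn p.1 k] (discrete_mfun_pair mL mJ)).
- apply: fin_bigcap_measurable => // i _.
  have mp : discrete_mfun (fun x : mstate R k => 0 < residual x i).
    by apply: discrete_mfun_bool; apply: measurable_lt => //; exact: measurable_cst.
  exact: (discrete_mfun_preimage [set p : bool * bool | p.1 -> p.2]
    (discrete_mfun_pair (discrete_active i mstate_fun_id) mp)).
- apply: fin_bigcap_measurable => // i _.
  have mp : discrete_mfun (fun x : mstate R k => residual x i == 0).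
    by apply: discrete_mfun_bool; exact: (measurable_eq0 (mR i)).
  rewrite (_ : [set x | _] = [set x | ~~ active x i -> residual x i == 0]).
    exact: (discrete_mfun_preimage [set p : bool * bool | ~~ p.1 -> p.2]
      (discrete_mfun_pair (discrete_active i mstate_fun_id) mp)).
  by apply/seteqP; split=> x /= h /h /eqP.
Qed.

Definition idle_state : state R k :=
  State 0 finset.set0 (fun i => (i == ord0)%:R).

Lemma idle_state_space : state_space idle_state.
Proof.
have aE i : active idle_state i = (i == ord0).
  rewrite /active; case: unliftP => [j ->|->]; last by rewrite eqxx.
  by rewrite finset.in_set0 eq_sym eq_liftF.
split=> [|i|i]; rewrite ?aE /=.
- by rewrite cards0 min0n.
- by move=> /eqP ->; rewrite eqxx ltr01.
- by move=> /negPf ->.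
Qed.

(** The estimates hold on [state_space] only, a set of full measure for [pi]; sending all other
    states to one fixed state makes them hold everywhere without changing means. *)
Definition regular (x : state R k) : state R k :=
  if `[<state_space x>] then x else idle_state.

Lemma regular_id x : state_space x -> regular x = x.
Proof. by rewrite /regular; case: asboolP. Qed.

Lemma regular_space x : state_space (regular x).
Proof. by rewrite /regular; case: asboolP => // _; exact: idle_state_space. Qed.

Lemma mstate_fun_regular : mstate_fun (fun x : mstate R k => regular x).
Proof.
have [mL mJ mR] := mstate_fun_id.
have mb : discrete_mfun (fun x : mstate R k => `[<state_space (x : state R k)>]).
  apply: discrete_mfun_bool; rewrite (_ : [set x | _] = @state_space R k).
    exact: measurable_state_space.
  by apply/seteqP; split=> x /asboolP.
split=> [||i].
- rewrite (_ : (fun _ => _) = fun x : mstate R k => if `[<state_space (x : state R k)>]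
    then customers x else 0%N); last by apply: funext => x; rewrite /regular; case: ifP.
  by apply: (discrete_mfun_glue (F := fun (b : bool) (x : mstate R k) =>
    if b then customers x else 0%N) mb) => -[//|]; exact: discrete_mfun_cst.
- rewrite (_ : (fun _ => _) = fun x : mstate R k => if `[<state_space (x : state R k)>]
    then busy x else finset.set0); last by apply: funext => x; rewrite /regular; case: ifP.
  by apply: (discrete_mfun_glue (F := fun (b : bool) (x : mstate R k) =>
    if b then busy x else finset.set0) mb) => -[//|]; exact: discrete_mfun_cst.
- rewrite (_ : (fun _ => _) = fun x : mstate R k => if `[<state_space (x : state R k)>]
    then residual x i else residual idle_state i); last by apply: funext => x; rewrite /regular; case: ifP.
  by apply: (measurable_glue (F := fun (b : bool) (x : mstate R k) =>
    if b then residual x i else residual idle_state i) mb) => -[//|]; exact: measurable_cst.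
Qed.

End state_space_measurable.

Lemma discrete_mfun_precomp d d' (Om : measurableType d)
    (Om' : measurableType d') (T : countType) (h : Om -> Om') (D : Om' -> T) :
  measurable_fun setT h -> discrete_mfun D -> discrete_mfun (fun w => D (h w)).
Proof.
move=> mh mD t; rewrite -[X in measurable X]setTI.
exact: (mh measurableT _ (mD t)).
Qed.

Lemma mstate_fun_precomp (R : realType) (k : nat) d d' (Om : measurableType d)
    (Om' : measurableType d') (h : Om -> Om') (X : Om' -> state R k) :
  measurable_fun setT h -> mstate_fun X -> mstate_fun (fun w => X (h w)).
Proof.
move=> mh [mL mJ mR]; split=> [||i].
- exact: discrete_mfun_precomp mL.
- exact: discrete_mfun_precomp mJ.
- exact: (measurableT_comp (mR i) mh).
Qed.

Section integral_null.
Context d (T : measurableType d) (R : realType) (mu : {measure set T -> \bar R}).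
Local Open Scope ereal_scope.

(** The integral is a supremum over simple functions below, so monotonicity needs no measurability.
    It is applied to [transition], for which measurability off the state space is not
    established. *)
Lemma ge0_le_integral_pointwise (f g : T -> \bar R) :
  (forall x, 0 <= f x) -> (forall x, f x <= g x) ->
  \int[mu]_x f x <= \int[mu]_x g x.
Proof.
move=> f0 fg; rewrite !ge0_integralTE//; last first.
  by move=> x; exact: le_trans (f0 x) (fg x).
apply: le_ereal_sup => _ [h hf <-]; exists h => // x.
exact: le_trans (hf x) (fg x).
Qed.

(* Here [f] need not be measurable outside of [A]. *)
Lemma ge0_integral_null_eq (A : set T) (f g : T -> \bar R) :
  measurable A -> mu (~` A) = 0 -> (forall x, 0 <= f x) ->
  (forall x, 0 <= g x) -> measurable_fun setT g ->
  (forall x, A x -> f x = g x) -> \int[mu]_x f x = \int[mu]_x g x.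
Proof.
move=> mA A0 f0 g0 mg fg.
have mb : discrete_mfun (fun x => `[<A x>]).
  apply: discrete_mfun_bool; rewrite (_ : [set x | _] = A)//.
  by apply/seteqP; split=> x /asboolP.
(* The choices [c = +oo] and [c = 0] bound [f] from above and below by measurable functions with the
   integral of [g]. *)
pose h (c : \bar R) x := if `[<A x>] then g x else c.
have mh c : measurable_fun setT (h c).
  apply: (measurable_glue (F := fun (b : bool) x => if b then g x else c) mb).
  by move=> -[//|]; exact: measurable_cst.
have inth c : 0 <= c -> \int[mu]_x h c x = \int[mu]_x g x.
  move=> c0; apply: ae_eq_integral => //; exists (~` A); split=> //.
    exact: measurableC.
  by move=> x /= nh Ax; apply: nh => _; rewrite /h asboolT.
apply/eqP; rewrite eq_le; apply/andP; split.
- rewrite -(inth +oo) ?leey//; apply: ge0_le_integral_pointwise => // x.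
  by rewrite /h; case: asboolP => [/fg ->//|_]; rewrite leey.
- rewrite -(inth 0)//; apply: ge0_le_integral_pointwise => x.
    by rewrite /h; case: ifP.
  by rewrite /h; case: asboolP => [/fg ->//|_].
Qed.

End integral_null.

(** * Stationarity as an identity of means *)

Section stationary_mean.
Context d (Om : measurableType d) (R : realType) (P : probability Om R).
Variables (k : nat) (Q : hetero_queue P k).
Variable pi : probability (mstate R k) R.
Hypothesis pi_stat : stationary_distribution Q pi.

Let Psi (t : R) (p : mstate R k * Om) : mstate R k :=
  queue_process Q (regular p.1) t p.2.

(** Joint measurability in the initial state and the primitives is what Fubini requires; [regular]
    guarantees that the event times are nondecreasing. *)
Lemma queue_process_joint t : mstate_fun (fun p : mstate R k * Om =>
  queue_process Q (regular p.1) t p.2).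
Proof.
have mX : mstate_fun (fun p : mstate R k * Om => regular p.1).
  exact: (mstate_fun_precomp measurable_fst (mstate_fun_regular R k)).
have mtm i l : measurable_fun setT (fun p : mstate R k * Om => time Q i l p.2).
  by apply: measurableT_comp => //; exact: measurable_snd.
have msel A j m : discrete_mfun (fun p : mstate R k * Om => select Q A j m p.2).
  by apply: (discrete_mfun_precomp measurable_snd) => D; exact: select_measurable.
pose tm m (p : mstate R k * Om) := qtime Q (regular p.1) p.2 m.
have mtime m : measurable_fun setT (tm m) := run_time_measurable mX mtm msel m.
have mrun m : mstate_fun (fun p : mstate R k * Om => (qrun Q (regular p.1) p.2 m).1).
  by have [] := run_measurable mX mtm msel m.
have mN : discrete_mfun (clock_index tm t).
  apply: discrete_clock_index => // p m1 m2; apply: qtime_le.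
  exact/state_space_valid/regular_space.
rewrite (_ : (fun p => _) = fun p =>
    (fun m p => elapse (t - tm m p) (qrun Q (regular p.1) p.2 m).1)
      (clock_index tm t p) p); last first.
  by apply/funext => p; rewrite queue_processE.
apply: (mstate_fun_glue (Y := fun m p =>
  elapse (t - tm m p) (qrun Q (regular p.1) p.2 m).1) mN) => m.
apply: mstate_fun_elapse => //.
by apply: measurable_funB => //; exact: measurable_cst.
Qed.

Lemma pi_state_space_ae (f : mstate R k -> R) : bounded_mfun f ->
  bounded_mfun (fun x : mstate R k => f (regular x)) /\
  \int[pi]_x f (regular x) = \int[pi]_x f x.
Proof.
move=> bf.
have br : bounded_mfun (fun x : mstate R k => f (regular x)).
  exact: (bounded_mfun_comp (mstate_funP (mstate_fun_regular R k)) bf).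
split=> //; have h := mean_ae_eq br bf (@measurable_state_space R k) pi_stat.1.
apply: h.
by move=> x sx; rewrite regular_id.
Qed.

(** Stationarity means that the image of [pi \x P] under [Psi t] is [pi]; change of variables and
    Fubini turn this into the identity. *)
Lemma stationary_mean (f : mstate R k -> R) t : 0 <= t -> bounded_mfun f ->
  bounded_mfun (fun x : mstate R k => \int[P]_w f (Psi t (x, w))) /\
  \int[pi]_x \int[P]_w f (Psi t (x, w)) = \int[pi]_x f x.
Proof.
move=> t0 bf.
have mPsi : measurable_fun setT (Psi t) := mstate_funP (queue_process_joint t).
have lawE B : measurable B -> (pushforward (pi \x P)%E (Psi t)) B = pi B.
  move=> mB; rewrite -(pi_stat.2 t B t0 mB) /pushforward /product_measure1.
  have mS := @measurable_state_space R k.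
  apply/esym; apply: (ge0_integral_null_eq mS) => //.
  - apply: (etrans (probability_setC pi mS)); rewrite pi_stat.1 subee//.
  - apply: measurable_fun_xsection.
    by rewrite -[X in measurable X]setTI; exact: mPsi.
  - move=> x sx; rewrite /transition /=; congr (P _).
    by apply/seteqP; split=> w; rewrite /xsection/= inE /= /Psi/= regular_id.
have bfPsi : bounded_mfun (f \o Psi t) by exact: bounded_mfun_comp.
have mu1 : (pi \x P)%E setT = 1%E.
  rewrite -setXTT product_measure1E//; transitivity (1 * 1 : \bar R)%E.
    by congr (_ * _)%E; exact: probability_setT.
  by rewrite mule1.
have iPsi : (pi \x P)%E.-integrable setT (EFin \o (f \o Psi t)).
  have [mfP [M fM]] := bfPsi.
  have muy : ((pi \x P)%E setT < +oo)%E by rewrite mu1 ltry.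
  apply: measurable_bounded_integrable => //.
  exists M; split; first exact: num_real.
  by move=> y My p _; apply: le_trans (fM p) _; exact: ltW.
have bF x : bounded_mfun (fun w => f (Psi t (x, w))).
  split; last by have [_ [M fM]] := bf; exists M.
  apply: measurableT_comp; first by case: bf.
  by apply: (measurable_fun_pair2 _ mPsi).
have FE x : (\int[P]_w (f (Psi t (x, w)))%:E = (\int[P]_w f (Psi t (x, w)))%:E)%E.
  rewrite /Rintegral fineK//.
  exact: integrable_fin_num (bounded_mfun_integrable P (bF x)).
split.
  split; last first.
    have [_ [M fM]] := bf; exists M => x.
    rewrite -[leRHS](mean_cst P); apply: norm_mean_le => //.
    exact: bounded_mfun_cst.
  apply/measurable_EFinP; rewrite (_ : _ \o _ = fun x =>
    (\int[P]_w (f (Psi t (x, w)))%:E)%E); last by apply/funext => x; rewrite FE.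
  exact: (measurable_fubini_F iPsi).
rewrite {1}/Rintegral; under eq_integral do rewrite -FE.
rewrite (integral12_prod_meas1 iPsi) /Rintegral; congr fine.
have mf : measurable_fun setT (EFin \o f) by apply/measurable_EFinP; case: bf.
transitivity (\int[pushforward (pi \x P)%E (Psi t)]_x (f x)%:E)%E.
  by rewrite (integral_pushforward mPsi mf iPsi measurableT).
by apply: eq_measure_integral => B mB _; exact: lawE.
Qed.

End stationary_mean.

Section products.
Variable R : realType.

Lemma norm_prod_diff_le (I : Type) (s : seq I) (a b : I -> R) (B e : R) :
  1 <= B -> 0 <= e -> (forall i, `|a i| <= B) -> (forall i, `|b i| <= B) ->
  (forall i, `|a i - b i| <= e) ->
  `|\prod_(i <- s) a i - \prod_(i <- s) b i| <= (size s)%:R * B ^+ size s * e.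
Proof.
move=> B1 e0 aB bB ab; have B0 : 0 <= B by rewrite (le_trans _ B1).
elim: s => [|i s IHs].
  by rewrite !big_nil subrr normr0 mul0r mul0r.
rewrite !big_cons (_ : _ - _ = (a i - b i) * \prod_(j <- s) a j +
  b i * (\prod_(j <- s) a j - \prod_(j <- s) b j)); last by ring.
rewrite (le_trans (ler_normD _ _))// !normrM.
have pB : `|\prod_(j <- s) a j| <= B ^+ size s.
  elim: (s) => [|j s' IH]; first by rewrite big_nil normr1.
  by rewrite big_cons normrM exprS ler_pM.
have h1 : `|a i - b i| * `|\prod_(j <- s) a j| <= e * B ^+ size s by rewrite ler_pM.
have h2 : `|b i| * `|\prod_(j <- s) a j - \prod_(j <- s) b j| <=
    B * ((size s)%:R * B ^+ size s * e) by rewrite ler_pM.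
apply: (le_trans (lerD h1 h2)).
have : B ^+ size s <= B ^+ (size s).+1 by rewrite ler_weXn2l.
rewrite /= exprS => BB; rewrite -[(size s).+1]addn1 natrD.
have := ler_wpM2r e0 BB; nra.
Qed.

(** The product rule in logarithmic form, the [e i] being logarithmic derivatives. *)
Lemma prod_quotient_cvg (I : Type) (s : seq I) (a : nat -> I -> R)
    (b e : I -> R) (t : nat -> R) : (forall n, t n != 0) ->
  t n @[n --> \oo] --> (0 : R) ->
  (forall i, (a n i - b i) / t n @[n --> \oo] --> b i * e i) ->
  (\prod_(i <- s) a n i - \prod_(i <- s) b i) / t n @[n --> \oo] -->
  (\prod_(i <- s) b i) * \sum_(i <- s) e i.
Proof.
move=> tn0 t0 ab; elim: s => [|i s IHs].
  under eq_cvg do rewrite !big_nil subrr mul0r.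
  by rewrite !big_nil mulr0; exact: cvg_cst.
have As : \prod_(j <- s) a n j @[n --> \oo] --> \prod_(j <- s) b j.
  rewrite (_ : (fun n => _) = fun n => \prod_(j <- s) b j +
    t n * ((\prod_(j <- s) a n j - \prod_(j <- s) b j) / t n)); last first.
    by apply/funext => n; rewrite mulrCA divff// mulr1 addrC subrK.
  rewrite -[X in _ --> X]addr0; apply: cvgD; first exact: cvg_cst.
  by rewrite -(mul0r ((\prod_(j <- s) b j) * \sum_(j <- s) e j)); exact: cvgM.
rewrite (_ : (fun n => _) = fun n => (a n i - b i) / t n * \prod_(j <- s) a n j +
   b i * ((\prod_(j <- s) a n j - \prod_(j <- s) b j) / t n)); last first.
  by apply/funext => n; rewrite !big_cons; field.
rewrite !big_cons (_ : _ * _ = b i * e i * \prod_(j <- s) b j +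
  b i * ((\prod_(j <- s) b j) * \sum_(j <- s) e j)); last by ring.
by apply: cvgD; [exact: cvgM|apply: cvgM => //; exact: cvg_cst].
Qed.

End products.

Section stationary_equation.
Context d (Om : measurableType d) (R : realType) (P : probability Om R).
Variables (k : nat) (Q : hetero_queue P k).
Hypothesis time_pos : forall i, (0 < P [set w | (0 < gtime Q i w)%R])%E.
Variable pi : probability (mstate R k) R.
Hypothesis pi_stat : stationary_distribution Q pi.
Variable z : R.
Hypothesis z01 : 0 < z <= 1.
Variable g : 'I_k.+1 -> R -> R.
Hypothesis g0 : forall i, g i 0 = 1.
Hypothesis mg : forall i, measurable_fun setT (g i).
Variables B ell : R.
Hypothesis gB : forall i r, `|g i r| <= B.
Hypothesis g_lip : forall i r s, 0 <= s -> s <= r ->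
  `|g i (r - s) - g i r| <= ell * s.
Variable e : 'I_k.+1 -> R -> R.
Hypothesis g_diff : forall i r, 0 < r ->
  (g i (r - n.+1%:R^-1) - g i r) / n.+1%:R^-1 @[n --> \oo] --> g i r * e i r.
Hypothesis mean_g0 : \int[P]_w g ord0 (gtime Q ord0 w) = z^-1.
Hypothesis mean_g : forall j,
  \int[P]_w g (lift ord0 j) (gtime Q (lift ord0 j) w) = z.

Notation f := (test_fun (waiting_weight z) g).

Let bg i : bounded_mfun (g i).
Proof. by split=> //; exists B. Qed.

Let B1 : 1 <= B.
Proof. by rewrite -[leLHS]normr1 -(g0 ord0). Qed.

Let ell0 : 0 <= ell.
Proof.
have := g_lip ord0 ler01 (lexx _); rewrite mulr1; exact: le_trans.
Qed.

Let L : R := k.+1%:R * B ^+ k.+1 * ell.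

Let L0 : 0 <= L.
Proof. by rewrite mulr_ge0// mulr_ge0// exprn_ge0// (le_trans _ B1). Qed.

Lemma test_fun_elapse (y : state R k) s : valid y ->
  test_fun (waiting_weight z) g (elapse s y) =
  waiting_weight z (customers y) (busy y) *
    \prod_i g i (if active y i then residual y i - s else residual y i).
Proof.
move=> [_ _ vz]; rewrite /test_fun /=; congr (_ * _); apply: eq_bigr => i _.
by case: ifPn => // /vz ->.
Qed.

Lemma waiting_weight01 n (J : {set 'I_k}) : 0 <= waiting_weight z n J <= 1.
Proof.
case/andP: z01 => z0 z1; have z0' := ltW z0.
by rewrite /waiting_weight exprn_ge0// exprn_ile1.
Qed.

Lemma test_fun_flow_lip y s : valid y -> 0 <= s <= next_event y ->
  `|f (elapse s y) - f y| <= L * s.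
Proof.
move=> vy /andP[s0 sn]; rewrite test_fun_elapse// /test_fun -mulrBr normrM.
have /andP[w0 w1] := waiting_weight01 (customers y) (busy y).
rewrite ger0_norm//; apply: (le_trans (ler_wpM2r _ w1)) => //.
rewrite mul1r /L -mulrA.
have := @norm_prod_diff_le R _ (index_enum 'I_k.+1)
  (fun i => g i (if active y i then residual y i - s else residual y i))
  (fun i => g i (residual y i)) B (ell * s) B1.
rewrite /index_enum/= -enumT size_enum_ord => h; rewrite !mulrA in h *.
apply: h => //; first exact: mulr_ge0.
move=> i; case: ifPn => [ai|_]; last by rewrite subrr normr0 mulr_ge0.
by apply: g_lip => //; rewrite (le_trans sn)//; exact: next_event_le.
Qed.

Definition drift_fun (y : state R k) : R :=
  f y * \sum_i (active y i)%:R * e i (residual y i).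

(** Running clocks are strictly positive on the state space, so for small times no event occurs and
    the process is the deterministic flow, to which [prod_quotient_cvg] applies. *)
Lemma drift_cvg (y : state R k) : state_space y ->
  (\int[P]_w f (queue_process Q y n.+1%:R^-1 w) - f y) / n.+1%:R^-1
  @[n --> \oo] --> drift_fun y.
Proof.
move=> sy; have vy := state_space_valid sy.
have ne0 : 0 < next_event y.
  by have [i ai ->] := next_event_attained y; case: sy => _ + _; apply.
have tn : n.+1%:R^-1 @[n --> \oo] --> (0 : R) by exact: cvg_harmonic.
have E : \forall n \near \oo, (f (elapse n.+1%:R^-1 y) - f y) / n.+1%:R^-1 =
   (\int[P]_w f (queue_process Q y n.+1%:R^-1 w) - f y) / n.+1%:R^-1.
  near=> n; congr ((_ - _) / _).
  have tlt : n.+1%:R^-1 < next_event y.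
    near: n; move/cvgrPdist_lt : tn => /(_ _ ne0); apply: filterS => n.
    by rewrite sub0r normrN ger0_norm.
  rewrite -[LHS](mean_cst P); apply: eq_Rintegral => w _; congr f.
  rewrite (queue_process_at (m := 0) vy) ?qtime0 ?subr0//.
  by rewrite invr_ge0 ler0n/= qtimeS qtime0 add0r.
apply: cvg_trans (near_eq_cvg E) _.
rewrite (_ : drift_fun y = waiting_weight z (customers y) (busy y) *
  ((\prod_i g i (residual y i)) * \sum_i (active y i)%:R * e i (residual y i)));
  last by rewrite mulrA.
rewrite (_ : (fun n => _) = fun n => waiting_weight z (customers y) (busy y) *
  ((\prod_i g i (if active y i then residual y i - n.+1%:R^-1 else residual y i)
    - \prod_i g i (residual y i)) / n.+1%:R^-1)); last first.
  by apply/funext => n; rewrite test_fun_elapse// /test_fun -mulrBr mulrA.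
apply: cvgM; first exact: cvg_cst.
apply: (@prod_quotient_cvg R _ (index_enum 'I_k.+1)
  (fun n i => g i (if active y i then residual y i - n.+1%:R^-1 else residual y i))
  (fun i => g i (residual y i)) (fun i => (active y i)%:R * e i (residual y i))
  (fun n => n.+1%:R^-1)) => // i.
have [ai|ai] := boolP (active y i); last first.
  rewrite mul0r mulr0; under eq_cvg do rewrite subrr mul0r.
  exact: cvg_cst.
by rewrite mul1r; apply: g_diff; case: sy => _ + _; apply.
Unshelve. all: by end_near.
Qed.

(** Every difference quotient has mean 0 by stationarity and is bounded by [L] through
    [mean_drift_le]; the pointwise limit of [drift_cvg] therefore has mean 0 too. *)
Lemma stationary_equation : bounded_mfun (drift_fun : mstate R k -> R) ->
  \int[pi]_x drift_fun x = 0.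
Proof.
move=> bD.
pose fm : mstate R k -> R := f.
have bf : bounded_mfun fm.
  apply: mstate_test_fun => //; last exact: mstate_fun_id.
  exists 1 => n J; have /andP[w0 w1] := waiting_weight01 n J.
  by rewrite ger0_norm.
pose t n : R := n.+1%:R^-1.
have t0 n : 0 < t n by rewrite invr_gt0.
pose D n (x : mstate R k) : R :=
  (\int[P]_w f (queue_process Q (regular x) (t n) w) - f (regular x)) / t n.
have [bfr Efr] := pi_state_space_ae pi_stat bf.
have bP n : bounded_mfun (fun x : mstate R k =>
    \int[P]_w f (queue_process Q (regular x) (t n) w)).
  by have [] := stationary_mean pi_stat (ltW (t0 n)) bf.
have bDn n : bounded_mfun (D n).
  apply: bounded_mfunM; last exact: bounded_mfun_cst.
  exact: bounded_mfunB.
have ED n : \int[pi]_x D n x = 0.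
  rewrite /D; under eq_Rintegral do rewrite mulrC.
  rewrite meanZ; last exact: bounded_mfunB.
  rewrite meanB// Efr.
  have [_ ->] := stationary_mean pi_stat (ltW (t0 n)) bf.
  by rewrite subrr mulr0.
have DL n x : `|D n x| <= L.
  rewrite /D normrM normfV (ger0_norm (ltW (t0 n))) ler_pdivrMr//.
  apply: (@mean_drift_le _ _ _ P _ Q (regular x) _ z z01 g) => //.
  - exact/state_space_valid/regular_space.
  - exact: test_fun_flow_lip.
  - exact/ltW.
have [_ cD] := mean_cvg pi (fun n => (bDn n).1) DL
  (fun x => drift_cvg (regular_space x)).
have [_ <-] := pi_state_space_ae pi_stat bD.
move: cD; under eq_cvg do rewrite ED.
by move=> /(cvg_lim (@Rhausdorff R)) <-; rewrite lim_cst.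
Qed.

End stationary_equation.

(** * Clock functions *)

Section exponential_bounds.
Variable R : realType.
Implicit Types x : R.

Lemma expR_sub1_le x : expR x - 1 <= x * expR x.
Proof.
have := expR_ge1Dx (- x); rewrite -(ler_pM2r (expR_gt0 x)) -expRD addNr expR0.
rewrite mulrDl mul1r mulNr => h; lra.
Qed.

Lemma expR_taylor1 x : `|expR x - 1| <= `|x| * expR `|x|.
Proof.
have h1 := expR_sub1_le x; have h2 := expR_ge1Dx x.
have e1 : 1 <= expR `|x| by rewrite -expR0 ler_expR.
have [x0|x0] := leP 0 x.
  by rewrite ger0_norm ?subr_ge0 -?expR0 ?ler_expR// expR0 !ger0_norm.
rewrite ler0_norm; last by rewrite subr_le0 -expR0 ler_expR ltW.
rewrite (ltr0_norm x0); have : 1 <= expR (- x).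
  by rewrite -expR0 ler_expR oppr_ge0 ltW.
nra.
Qed.

Lemma expR_taylor2 x : `|expR x - 1 - x| <= x ^+ 2 * expR `|x|.
Proof.
have h1 := expR_sub1_le x; have h2 := expR_ge1Dx x.
have h3 := expR_taylor1 x.
have x0 : 0 <= `|x| by [].
rewrite ger0_norm; last by lra.
rewrite -(real_normK (num_real x)) expr2 -mulrA.
apply: (@le_trans _ _ (`|x| * `|expR x - 1|)); last exact: ler_wpM2l.
rewrite -normrM (le_trans _ (ler_norm _))//; lra.
Qed.

(** Mean value theorem: the derivative of this remainder is the one bounded in [expR_taylor2]. *)
Lemma expR_taylor3 x :
  `|expR x - (1 + x + x ^+ 2 / 2)| <= `|x| ^+ 3 * expR `|x|.
Proof.
pose h (y : R) := expR y - (1 + y + y ^+ 2 / 2).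
pose h' (y : R) := expR y - 1 - y.
have dh (y : R) : is_derive y (1 : R) h (h' y).
  rewrite /h /h'; apply: is_derive_eq; rewrite /GRing.scale/=; by field.
have ch : continuous h.
  by move=> y; apply/differentiable_continuous/derivable1_diffP; exact: ex_derive.
have h0 : h 0 = 0 by rewrite /h expR0; lra.
have key c : `|c| <= `|x| -> `|h' c * x| <= `|x| ^+ 3 * expR `|x|.
  move=> cx; rewrite normrM exprSr mulrAC; apply: ler_wpM2r => //.
  apply: (le_trans (expR_taylor2 c)); rewrite -(real_normK (num_real c)).
  by apply: ler_pM; rewrite ?exprn_ge0 ?expR_ge0// ?ler_expR// lerXn2r ?nnegrE.
have [x0|x0|x0] := ltgtP x 0.
- have [c|c cx E] := MVT x0 (fun y _ => dh y).
    exact: continuous_subspaceT.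
  have hx : h x = h' c * x by move: E; rewrite h0 !sub0r mulrN => /oppr_inj.
  rewrite -/(h x) hx; apply: key.
  by move: cx; rewrite in_itv/= => /andP[cx c0]; rewrite !ltr0_norm// lerN2 ltW.
- have [c|c cx E] := MVT x0 (fun y _ => dh y).
    exact: continuous_subspaceT.
  have hx : h x = h' c * x by move: E; rewrite h0 !subr0.
  rewrite -/(h x) hx; apply: key.
  by move: cx; rewrite in_itv/= => /andP[c0 cx]; rewrite !gtr0_norm// ltW.
- by rewrite x0 -/(h 0) h0 normr0 mulr_ge0 ?expR_ge0.
Qed.

Lemma expR_quotient_cvg (eta : R) (t : nat -> R) : (forall n, t n != 0) ->
  t n @[n --> \oo] --> (0 : R) ->
  (expR (eta * t n) - 1) / t n @[n --> \oo] --> eta.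
Proof.
move=> tn0 t0.
have nt : `|t n| @[n --> \oo] --> (0 : R) by rewrite -(normr0 R); exact: cvg_norm.
have et : eta * t n @[n --> \oo] --> (0 : R).
  by rewrite -(mulr0 eta); apply: cvgM => //; exact: cvg_cst.
have ent : `|eta * t n| @[n --> \oo] --> (0 : R).
  by rewrite -(normr0 R); exact: cvg_norm.
have bt : (eta ^+ 2 * `|t n|) * expR `|eta * t n| @[n --> \oo] --> (0 : R).
  rewrite -(mul0r (expR 0)) -[X in X * _](mulr0 (eta ^+ 2)).
  apply: cvgM; first by apply: cvgM => //; exact: cvg_cst.
  exact: (cvg_comp _ _ ent (@continuous_expR R _)).
apply/cvgrPdist_le => ep ep0; move/cvgrPdist_le : bt => /(_ ep ep0).
apply: filterS => n; rewrite sub0r normrN => bn.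
apply: le_trans (le_trans (ler_norm _) bn).
rewrite distrC (_ : _ - _ = (expR (eta * t n) - 1 - eta * t n) / t n); last by field.
rewrite normrM normfV ler_pdivrMr ?normr_gt0//.
apply: (le_trans (expR_taylor2 _)).
by rewrite exprMn -(real_normK (num_real (t n))) le_eqVlt; apply/orP; left; apply/eqP; ring.
Qed.

End exponential_bounds.

Section clip.
Variable R : realType.
Implicit Types b r s : R.

(** For residual times this is the minimum with [b]; the cut at 0 makes it bounded on the whole
    line. *)
Definition clip b r : R := Num.min (Num.max r 0) b.

Lemma clip_ge0 b r : 0 <= b -> 0 <= clip b r.
Proof. by move=> b0; rewrite /clip le_min b0 le_max lexx orbT. Qed.

Lemma clip_le b r : clip b r <= b.
Proof. by rewrite /clip ge_min lexx orbT. Qed.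

Lemma clip0 b : 0 <= b -> clip b 0 = 0.
Proof. by move=> b0; rewrite /clip max_l// min_l. Qed.

Lemma clip_lip b r s : 0 <= b -> 0 <= s -> `|clip b (r - s) - clip b r| <= s.
Proof.
move=> b0 s0; rewrite /clip ler_norml.
have [h1|h1] := leP (r - s) 0; have [h2|h2] := leP r 0.
- by have [h3|h3] := leP 0 b; apply/andP; split; lra.
- by have [h3|h3] := leP 0 b; have [h4|h4] := leP r b; apply/andP; split; lra.
- by have [h3|h3] := leP 0 b; have [h4|h4] := leP (r - s) b; apply/andP; split; lra.
- by have [h3|h3] := leP r b; have [h4|h4] := leP (r - s) b; apply/andP; split; lra.
Qed.

Lemma clip_le_id b r : 0 <= r -> clip b r <= r.
Proof. by move=> r0; rewrite /clip max_l// ge_min lexx. Qed.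

Lemma clip_id b r : 0 <= r -> r <= b -> clip b r = r.
Proof. by move=> r0 rb; rewrite /clip max_l// min_l. Qed.

Lemma clip_gt b r : 0 <= r -> b <= r -> clip b r = b.
Proof. by move=> r0 rb; rewrite /clip max_l// min_r. Qed.

Lemma measurable_clip b : measurable_fun setT (clip b).
Proof.
apply: measurable_minr; last exact: measurable_cst.
by apply: measurable_maxr; [exact: measurable_id|exact: measurable_cst].
Qed.

(* The linear term, of lower order, makes it possible to give the mean any
   prescribed value near 1 exactly. *)
Definition clock_fun (eta del b r : R) : R :=
  expR (- (eta * clip b r)) + del * clip b r.

Variables eta del b : R.
Hypothesis b_gt0 : 0 < b.

Let b0 : 0 <= b := ltW b_gt0.

Lemma clock_fun0 : clock_fun eta del b 0 = 1.
Proof. by rewrite /clock_fun clip0// !mulr0 oppr0 expR0 addr0. Qed.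

Lemma measurable_clock_fun : measurable_fun setT (clock_fun eta del b).
Proof.
apply: measurable_funD.
  apply: measurableT_comp => //; apply: measurableT_comp => //.
  by apply: measurable_funM; [exact: measurable_cst|exact: measurable_clip].
by apply: measurable_funM; [exact: measurable_cst|exact: measurable_clip].
Qed.

Lemma expR_clip_bounds r :
  expR (- (`|eta| * b)) <= expR (- (eta * clip b r)) <= expR (`|eta| * b).
Proof.
have c0 := clip_ge0 r b0; have cb := clip_le b r.
have h : `|eta * clip b r| <= `|eta| * b.
  by rewrite normrM; apply: ler_pM => //; rewrite ger0_norm.
by move: h; rewrite ler_norml !ler_expR => /andP[h1 h2]; apply/andP; split; lra.
Qed.

Lemma clock_fun_le r : `|clock_fun eta del b r| <= expR (`|eta| * b) + `|del| * b.
Proof.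
have c0 := clip_ge0 r b0; have cb := clip_le b r.
have /andP[h1 h2] := expR_clip_bounds r.
rewrite (le_trans (ler_normD _ _))// ger0_norm ?expR_ge0//; apply: lerD => //.
by rewrite normrM; apply: ler_pM => //; rewrite ger0_norm.
Qed.

Lemma clock_fun_lip r s : 0 <= s -> s <= r ->
  `|clock_fun eta del b (r - s) - clock_fun eta del b r| <=
  (expR (`|eta| * b) * (`|eta| * expR (`|eta| * b)) + `|del|) * s.
Proof.
move=> s0 sr; have cl := clip_lip r b0 s0.
have c0 := clip_ge0 r b0; have c0' := clip_ge0 (r - s) b0.
have cb := clip_le b r; have cb' := clip_le b (r - s).
rewrite /clock_fun; set u := clip b (r - s) in cl c0' cb' *; set v := clip b r in cl c0 cb *.
have -> : expR (- (eta * u)) + del * u - (expR (- (eta * v)) + del * v) =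
    expR (- (eta * v)) * (expR (eta * (v - u)) - 1) + del * (u - v).
  rewrite mulrBr -expRD (_ : - (eta * v) + eta * (v - u) = - (eta * u)); ring.
rewrite (le_trans (ler_normD _ _))// mulrDl; apply: lerD; last first.
  by rewrite normrM ler_wpM2l.
rewrite normrM ger0_norm ?expR_ge0// -mulrA; apply: ler_pM => //.
- by have /andP[] := expR_clip_bounds r.
- apply: (le_trans (expR_taylor1 _)); rewrite normrM -mulrA -mulrA.
  apply: ler_wpM2l => //; rewrite mulrC; apply: ler_pM => //.
  + rewrite ler_expR; apply: ler_wpM2l => //.
    by rewrite ler_norml; apply/andP; split; lra.
  + by rewrite distrC.
Qed.

(** Minus the left derivative of [clock_fun]: clocks run down, so the kink at [b] belongs to the
    part below the cap. *)
Definition clock_slope r : R :=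
  (r <= b)%R%:R * (eta * expR (- (eta * clip b r)) - del).

Lemma clock_fun_diff r : 0 < r ->
  (clock_fun eta del b (r - n.+1%:R^-1) - clock_fun eta del b r) / n.+1%:R^-1
  @[n --> \oo] --> clock_slope r.
Proof.
move=> r0; have r0' := ltW r0.
have tn : n.+1%:R^-1 @[n --> \oo] --> (0 : R) by exact: cvg_harmonic.
have ev ep : 0 < ep -> \forall n \near \oo, n.+1%:R^-1 <= ep :> R.
  move=> ep0; move/cvgrPdist_le : tn => /(_ _ ep0); apply: filterS => n.
  by rewrite sub0r normrN ger0_norm.
rewrite /clock_slope; have [rb|rb] := leP r b; last first.
  rewrite mul0r; apply: cvg_near_cst.
  have rb' : 0 < r - b by rewrite subr_gt0.
  near=> n; have nb : n.+1%:R^-1 <= r - b by near: n; exact: ev.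
  move: nb; move: (n.+1%:R^-1) => u nb.
  rewrite /clock_fun (clip_gt r0' (ltW rb)) clip_gt ?subrr ?mul0r//.
    by rewrite subr_ge0 (le_trans nb)// lerBlDr lerDl.
  by rewrite lerBrDl -lerBrDr.
rewrite mul1r (clip_id r0' rb).
have E : \forall n \near \oo, expR (- (eta * r)) * ((expR (eta * n.+1%:R^-1) - 1) / n.+1%:R^-1) - del =
  (clock_fun eta del b (r - n.+1%:R^-1) - clock_fun eta del b r) / n.+1%:R^-1.
  near=> n; have nr : n.+1%:R^-1 <= r by near: n; exact: ev.
  have n0 : 0 < n.+1%:R^-1 :> R by rewrite invr_gt0.
  rewrite /clock_fun (clip_id r0' rb) clip_id ?subr_ge0//; last first.
    by rewrite (le_trans _ rb)// lerBlDr lerDl ltW.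
  have -> : expR (- (eta * (r - n.+1%:R^-1))) = expR (- (eta * r)) * expR (eta * n.+1%:R^-1).
    by rewrite -expRD; congr expR; ring.
  by field; rewrite addrC natr1.
apply: cvg_trans (near_eq_cvg E) _.
apply: cvgB; last exact: cvg_cst.
rewrite [X in _ --> X]mulrC; apply: cvgM; first exact: cvg_cst.
by apply: expR_quotient_cvg => // n; rewrite invr_eq0.
Unshelve. all: by end_near.
Qed.

End clip.

Section clock_equation.
Context d (Om : measurableType d) (R : realType) (P : probability Om R).
Variables (k : nat) (Q : hetero_queue P k).
Hypothesis time_pos : forall i, (0 < P [set w | (0 < gtime Q i w)%R])%E.
Variable pi : probability (mstate R k) R.
Hypothesis pi_stat : stationary_distribution Q pi.

Section exponents.
Variables (z : R) (eta del b : 'I_k.+1 -> R).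
Hypothesis z01 : 0 < z <= 1.
Hypothesis b_gt0 : forall i, 0 < b i.
Hypothesis small : forall i, `|del i| * b i * expR (`|eta i| * b i) <= 2^-1.

Definition clock i := clock_fun (eta i) (del i) (b i).

(** By [small] the linear term is at most half of the least value of the exponential. A positive
    lower bound is what keeps [log_slope] bounded. *)
Lemma clock_ge i r : expR (- (`|eta i| * b i)) / 2 <= clock i r.
Proof.
have b0 := ltW (b_gt0 i).
have /andP[h1 _] := expR_clip_bounds (eta i) (b_gt0 i) r.
have c0 := clip_ge0 r b0; have cb := clip_le (b i) r.
have : `|del i * clip (b i) r| <= `|del i| * b i.
  by rewrite normrM; apply: ler_pM => //; rewrite ger0_norm.
rewrite ler_norml => /andP[h2 _].
have := small i; rewrite -ler_pdivlMr ?expR_gt0// -expRN => h3.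
by rewrite /clock /clock_fun; lra.
Qed.

Lemma clock_gt0 i r : 0 < clock i r.
Proof. by apply: lt_le_trans (clock_ge i r); rewrite divr_gt0// expR_gt0. Qed.

Lemma bounded_clock i : bounded_mfun (clock i).
Proof.
split; first exact: measurable_clock_fun.
by exists (expR (`|eta i| * b i) + `|del i| * b i) => r; exact: clock_fun_le.
Qed.

Definition log_slope i r : R :=
  clock_slope (eta i) (del i) (b i) r / clock i r.

Lemma bounded_clock_slope i :
  bounded_mfun (clock_slope (eta i) (del i) (b i)).
Proof.
apply: bounded_mfunM.
  apply: bounded_mfun_bool; apply: measurable_le; last exact: measurable_cst.
  exact: measurable_id.
apply: bounded_mfunB; last exact: bounded_mfun_cst.
apply: bounded_mfunM; first exact: bounded_mfun_cst.
split; last first.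
  exists (expR (`|eta i| * b i)) => r; rewrite ger0_norm ?expR_ge0//.
  by have /andP[] := expR_clip_bounds (eta i) (b_gt0 i) r.
apply: measurableT_comp => //; apply: measurableT_comp => //.
by apply: measurable_funM; [exact: measurable_cst|exact: measurable_clip].
Qed.

Lemma bounded_log_slope i : bounded_mfun (log_slope i).
Proof.
apply: bounded_mfunM; first exact: bounded_clock_slope.
split; last first.
  exists (expR (- (`|eta i| * b i)) / 2)^-1 => r.
  have cg := clock_gt0 i r; have cge := clock_ge i r.
  move: (clock i r) cg cge => c c0 cge; rewrite normfV gtr0_norm//.
  rewrite lef_pV2 // posrE; first by rewrite divr_gt0// expR_gt0.
rewrite (_ : (fun r => _) = fun r => expR (- ln (clock i r))).
  apply: measurableT_comp => //; apply: measurableT_comp => //.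
  by apply: measurableT_comp; [exact: measurable_ln|case: (bounded_clock i)].
by apply/funext => r; rewrite expRN lnK// posrE clock_gt0.
Qed.

Lemma bounded_waiting_weight : exists M : R,
  forall L J, `|waiting_weight (k := k) z L J| <= M.
Proof.
case/andP: z01 => z0 z1; have z0' := ltW z0; exists 1 => L J.
by rewrite ger0_norm /waiting_weight ?exprn_ge0// exprn_ile1.
Qed.

Lemma bounded_test_clock :
  bounded_mfun (test_fun (waiting_weight z) clock : mstate R k -> R).
Proof.
apply: mstate_test_fun; [exact: bounded_waiting_weight|exact: bounded_clock|].
exact: mstate_fun_id.
Qed.

Lemma bounded_active_fun i (h : R -> R) : bounded_mfun h ->
  bounded_mfun (fun x : mstate R k => (active x i)%:R * h (residual x i)).
Proof.
move=> bh; have [_ _ mR] := mstate_fun_id R k.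
apply: bounded_mfunM; last exact: (bounded_mfun_comp (mR i) bh).
apply: bounded_mfun_bool.
exact: (discrete_active i (mstate_fun_id R k) true).
Qed.

Lemma clock_equation :
  \int[P]_w clock ord0 (gtime Q ord0 w) = z^-1 ->
  (forall j, \int[P]_w clock (lift ord0 j) (gtime Q (lift ord0 j) w) = z) ->
  \int[pi]_x (test_fun (waiting_weight z) clock x *
    \sum_i (active x i)%:R * log_slope i (residual x i)) = 0.
Proof.
move=> m0 m1.
pose B := \sum_i (expR (`|eta i| * b i) + `|del i| * b i).
pose ell := \sum_i (expR (`|eta i| * b i) * (`|eta i| * expR (`|eta i| * b i)) + `|del i|).
have le_sum_term (F : 'I_k.+1 -> R) i : (forall j, 0 <= F j) -> F i <= \sum_j F j.
  by move=> F0; rewrite (bigD1 i)//= lerDl sumr_ge0.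
apply: (@stationary_equation _ _ _ P _ Q time_pos pi pi_stat z z01 clock _ _ B ell) => //.
- by move=> i; exact: clock_fun0.
- by move=> i; case: (bounded_clock i).
- move=> i r; apply: (le_trans (clock_fun_le _ _ (b_gt0 i) _)).
  apply: (le_sum_term (fun i => expR (`|eta i| * b i) + `|del i| * b i)) => j.
  by rewrite addr_ge0 ?expR_ge0// mulr_ge0// ltW.
- move=> i r s s0 sr; apply: (le_trans (clock_fun_lip _ _ (b_gt0 i) s0 sr)).
  apply: ler_wpM2r => //.
  apply: (le_sum_term (fun i => expR (`|eta i| * b i) * (`|eta i| * expR (`|eta i| * b i)) + `|del i|)) => j.
  by rewrite addr_ge0// mulr_ge0 ?expR_ge0// mulr_ge0 ?expR_ge0.
- move=> i r r0; rewrite /log_slope mulrCA divff ?mulr1; last by rewrite gt_eqF ?clock_gt0.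
  exact: clock_fun_diff.
- apply: bounded_mfunM; first exact: bounded_test_clock.
  by apply: bounded_mfun_sum => i; exact: (bounded_active_fun i (bounded_log_slope i)).
Qed.

End exponents.

Definition busy_below i (c : R) : R :=
  \int[pi]_x ((active x i)%:R * (residual x i <= c)%R%:R).

Definition clipped_mean i (c : R) : R := \int[P]_w clip c (gtime Q i w).

Lemma bounded_clip (c : R) : 0 < c -> bounded_mfun (clip c).
Proof.
move=> c0; split; first exact: measurable_clip.
by exists c => r; rewrite ger0_norm; [exact: clip_le|exact/clip_ge0/ltW].
Qed.

Lemma bounded_clip_time i c : 0 < c -> bounded_mfun (fun w => clip c (gtime Q i w)).
Proof.
by move=> c0; apply: bounded_mfun_comp (bounded_clip c0); exact: measurable_funP.
Qed.

Lemma clipped_mean_gt0 i c : 0 < c -> 0 < clipped_mean i c.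
Proof.
move=> c0; apply: (mean_gt0 (bounded_clip_time i c0) _ _ (time_pos i)).
- by move=> w; rewrite clip_ge0// ltW.
- by apply: measurable_lt; [exact: measurable_cst|exact: measurable_funP].
- by move=> w /= T0; rewrite /clip lt_min c0 lt_max T0.
Qed.

Lemma measurable_busy_below i c :
  bounded_mfun (fun x : mstate R k =>
    (active x i)%:R * (residual x i <= c)%R%:R : R).
Proof.
apply: (bounded_active_fun i (h := fun r : R => (r <= c)%R%:R)).
apply: bounded_mfun_bool; apply: measurable_le; last exact: measurable_cst.
exact: measurable_id.
Qed.

(* First-order part in [h] of [clock_equation] for [z = 1 - h] and clock
   functions linear below [b i]; the truncation levels are arbitrary. *)
Lemma busy_balance (b : 'I_k.+1 -> R) : (forall i, 0 < b i) ->
  busy_below ord0 (b ord0) / clipped_mean ord0 (b ord0) =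
  \sum_(j < k) busy_below (lift ord0 j) (b (lift ord0 j)) /
     clipped_mean (lift ord0 j) (b (lift ord0 j)).
Proof.
move=> b0; pose M i := clipped_mean i (b i).
have M0 i : 0 < M i by exact: clipped_mean_gt0.
have M0' i : 0 <= M i := ltW (M0 i).
have b0' i : 0 <= b i := ltW (b0 i).
pose S := \sum_i 4 * b i / M i.
have S0 : 0 <= S by apply: sumr_ge0 => i _; rewrite divr_ge0 ?mulr_ge0//.
have Si i : 4 * b i / M i <= S.
  rewrite /S (bigD1 i)//= lerDl sumr_ge0// => j _; rewrite divr_ge0 ?mulr_ge0//.
(* [S] dominates every [4 * b i / M i], hence [h n * (4 * b i / M i) <= 1], from which the condition
   [small] follows; the 2 gives [h n <= 2^-1]. *)
pose h n : R := (2 + S)^-1 / n.+1%:R.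
have h0 n : 0 < h n by rewrite divr_gt0// invr_gt0; lra.
have h0' n : 0 <= h n := ltW (h0 n).
have hS n : h n <= (2 + S)^-1.
  by rewrite /h ler_pdivrMr// ler_peMr ?invr_ge0 ?ler1n//; lra.
have h2 n : h n <= 2^-1.
  by apply: (le_trans (hS n)); rewrite lef_pV2 ?posrE; lra.
have hM n i : h n * (4 * b i / M i) <= 1.
  apply: (@le_trans _ _ ((2 + S)^-1 * (2 + S))); last by rewrite mulVf//; lra.
  by apply: ler_pM => //; [rewrite divr_ge0 ?mulr_ge0//|have := Si i; lra].
have h_cvg : h n @[n --> \oo] --> (0 : R).
  rewrite -(mulr0 (2 + S)^-1); apply: cvgM; first exact: cvg_cst.
  exact: cvg_harmonic.
clearbody h.
pose z n := 1 - h n.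
have z01 n : 0 < z n <= 1 by have := h0 n; have := h2 n; rewrite /z => ? ?; apply/andP; split; lra.
(* These choices solve the mean conditions with zero exponents: the arrival clock has mean
   [1 + h / (1 - h) = z^-1], a service clock has mean [1 - h = z]. *)
pose sgn (i : 'I_k.+1) : R := if i == ord0 then 1 else -1.
pose c n (i : 'I_k.+1) : R := if i == ord0 then (z n)^-1 else 1.
pose del n i := sgn i * (h n * c n i / M i).
have c_bound n i : 0 <= c n i <= 2.
  rewrite /c; case: ifP => _; last by apply/andP; split; lra.
  have /andP[z0 z1] := z01 n; rewrite invr_ge0 ltW//= -[2]invrK lef_pV2 ?posrE ?invr_gt0//.
  by rewrite /z; have := h2 n; lra.
have normdel n i : `|del n i| = h n * c n i / M i.
  have /andP[c0 _] := c_bound n i.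
  rewrite /del normrM (_ : `|sgn i| = 1) ?mul1r; last first.
    by rewrite /sgn; case: ifP => _; rewrite ?normrN normr1.
  by rewrite ger0_norm// divr_ge0// mulr_ge0.
have small n i : `|del n i| * b i * expR (`|(fun=> 0 : R) i| * b i) <= 2^-1.
  rewrite /= normr0 mul0r expR0 mulr1 normdel.
  have /andP[c0 c2] := c_bound n i.
  have -> : h n * c n i / M i * b i = h n * (4 * b i / M i) * c n i / 4.
    by field; rewrite gt_eqF.
  have := hM n i; have : 0 <= h n * (4 * b i / M i).
    by rewrite mulr_ge0 ?divr_ge0 ?mulr_ge0//.
  by move: (h n * _) => q q0 q1; nra.
have bclip i : bounded_mfun (fun w => clip (b i) (gtime Q i w)) by exact: bounded_clip_time.
have meanE n i : \int[P]_w clock (fun=> 0) (del n) b i (gtime Q i w) = 1 + del n i * M i.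
  rewrite /clock /clock_fun.
  transitivity (\int[P]_w (1 + del n i * clip (b i) (gtime Q i w))).
    by apply: eq_Rintegral => w _; rewrite mul0r oppr0 expR0.
  rewrite meanD ?mean_cst ?meanZ//; first exact: bounded_mfun_cst.
  by apply: bounded_mfunM => //; exact: bounded_mfun_cst.
have lift_neq j : (lift ord0 j == ord0 :> 'I_k.+1) = false by rewrite eq_sym eq_liftF.
pose F n (x : mstate R k) := (h n)^-1 * (test_fun (waiting_weight (z n)) (clock (fun=> 0) (del n) b) x *
    \sum_i (active x i)%:R * log_slope (fun=> 0) (del n) b i (residual x i)).
have bF n : bounded_mfun (F n).
  apply: bounded_mfunM; first exact: bounded_mfun_cst.
  apply: bounded_mfunM; first exact: bounded_test_clock.
  by apply: bounded_mfun_sum => i; exact: (bounded_active_fun i (bounded_log_slope b0 (small n) i)).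
have EF n : \int[pi]_x F n x = 0.
  rewrite meanZ; last first.
    apply: bounded_mfunM; first exact: bounded_test_clock.
    by apply: bounded_mfun_sum => i; exact: (bounded_active_fun i (bounded_log_slope b0 (small n) i)).
  rewrite clock_equation ?mulr0//.
  - rewrite meanE /del /sgn /c eqxx mul1r /z divfK ?gt_eqF//; field.
    by have /andP[z0 _] := z01 n; rewrite gt_eqF.
  - by move=> j; rewrite meanE /del /sgn /c lift_neq mulr1 mulNr mul1r mulNr divfK ?gt_eqF.
(* The pointwise limit of [F n]: the test function tends to 1, and each logarithmic slope divided by
   [h n] tends to minus the slope [sgn i / M i] below the cap. *)
pose G (x : mstate R k) := - (\sum_i (active x i)%:R * ((residual x i <= b i)%R%:R * (sgn i / M i))).
have clockE n i r : clock (fun=> 0) (del n) b i r = 1 + del n i * clip (b i) r.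
  by rewrite /clock /clock_fun mul0r oppr0 expR0.
have clock_b n i r : 2^-1 <= clock (fun=> 0) (del n) b i r <= 2.
  have := clock_ge b0 (small n) i r; rewrite normr0 mul0r oppr0 expR0 mul1r => -> /=.
  rewrite clockE; have := small n i; rewrite /= normr0 mul0r expR0 mulr1 => s.
  have cl0 := clip_ge0 r (ltW (b0 i)); have clb := clip_le (b i) r.
  have : del n i * clip (b i) r <= `|del n i| * b i.
    apply: (le_trans (ler_norm _)); rewrite normrM; apply: ler_pM => //.
    by rewrite ger0_norm.
  by lra.
have z_cvg : z n @[n --> \oo] --> (1 : R).
  by rewrite -[X in _ --> X]subr0; apply: cvgB => //; exact: cvg_cst.
have c_cvg i : c n i @[n --> \oo] --> (1 : R).
  rewrite /c; have [_|_] := boolP (i == ord0); last exact: cvg_cst.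
  by rewrite -[X in _ --> X]invr1; apply: cvgV => //; rewrite oner_eq0.
have del_cvg i : del n i @[n --> \oo] --> (0 : R).
  rewrite /del (_ : 0 = sgn i * (0 * 1 * (M i)^-1)); last by rewrite !mul0r mulr0.
  apply: cvgM; first exact: cvg_cst.
  by apply: cvgM; [exact: cvgM|exact: cvg_cst].
have clock_cvg i r : clock (fun=> 0) (del n) b i r @[n --> \oo] --> (1 : R).
  rewrite (_ : (fun n => _) = fun n => 1 + del n i * clip (b i) r); last first.
    by apply/funext => n; rewrite clockE.
  rewrite -[X in _ --> X]addr0 -[X in _ + X](mul0r (clip (b i) r)).
  apply: cvgD; first exact: cvg_cst.
  by apply: cvgM => //; exact: cvg_cst.
have logE n i r : (h n)^-1 * log_slope (fun=> 0) (del n) b i r =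
    - ((r <= b i)%R%:R * (sgn i * (c n i / M i) / clock (fun=> 0) (del n) b i r)).
  rewrite /log_slope /clock_slope mul0r sub0r /del; field.
  have /andP[cl _] := clock_b n i r.
  by rewrite !gt_eqF//; apply: lt_le_trans cl; rewrite invr_gt0.
have FE n x : F n x = test_fun (waiting_weight (z n)) (clock (fun=> 0) (del n) b) x *
   (\sum_i (active x i)%:R * - ((residual x i <= b i)%R%:R *
      (sgn i * (c n i / M i) / clock (fun=> 0) (del n) b i (residual x i)))).
  rewrite /F mulrCA mulr_sumr; congr (_ * _); apply: eq_bigr => i _.
  by rewrite mulrCA logE.
have normsgn i : `|sgn i| = 1 by rewrite /sgn; case: ifP => _; rewrite ?normrN normr1.
have FB n x : `|F n x| <= 2 ^+ k.+1 * \sum_i (4 / M i).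
  rewrite FE normrM; apply: ler_pM => //.
    rewrite /test_fun normrM -[leRHS]mul1r; apply: ler_pM => //.
      have /andP[z0 z1] := z01 n; have z0' := ltW z0.
      by rewrite ger0_norm /waiting_weight ?exprn_ge0// exprn_ile1.
    rewrite normr_prod (_ : 2 ^+ k.+1 = \prod_(i < k.+1) 2); last first.
      by rewrite prodr_const card_ord.
    apply: ler_prod => i _; have /andP[cl cu] := clock_b n i (residual x i).
    by rewrite normr_ge0/= ger0_norm//; apply: le_trans cl; rewrite invr_ge0.
  apply: (le_trans (ler_norm_sum _ _ _)); apply: ler_sum => i _.
  have /andP[cl cu] := clock_b n i (residual x i).
  have /andP[c0 c2] := c_bound n i.
  rewrite normrM normrN -[leRHS]mul1r; apply: ler_pM => //.
    by case: active; rewrite ?normr1 ?normr0.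
  rewrite normrM -[leRHS]mul1r; apply: ler_pM => //.
    by case: (_ <= b i); rewrite ?normr1 ?normr0.
  have cp : 0 < clock (fun=> 0) (del n) b i (residual x i).
    by apply: lt_le_trans cl; rewrite invr_gt0.
  rewrite !normrM normsgn mul1r !normfV (ger0_norm c0) (gtr0_norm (M0 i)) (gtr0_norm cp).
  rewrite mulrAC; apply: ler_wpM2r; first by rewrite invr_ge0 ltW.
  rewrite ler_pdivrMr//; lra.
have FG x : F n x @[n --> \oo] --> G x.
  rewrite (_ : (fun n => _) = fun n => test_fun (waiting_weight (z n)) (clock (fun=> 0) (del n) b) x *
   (\sum_i (active x i)%:R * - ((residual x i <= b i)%R%:R *
      (sgn i * (c n i / M i) / clock (fun=> 0) (del n) b i (residual x i))))); last first.
    by apply/funext => n; rewrite FE.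
  rewrite -[G x]mul1r; apply: cvgM.
    rewrite -[X in _ --> X]mulr1; apply: cvgM.
      rewrite /waiting_weight -[X in _ --> X](expr1n _ (customers x - #|busy x|)).
      exact: (cvg_comp _ _ z_cvg (@exprn_continuous R _ 1)).
    have : \prod_(i < k.+1) clock (fun=> 0) (del n) b i (residual x i) @[n --> \oo] -->
        \prod_(i < k.+1) (1 : R).
      elim: (index_enum _) => [|i s IHs].
        by under eq_cvg do rewrite big_nil; rewrite big_nil; exact: cvg_cst.
      by under eq_cvg do rewrite big_cons; rewrite big_cons; exact: cvgM.
    by rewrite big1.
  rewrite /G -sumrN.
  elim: (index_enum _) => [|i s IHs].
    by under eq_cvg do rewrite big_nil; rewrite big_nil; exact: cvg_cst.
  under eq_cvg do rewrite big_cons; rewrite big_cons; apply: cvgD => //.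
  rewrite -mulrN; apply: cvgM; first exact: cvg_cst.
  apply: cvgN; apply: cvgM; first exact: cvg_cst.
  have cM : c n i / M i @[n --> \oo] --> 1 / M i by apply: cvgM => //; exact: cvg_cst.
  rewrite (_ : sgn i / M i = sgn i * (1 / M i) / 1); last by rewrite divr1 div1r.
  apply: cvgM; first by apply: cvgM => //; exact: cvg_cst.
  by apply: cvgV => //; rewrite oner_eq0.
have [bG] := mean_cvg pi (fun n => (bF n).1) FB FG.
under eq_cvg do rewrite EF.
move=> /(cvg_lim (@Rhausdorff R)); rewrite lim_cst// => /esym EG.
have : \int[pi]_x G x = - \sum_i busy_below i (b i) * (sgn i / M i).
  rewrite /G; under eq_Rintegral do rewrite -mulN1r.
  have bt i : bounded_mfun (fun x : mstate R k => (active x i)%:R * ((residual x i <= b i)%R%:R * (sgn i / M i))).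
    rewrite (_ : (fun x => _) = fun x : mstate R k => (active x i)%:R * (residual x i <= b i)%R%:R * (sgn i / M i)); last by apply/funext => x; rewrite mulrA.
    by apply: bounded_mfunM; [exact: measurable_busy_below|exact: bounded_mfun_cst].
  rewrite meanZ; last exact: bounded_mfun_sum.
  rewrite mulN1r; congr (- _); rewrite mean_sum//; apply: eq_bigr => i _.
  under eq_Rintegral do rewrite mulrA mulrC.
  by rewrite meanZ; [rewrite mulrC|exact: measurable_busy_below].
rewrite EG big_ord_recl => /esym/eqP; rewrite oppr_eq0 addr_eq0 => /eqP.
rewrite /sgn eqxx mul1r => ->; rewrite -sumrN; apply: eq_bigr => j _.
by rewrite lift_neq mulN1r mulrN opprK.
Qed.

End clock_equation.

(** * Busy probabilities *)

Section busy_laws.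
Context d (Om : measurableType d) (R : realType) (P : probability Om R).
Variables (k : nat) (Q : hetero_queue P k).
Hypothesis time_pos : forall i, (0 < P [set w | (0 < gtime Q i w)%R])%E.
Variable pi : probability (mstate R k) R.
Hypothesis pi_stat : stationary_distribution Q pi.

Notation T i := (gtime Q i).
Notation m i := (\int[P]_w T i w).
Notation busy_below := (busy_below pi).
Notation clipped_mean := (clipped_mean Q).

Lemma gtime_ge0 i w : 0 <= T i w.
Proof. exact: time_ge0. Qed.

Lemma integrable_gtime i : P.-integrable setT (EFin \o T i).
Proof.
apply/integrableP; split; first by apply/measurable_EFinP; exact: measurable_funP.
have := time_mean_fin Q i; rewrite unlock => fin.
under eq_integral do rewrite /= ger0_norm ?gtime_ge0//.
by rewrite ltey_eq fin.
Qed.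

Lemma rateE i : rate Q i = (m i)^-1.
Proof. by rewrite /rate unlock. Qed.

Lemma mean_gtime_gt0 i : 0 < m i.
Proof.
have := time_mean_gt0 Q i; have := time_mean_fin Q i; rewrite unlock => fin pos.
by rewrite /Rintegral fine_gt0// pos ltey_eq fin.
Qed.

Lemma rate_gt0 i : 0 < rate Q i.
Proof. by rewrite rateE invr_gt0 mean_gtime_gt0. Qed.

Lemma clipped_mean_cvg i : clipped_mean i n.+1%:R @[n --> \oo] --> m i.
Proof.
have [] := @dominated_convergence _ Om R P setT measurableT
  (fun n w => (clip n.+1%:R (T i w))%:E) (fun w => (T i w)%:E) (fun w => (T i w)%:E).
- by move=> n; apply/measurable_EFinP; case: (@bounded_clip_time _ Om R P k Q i n.+1%:R).
- by apply/measurable_EFinP; exact: measurable_funP.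
- apply: aeW => w _; apply: cvg_near_cst; near=> n; congr (_%:E).
  rewrite clip_id ?gtime_ge0//.
  have : `|T i w| <= n%:R by near: n; exact: nbhs_infty_ger.
  rewrite ger0_norm ?gtime_ge0// => h; apply: (le_trans h).
  by rewrite ler_nat.
- exact: integrable_gtime.
- apply: aeW => w n _; rewrite lee_fin ger0_norm ?clip_ge0//.
  by rewrite clip_le_id// gtime_ge0.
move=> _ _ cE; apply: fine_cvg.
rewrite /Rintegral fineK//.
exact: integrable_fin_num (integrable_gtime i).
Unshelve. all: by end_near.
Qed.

Definition busy_prob i : R := \int[pi]_x (active x i)%:R.

Lemma bounded_active i : bounded_mfun (fun x : mstate R k => (active x i)%:R : R).
Proof.
apply: bounded_mfun_bool; exact: (discrete_active i (mstate_fun_id R k) true).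
Qed.

Lemma busy_prob0 : busy_prob ord0 = 1.
Proof.
rewrite /busy_prob; under eq_Rintegral do rewrite active0.
by rewrite mean_cst.
Qed.

Lemma busy_prob_bounds i : 0 <= busy_prob i <= 1.
Proof.
apply/andP; split; first by apply: Rintegral_ge0 => x _; exact: ler0n.
rewrite -[leRHS](mean_cst pi); apply: le_mean.
- exact: bounded_active.
- exact: bounded_mfun_cst.
- by move=> x; case: active.
Qed.

Lemma busy_below_cvg i : busy_below i n.+1%:R @[n --> \oo] --> busy_prob i.
Proof.
have [] := @mean_cvg _ _ R pi
  (fun n (x : mstate R k) => (active x i)%:R * (residual x i <= n.+1%:R)%R%:R)
  (fun x : mstate R k => (active x i)%:R) 1 => //.
- by move=> n; exact: (measurable_busy_below i (n.+1%:R : R)).1.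
- move=> n x; rewrite normrM -[leRHS]mulr1; apply: ler_pM => //.
    by case: active; rewrite ?normr1 ?normr0.
  by case: (residual x i <= _); rewrite ?normr1 ?normr0.
- move=> x /=; apply: cvg_near_cst; near=> n.
  have -> : residual x i <= n.+1%:R; last by rewrite mulr1.
  have : `|residual x i| <= n%:R by near: n; exact: nbhs_infty_ger.
  move=> h; apply: (le_trans (ler_norm _)); apply: (le_trans h).
  by rewrite ler_nat.
Unshelve. all: by end_near.
Qed.

(* Each ratio is the only term of [busy_balance] depending on its own level. *)
Lemma busy_ratio_const i c c' : 0 < c -> 0 < c' ->
  busy_below i c / clipped_mean i c = busy_below i c' / clipped_mean i c'.
Proof.
move=> c0 c0'.
pose h j a := busy_below j a / clipped_mean j a.
have bal (b : 'I_k.+1 -> R) : (forall j, 0 < b j) ->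
    h ord0 (b ord0) = \sum_(j < k) h (lift ord0 j) (b (lift ord0 j)).
  exact: busy_balance.
have lift_neq j : (lift ord0 j == ord0 :> 'I_k.+1) = false by rewrite eq_sym eq_liftF.
case: (unliftP ord0 i) => [j ->|->]; last first.
  have e0 a : 0 < a -> h ord0 a = \sum_(j < k) h (lift ord0 j) 1.
    move=> a0; have := bal (fun l => if l == ord0 then a else 1).
    rewrite eqxx => ->; first by apply: eq_bigr => j _; rewrite lift_neq.
    by move=> l; case: ifP.
  by rewrite -/(h _ c) -/(h _ c') !e0.
have ej a : 0 < a -> h (lift ord0 j) a =
    h ord0 1 - \sum_(l < k | l != j) h (lift ord0 l) 1.
  move=> a0; have := bal (fun l => if l == lift ord0 j then a else 1).
  rewrite eq_sym lift_neq => ->; last by move=> l; case: ifP.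
  rewrite (bigD1 j)//= eqxx [X in _ = _ + X - _](eq_bigr (fun l => h (lift ord0 l) 1)).
    by rewrite addrK.
  by move=> l lj; rewrite (inj_eq (@lift_inj _ ord0)) (negPf lj).
by rewrite -/(h _ c) -/(h _ c') !ej.
Qed.

(** Letting the level in the constant ratio tend to infinity identifies the constant. This is the
    residual law of renewal theory: given that clock [i] runs, its residual time has density
    [rate * P(T > c)]. *)
Lemma busy_below_rate i c : 0 < c ->
  busy_below i c = busy_prob i * rate Q i * clipped_mean i c.
Proof.
move=> c0; have M0 := clipped_mean_gt0 time_pos i c0.
suff <- : busy_below i c / clipped_mean i c = busy_prob i * rate Q i.
  by rewrite divfK// gt_eqF.
have m0 : m i != 0 by rewrite gt_eqF// mean_gtime_gt0.
have : busy_below i n.+1%:R / clipped_mean i n.+1%:R @[n --> \oo] -->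
    busy_prob i / m i.
  apply: cvgM; first exact: busy_below_cvg.
  by apply: cvgV => //; exact: clipped_mean_cvg.
rewrite (_ : (fun n => _) = fun=> busy_below i c / clipped_mean i c); last first.
  by apply/funext => n; exact: busy_ratio_const.
move=> /(cvg_lim (@Rhausdorff R)); rewrite lim_cst// => ->.
by rewrite rateE.
Qed.

(** Flow in equals flow out: the constants found in [busy_below_rate] are inserted into
    [busy_balance]. *)
Lemma busy_prob_balance :
  \sum_(j < k) rate Q (lift ord0 j) * busy_prob (lift ord0 j) = rate Q ord0.
Proof.
have := busy_balance time_pos pi_stat (b := fun=> 1) (fun=> ltr01).
have rE i : busy_below i 1 / clipped_mean i 1 = rate Q i * busy_prob i.
  rewrite busy_below_rate// mulfK ?gt_eqF ?clipped_mean_gt0// mulrC//.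
rewrite rE busy_prob0 mulr1 => ->; apply: eq_bigr => j _.
by rewrite rE.
Qed.

Definition busy_above i c : R :=
  \int[pi]_x ((active x i)%:R * (c < residual x i)%R%:R).

Lemma bounded_busy_above i (c : R) : bounded_mfun (fun x : mstate R k =>
  (active x i)%:R * (c < residual x i)%R%:R : R).
Proof.
apply: (bounded_active_fun i (h := fun r : R => (c < r)%R%:R)).
apply: bounded_mfun_bool; apply: measurable_lt; first exact: measurable_cst.
exact: measurable_id.
Qed.

(** This is [rate * E (T - c)^+], the mass beyond [c] of the stationary residual law. *)
Definition excess i c : R := 1 - rate Q i * clipped_mean i c.

Lemma excess_ge0 i c : 0 < c -> 0 <= excess i c.
Proof.
move=> c0; rewrite /excess subr_ge0 rateE mulrC ler_pdivrMr ?mean_gtime_gt0// mul1r.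
apply: le_Rintegral => //.
- exact: (bounded_mfun_integrable P (bounded_clip_time Q i c0)).
- exact: integrable_gtime.
- by move=> w _; rewrite clip_le_id// gtime_ge0.
Qed.

Lemma busy_above_le i c : 0 < c -> busy_above i c <= excess i c.
Proof.
move=> c0; have -> : busy_above i c = busy_prob i - busy_below i c.
  rewrite /busy_prob /busy_below -meanB; last 2 first.
  - exact: bounded_active.
  - exact: measurable_busy_below.
  apply: eq_Rintegral => x _; rewrite ltNge; case: (_ <= c); rewrite /= ?mulr1 ?mulr0.
    by rewrite subrr.
  by rewrite subr0.
rewrite busy_below_rate// /excess.
have := excess_ge0 i c0; rewrite /excess.
have /andP[p0 p1] := busy_prob_bounds i.
rewrite -mulrA; move: (rate Q i * clipped_mean i c) => y y1.
by rewrite -[X in X - _]mulr1 -mulrBr ler_piMl.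
Qed.

End busy_laws.

(** * The stationary equation in heavy traffic *)

Section product_near_one.
Variable R : realType.

Lemma norm_prod_sub1_le (I : Type) (s : seq I) (a : I -> R) (B : R) :
  1 <= B -> (forall i, `|a i| <= B) ->
  `|\prod_(i <- s) a i - 1| <= B ^+ size s * \sum_(i <- s) `|a i - 1|.
Proof.
move=> B1 aB; have B0 : 0 <= B by rewrite (le_trans _ B1).
elim: s => [|i s IHs]; first by rewrite !big_nil subrr normr0 mulr0.
rewrite !big_cons (_ : _ - 1 = a i * (\prod_(j <- s) a j - 1) + (a i - 1)); last by ring.
rewrite (le_trans (ler_normD _ _))// normrM /= exprS mulrDr addrC; apply: lerD.
  by rewrite ler_peMl// -exprS exprn_ege1.
by rewrite -mulrA; apply: ler_pM.
Qed.

End product_near_one.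

Section main_estimate.
Variables (R : realType) (k : nat) (K : R).
Hypothesis K1 : 1 <= K.

(** The exponential part of a clock lies between [expR (- K)] and [expR K], and the linear part is
    at most half of the former; hence the factor 2 on both sides of [clock_bounds]. *)
Definition clock_bound : R := 2 * expR K.
Definition test_bound : R := clock_bound ^+ k.+1.
(** Bounds the deviation of a clock from 1 relative to the scaled variable [r * clip r^-1 u], see
    [clock_near1]. *)
Definition oscillation : R := K * expR K + 1.

(** The terms are the coefficients of the lines of [pointwise_error], with [k.+1] for the number of
    clocks in [spread]. *)
Definition estimate_const : R :=
  test_bound * oscillation * k.+1%:R + k%:R
  + K * test_bound * oscillation * k.+1%:R + K * test_bound
  + (1 + K) * test_bound * clock_bound.

Let K0 : 0 <= K. Proof. exact: le_trans K1. Qed.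

Lemma clock_bound_ge1 : 1 <= clock_bound.
Proof.
have : 1 <= expR K by rewrite -expR0 ler_expR.
by rewrite /clock_bound; lra.
Qed.

Lemma test_bound_ge1 : 1 <= test_bound.
Proof. by rewrite exprn_ege1// clock_bound_ge1. Qed.

Lemma oscillation_ge0 : 0 <= oscillation.
Proof. by rewrite addr_ge0// mulr_ge0// expR_ge0. Qed.

Context d (Om : measurableType d) (P : probability Om R).
Variable Q : hetero_queue P k.
Hypothesis time_pos : forall i, (0 < P [set w | (0 < gtime Q i w)%R])%E.
Variable pi : probability (mstate R k) R.
Hypothesis pi_stat : stationary_distribution Q pi.
Variables (r th ep : R) (eta del : 'I_k.+1 -> R).
Hypothesis r01 : 0 < r <= 1.
Hypothesis th_ge0 : 0 <= th.
Hypothesis ep01 : 0 < ep <= 1.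
Hypothesis eta_le : forall i, `|eta i| <= K * r.
Hypothesis del_le : forall i, `|del i| * expR K <= r / 2.

Let z : R := expR (- (th * r)).
Let b : 'I_k.+1 -> R := fun=> r^-1.

Notation clock := (clock eta del b).
Notation f := (test_fun (waiting_weight z) clock).

Let r0 : 0 < r. Proof. by case/andP: r01. Qed.
Let b_gt0 i : 0 < b i. Proof. by rewrite invr_gt0. Qed.

Let z01 : 0 < z <= 1.
Proof.
by rewrite expR_gt0/= -expR0 ler_expR oppr_le0 mulr_ge0// ltW.
Qed.

Let eta_b i : `|eta i| * b i <= K.
Proof. by rewrite ler_pdivrMr. Qed.

Lemma small_del i : `|del i| * b i * expR (`|eta i| * b i) <= 2^-1.
Proof.
rewrite mulrAC /b ler_pdivrMr// mulrC; apply: le_trans (_ : `|del i| * expR K <= _).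
  by rewrite mulrC; apply: ler_wpM2l => //; rewrite ler_expR.
by rewrite (le_trans (del_le i))// mulrC.
Qed.

Lemma clock_bounds i u : clock_bound^-1 <= clock i u <= clock_bound.
Proof.
have eK : expR (`|eta i| * b i) <= expR K by rewrite ler_expR.
apply/andP; split.
  apply: le_trans (clock_ge b_gt0 small_del i u).
  rewrite /clock_bound invfM expRN mulrC; apply: ler_wpM2r; first by rewrite invr_ge0.
  by rewrite lef_pV2 ?posrE ?expR_gt0.
apply: (le_trans (ler_norm _)); apply: (le_trans (clock_fun_le _ _ (b_gt0 i) _)).
have := small_del i; have : 1 <= expR (`|eta i| * b i).
  by rewrite -expR0 ler_expR mulr_ge0// ltW.
have : 1 <= expR K by rewrite -expR0 ler_expR.
have : 0 <= `|del i| * b i by rewrite mulr_ge0// ltW.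
rewrite /clock_bound; move: (`|del i| * b i) (expR (`|eta i| * b i)) eK => y e eK.
move: (expR K) eK => c; nra.
Qed.

Lemma clock_gt0' i u : 0 < clock i u.
Proof. exact: clock_gt0 b_gt0 small_del i u. Qed.

Lemma clock_norm i u : `|clock i u| <= clock_bound.
Proof. by rewrite gtr0_norm ?clock_gt0'//; case/andP: (clock_bounds i u). Qed.

Lemma test_fun_clock_bounds (x : state R k) : 0 <= f x <= test_bound.
Proof.
have /andP[w0 w1] := waiting_weight01 z01 (customers x) (busy x).
have p0 : 0 <= \prod_i clock i (residual x i).
  by apply: prodr_ge0 => i _; exact/ltW/clock_gt0'.
rewrite mulr_ge0//= /test_bound -[leRHS]mul1r; apply: ler_pM => //.
have -> : clock_bound ^+ k.+1 = \prod_(i < k.+1) clock_bound.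
  by rewrite prodr_const card_ord.
apply: ler_prod => i _; have /andP[_ cu] := clock_bounds i (residual x i).
by rewrite cu andbT; exact/ltW/clock_gt0'.
Qed.

Lemma clock_near1 i u : `|clock i u - 1| <= oscillation * (r * clip (b i) u).
Proof.
have c0 := clip_ge0 u (ltW (b_gt0 i)); have cb := clip_le (b i) u.
have e1 : 1 <= expR K by rewrite -expR0 ler_expR.
rewrite /clock /clock_fun addrAC (le_trans (ler_normD _ _))//.
rewrite /oscillation mulrDl mul1r; apply: lerD.
  apply: (le_trans (expR_taylor1 _)); rewrite normrN normrM (ger0_norm c0).
  rewrite -mulrA [expR K * _]mulrC !mulrA; apply: ler_pM; rewrite ?mulr_ge0 ?expR_ge0//.
    by apply: ler_wpM2r.
  rewrite ler_expR; apply: le_trans (eta_b i); exact: ler_wpM2l.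
rewrite normrM (ger0_norm c0); apply: ler_wpM2r => //.
have : `|del i| <= `|del i| * expR K by rewrite ler_peMr.
move=> h; apply: (le_trans h); apply: (le_trans (del_le i)).
by have := r0; lra.
Qed.

(** An upper bound for the sum of the scaled residual times [r * clip r^-1 (residual x i)]: each is
    at most [ep] below the level [ep / r], and at most 1 always. *)
Definition spread (x : state R k) : R :=
  \sum_i (ep + (active x i)%:R * (ep * r^-1 < residual x i)%R%:R).

Lemma spread_ge0 x : 0 <= spread x.
Proof.
apply: sumr_ge0 => i _; case/andP: ep01 => e0 _.
by rewrite addr_ge0 ?mulr_ge0// ltW.
Qed.

Lemma prod_clock_near1 (x : state R k) : state_space x ->
  `|\prod_i clock i (residual x i) - 1| <= test_bound * (oscillation * spread x).
Proof.
move=> [_ rp r0'].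
have := @norm_prod_sub1_le R _ (index_enum 'I_k.+1) (fun i => clock i (residual x i))
  clock_bound clock_bound_ge1 (fun i => clock_norm i _).
rewrite /index_enum/= -enumT size_enum_ord => /le_trans; apply.
apply: ler_wpM2l; first exact: le_trans test_bound_ge1.
rewrite /spread mulr_sumr big_enum/=; apply: ler_sum => i _.
apply: (le_trans (clock_near1 i _)); apply: ler_wpM2l; first exact: oscillation_ge0.
have [ai|/r0' ->] := boolP (active x i); last first.
  case/andP: ep01 => e0 _; rewrite clip0 ?mulr0 ?mul0r ?addr0; first exact: ltW.
  exact/ltW/b_gt0.
have Rp := ltW (rp i ai); rewrite mul1r.
have [Rle|Rgt] := leP (residual x i) (ep * r^-1).
  rewrite addr0 mulrC -ler_pdivlMr//; exact: le_trans (clip_le_id _ Rp) _.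
case/andP: ep01 => e0 _; apply: (@le_trans _ _ 1); last by rewrite lerDr ltW.
by rewrite mulrC -ler_pdivlMr// mul1r clip_le.
Qed.

Lemma test_fun_near (x : state R k) : state_space x ->
  `|f x - waiting_weight z (customers x) (busy x)| <=
  test_bound * (oscillation * spread x).
Proof.
move=> sx; have /andP[w0 w1] := waiting_weight01 z01 (customers x) (busy x).
rewrite /test_fun -[X in _ - X]mulr1 -mulrBr normrM ger0_norm//.
by apply: le_trans (prod_clock_near1 sx); rewrite ler_piMl.
Qed.

(** The two powers differ by the factor [z ^+ #|busy x|], with at most [k] busy servers, and
    [1 - expR (- y) <= y]. *)
Lemma waiting_weight_near (x : state R k) : state_space x ->
  `|waiting_weight z (customers x) (busy x) - z ^+ customers x| <= k%:R * (th * r).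
Proof.
move=> [bE _ _]; have bL : (#|busy x| <= customers x)%N by rewrite bE geq_minl.
have bk : (#|busy x| <= k)%N by rewrite bE geq_minr.
rewrite /waiting_weight -{2}(subnK bL) exprD -[X in X - _]mulr1 -mulrBr normrM.
have /andP[z0 z1] := z01; have z0' := ltW z0.
have h1 : 0 <= z ^+ #|busy x| <= 1 by rewrite exprn_ge0// exprn_ile1.
have h2 : `|z ^+ (customers x - #|busy x|)| <= 1.
  by rewrite ger0_norm ?exprn_ge0// exprn_ile1.
apply: (@le_trans _ _ `|1 - z ^+ #|busy x| |); first by rewrite ler_piMl.
rewrite ger0_norm; last by rewrite subr_ge0; case/andP: h1.
have -> : z ^+ #|busy x| = expR (- (#|busy x|%:R * (th * r))).
  by rewrite -mulrN expRM_natl.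
have := expR_ge1Dx (- (#|busy x|%:R * (th * r))).
have : #|busy x|%:R * (th * r) <= k%:R * (th * r).
  by apply: ler_wpM2r; [rewrite mulr_ge0// ltW|rewrite ler_nat].
by lra.
Qed.

(** Since the exponential is the clock minus [del * clip], the slope is [eta] times the clock up to
    a multiple of [del]. So the logarithmic slope is nearly constant below the cap. *)
Lemma log_slope_split i (u : R) : log_slope eta del b i u =
  (u <= b i)%R%:R * (eta i - del i * (1 + eta i * clip (b i) u) / clock i u).
Proof.
rewrite /log_slope /clock_slope -mulrA; congr (_ * _).
have cg : clock i u != 0 by rewrite gt_eqF// clock_gt0'.
apply: (mulIf cg); rewrite divfK// mulrBl divfK//.
by rewrite /clock /clock_fun; ring.
Qed.

Definition busy_gap (x : state R k) : R := \sum_i (1 - (active x i)%:R).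

Definition overflow c (x : state R k) : R :=
  \sum_i (active x i)%:R * (c < residual x i)%R%:R.

Lemma overflow_ge0 c x : 0 <= overflow c x.
Proof.
by apply: sumr_ge0 => i _; case: active; case: (c < _); rewrite ?mul0r ?mulr0 ?mulr1.
Qed.

Lemma spreadE x : spread x = k.+1%:R * ep + overflow (ep * r^-1) x.
Proof. by rewrite /spread big_split/= sumr_const card_ord mulr_natl. Qed.

(** No server idles while customers wait: with fewer than [k] busy servers, all customers are in
    service. *)
Lemma inactive_no_waiting (x : state R k) i : state_space x -> ~~ active x i ->
  waiting_weight z (customers x) (busy x) = 1.
Proof.
move=> [bE _ _]; case: (unliftP ord0 i) => [j ->|->]; last by rewrite active0.
rewrite active_lift => jb; rewrite /waiting_weight.
have : (#|busy x| < k)%N.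
  rewrite -[X in (_ < X)%N](card_ord k) -cardsT; apply: proper_card.
  by apply/properP; split; [exact: finset.subsetT|exists j; rewrite ?finset.inE].
rewrite {1}bE gtn_min ltnn orbF => Lk; rewrite bE (minn_idPl (ltnW Lk)).
by rewrite subnn expr0.
Qed.

(** In the second line the idle indicators are kept on the [ep] part, where their mean [O(r)] is
    needed to reach order [ep * r ^+ 2]; the overflow has mean [o(r)] by itself. *)
Definition pointwise_error (x : state R k) : R :=
  `|\sum_i eta i| * (test_bound * oscillation * spread x + k%:R * (th * r))
  + K * r * (test_bound * oscillation) *
      (k.+1%:R * ep * busy_gap x + k.+1%:R * overflow (ep * r^-1) x)
  + K * r * test_bound * overflow r^-1 x
  + (1 + K) * test_bound * clock_bound * \sum_i `|del i|.

Lemma pointwise_estimate (x : state R k) : state_space x ->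
  `|(\sum_i eta i) * z ^+ customers x - \sum_i eta i * (1 - (active x i)%:R)
    - f x * \sum_i (active x i)%:R * log_slope eta del b i (residual x i)|
  <= pointwise_error x.
Proof.
move=> sx; have /andP[f0 f1] := test_fun_clock_bounds x.
have tb0 : 0 <= test_bound by apply: le_trans test_bound_ge1.
have os0 := oscillation_ge0.
have [_ rp rz] := sx.
pose A i : R := (active x i)%:R.
pose I1 i : R := (residual x i <= b i)%R%:R.
pose u i := clip (b i) (residual x i).
have I1E i : (b i < residual x i)%R%:R = 1 - I1 i.
  by rewrite /I1 ltNge; case: (_ <= b i); rewrite /= ?subrr ?subr0.
(* Four sources of error: [f] in place of [z ^+ customers x], idle clocks (where nobody waits and
   [f] is close to 1), clocks above the cap, and the linear corrections. *)
have -> : (\sum_i eta i) * z ^+ customers x - \sum_i eta i * (1 - (active x i)%:R)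
    - f x * \sum_i (active x i)%:R * log_slope eta del b i (residual x i) =
  (\sum_i eta i) * (z ^+ customers x - f x)
  + \sum_i eta i * ((1 - A i) * (f x - 1))
  + \sum_i eta i * (A i * (1 - I1 i) * f x)
  + \sum_i del i * ((A i * I1 i) * (1 + eta i * u i) * (f x / clock i (residual x i))).
  rewrite mulrBr !mulr_suml !mulr_sumr -!sumrB -!big_split/=; apply: eq_bigr => i _.
  rewrite log_slope_split -/(A i) -/(I1 i) -/(u i); field.
  by rewrite gt_eqF// clock_gt0'.
have I01 i : 0 <= I1 i <= 1 by rewrite /I1; case: (_ <= b i); rewrite ?lexx ?ler01.
have A01 i : 0 <= A i <= 1 by rewrite /A; case: active; rewrite ?lexx ?ler01.
rewrite /pointwise_error; apply: (le_trans (ler_normD _ _)); apply: lerD; last first.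
  rewrite mulr_sumr; apply: (le_trans (ler_norm_sum _ _ _)); apply: ler_sum => i _.
  rewrite normrM [leRHS]mulrC; apply: ler_wpM2l => //.
  have /andP[i0 i1] := I01 i; have /andP[a0 a1] := A01 i.
  rewrite -mulrA normrM -[leRHS]mul1r; apply: ler_pM => //.
    by rewrite ger0_norm ?mulr_ge0//; apply: mulr_ile1.
  rewrite normrM -mulrA; apply: ler_pM => //.
    apply: (le_trans (ler_normD _ _)); rewrite normr1 lerD2l normrM.
    apply: le_trans (eta_b i); apply: ler_pM => //.
    by rewrite ger0_norm ?clip_le// clip_ge0// ltW.
  have /andP[cl _] := clock_bounds i (residual x i); have cg := clock_gt0' i (residual x i).
  have cb0 : 0 < clock_bound by apply: lt_le_trans clock_bound_ge1.
  rewrite ger0_norm; last by rewrite divr_ge0// ltW.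
  apply: ler_pM => //; first by rewrite invr_ge0 ltW.
  by rewrite -[leRHS]invrK lef_pV2 ?posrE ?invr_gt0.
apply: (le_trans (ler_normD _ _)); apply: lerD; last first.
  rewrite /overflow mulr_sumr; apply: (le_trans (ler_norm_sum _ _ _)); apply: ler_sum => i _.
  rewrite normrM -[K * r * _ * _]mulrA; apply: ler_pM => //.
  have /andP[i0 i1] := I01 i; have /andP[a0 a1] := A01 i.
  have t0 : 0 <= A i * (1 - I1 i) by apply: mulr_ge0 => //; rewrite subr_ge0.
  rewrite I1E -/(A i) ger0_norm; last exact: mulr_ge0.
  by rewrite mulrC; apply: ler_wpM2r.
apply: (le_trans (ler_normD _ _)); apply: lerD.
  rewrite normrM; apply: ler_wpM2l => //; rewrite distrC.
  rewrite (_ : f x - _ = (f x - waiting_weight z (customers x) (busy x)) +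
    (waiting_weight z (customers x) (busy x) - z ^+ customers x)); last by rewrite addrA subrK.
  apply: (le_trans (ler_normD _ _)); apply: lerD; last exact: waiting_weight_near.
  by rewrite -mulrA; exact: test_fun_near.
have ov0 := overflow_ge0 (ep * r^-1) x.
have sp0 := spread_ge0 x.
have -> : k.+1%:R * ep * busy_gap x + k.+1%:R * overflow (ep * r^-1) x =
    \sum_i (k.+1%:R * ep * (1 - (active x i)%:R) + overflow (ep * r^-1) x).
  by rewrite big_split/= -mulr_sumr sumr_const card_ord [X in _ + X = _]mulr_natl.
rewrite mulr_sumr; apply: (le_trans (ler_norm_sum _ _ _)); apply: ler_sum => i _.
rewrite normrM -[K * r * _ * _]mulrA; apply: ler_pM => //.
rewrite /A; have [ai|ai] := boolP (active x i).
  by rewrite subrr mul0r normr0 mulr0 add0r !mulr_ge0.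
rewrite subr0 mul1r mulr1 -spreadE -mulrA.
have := test_fun_near sx; by rewrite (inactive_no_waiting sx ai).
Qed.

Hypothesis mean_clock0 : \int[P]_w clock ord0 (gtime Q ord0 w) = z^-1.
Hypothesis mean_clock : forall j,
  \int[P]_w clock (lift ord0 j) (gtime Q (lift ord0 j) w) = z.

Lemma bounded_power_customers :
  bounded_mfun (fun x : mstate R k => z ^+ customers x).
Proof.
have /andP[z0 z1] := z01; have z0' := ltW z0.
split; last by exists 1 => x; rewrite ger0_norm ?exprn_ge0// exprn_ile1.
have [mL _ _] := mstate_fun_id R k.
exact: (discrete_fun_mfun (fun n => z ^+ n) mL).
Qed.

(** The mean of [pointwise_estimate] under [pi]: [clock_equation] annihilates the drift, and
    [busy_above_le] bounds the overflows by the excesses. *)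
Lemma main_estimate :
  `|(\sum_i eta i) * \int[pi]_x z ^+ customers x
    - \sum_i eta i * (1 - busy_prob pi i)| <=
  estimate_const *
   (`|\sum_i eta i| * (ep + \sum_i excess Q i (ep * r^-1) + th * r)
    + r * (ep * \sum_i (1 - busy_prob pi i) + \sum_i excess Q i (ep * r^-1)
           + \sum_i excess Q i r^-1)
    + \sum_i `|del i|).
Proof.
have bE : bounded_mfun (fun x : mstate R k => (\sum_i eta i) * z ^+ customers x).
  by apply: bounded_mfunM; [exact: bounded_mfun_cst|exact: bounded_power_customers].
have b1a i : bounded_mfun (fun x : mstate R k => 1 - (active x i)%:R : R).
  by apply: bounded_mfunB; [exact: bounded_mfun_cst|exact: bounded_active].
have bga i : bounded_mfun (fun x : mstate R k => eta i * (1 - (active x i)%:R)).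
  by apply: bounded_mfunM => //; exact: bounded_mfun_cst.
have bgap : bounded_mfun (fun x : mstate R k => \sum_i eta i * (1 - (active x i)%:R)).
  exact: bounded_mfun_sum.
have bf : bounded_mfun (fun x : mstate R k => f x *
    \sum_i (active x i)%:R * log_slope eta del b i (residual x i)).
  apply: bounded_mfunM; first exact: bounded_test_clock.
  apply: bounded_mfun_sum => i.
  exact: (bounded_active_fun i (bounded_log_slope b_gt0 small_del i)).
have bX : bounded_mfun (fun x : mstate R k => (\sum_i eta i) * z ^+ customers x
    - \sum_i eta i * (1 - (active x i)%:R) - f x *
    \sum_i (active x i)%:R * log_slope eta del b i (residual x i)).
  by apply: bounded_mfunB => //; exact: bounded_mfunB.
have -> : (\sum_i eta i) * \int[pi]_x z ^+ customers x
    - \sum_i eta i * (1 - busy_prob pi i) =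
  \int[pi]_x ((\sum_i eta i) * z ^+ customers x
    - \sum_i eta i * (1 - (active x i)%:R) - f x *
    \sum_i (active x i)%:R * log_slope eta del b i (residual x i)).
  rewrite meanB//; last exact: bounded_mfunB.
  rewrite (clock_equation time_pos pi_stat z01 b_gt0 small_del mean_clock0 mean_clock) subr0.
  rewrite meanB// meanZ; last exact: bounded_power_customers.
  congr (_ - _); rewrite mean_sum//; apply: eq_bigr => i _; rewrite meanZ//.
  by rewrite meanB ?mean_cst//; [exact: bounded_mfun_cst|exact: bounded_active].
have bov c : bounded_mfun (overflow c : mstate R k -> R).
  by apply: bounded_mfun_sum => i; exact: bounded_busy_above.
have bbg : bounded_mfun (busy_gap : mstate R k -> R) by exact: bounded_mfun_sum.
have bsp : bounded_mfun (spread : mstate R k -> R).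
  rewrite (_ : spread = fun x => k.+1%:R * ep + overflow (ep * r^-1) x).
    by apply: bounded_mfunD => //; exact: bounded_mfun_cst.
  by apply/funext => x; exact: spreadE.
have bc c (h : mstate R k -> R) : bounded_mfun h -> bounded_mfun (fun x => c * h x).
  by move=> bh; apply: bounded_mfunM => //; exact: bounded_mfun_cst.
have b1 : bounded_mfun (fun x : mstate R k =>
    test_bound * oscillation * spread x + k%:R * (th * r)).
  by apply: bounded_mfunD; [exact: bc|exact: bounded_mfun_cst].
have b2 : bounded_mfun (fun x : mstate R k =>
    k.+1%:R * ep * busy_gap x + k.+1%:R * overflow (ep * r^-1) x).
  by apply: bounded_mfunD; exact: bc.
have b12 : bounded_mfun (fun x : mstate R k => `|\sum_i eta i| *
    (test_bound * oscillation * spread x + k%:R * (th * r))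
  + K * r * (test_bound * oscillation) *
    (k.+1%:R * ep * busy_gap x + k.+1%:R * overflow (ep * r^-1) x)).
  by apply: bounded_mfunD; exact: bc.
have b3 : bounded_mfun (fun x : mstate R k => `|\sum_i eta i| *
    (test_bound * oscillation * spread x + k%:R * (th * r))
  + K * r * (test_bound * oscillation) *
    (k.+1%:R * ep * busy_gap x + k.+1%:R * overflow (ep * r^-1) x)
  + K * r * test_bound * overflow r^-1 x).
  by apply: bounded_mfunD => //; exact: bc.
have bpe : bounded_mfun (pointwise_error : mstate R k -> R).
  by apply: bounded_mfunD => //; exact: bounded_mfun_cst.
have [bXr <-] := pi_state_space_ae pi_stat bX.
have [bper Epe] := pi_state_space_ae pi_stat bpe.
apply: (le_trans (norm_mean_le pi bXr bper
  (fun x => pointwise_estimate (regular_space x)))).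
rewrite Epe.
pose O1 := \int[pi]_x overflow (ep * r^-1) x.
pose O2 := \int[pi]_x overflow r^-1 x.
pose Gp := \sum_i (1 - busy_prob pi i).
have EO c : \int[pi]_x overflow c x = \sum_i busy_above pi i c.
  by rewrite mean_sum// => i; exact: bounded_busy_above.
have Ebg : \int[pi]_x busy_gap x = Gp.
  rewrite mean_sum//; apply: eq_bigr => i _.
  by rewrite meanB ?mean_cst//; [exact: bounded_mfun_cst|exact: bounded_active].
have Esp : \int[pi]_x spread x = k.+1%:R * ep + O1.
  rewrite -[X in _ = X + _](mean_cst pi) -meanD//; last exact: bounded_mfun_cst.
  by apply: eq_Rintegral => x _; rewrite spreadE.
have -> : \int[pi]_x pointwise_error x =
  `|\sum_i eta i| * (test_bound * oscillation * (k.+1%:R * ep + O1) + k%:R * (th * r))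
  + K * r * (test_bound * oscillation) * (k.+1%:R * ep * Gp + k.+1%:R * O1)
  + K * r * test_bound * O2
  + (1 + K) * test_bound * clock_bound * \sum_i `|del i|.
  have bcst (c : R) : bounded_mfun (fun _ : mstate R k => c) := bounded_mfun_cst _ c.
  rewrite (meanD pi b3 (bcst _)) mean_cst (meanD pi b12 (bc _ _ (bov _))).
  rewrite (meanD pi (bc _ _ b1) (bc _ _ b2)) (meanZ pi _ b1) (meanZ pi _ b2).
  rewrite (meanD pi (bc _ _ bsp) (bcst _)) (meanD pi (bc _ _ bbg) (bc _ _ (bov _))).
  by rewrite mean_cst !meanZ// Esp Ebg.
have /andP[e0 e1] := ep01.
have le_exc c : 0 < c -> \sum_i busy_above pi i c <= \sum_i excess Q i c.
  by move=> c0; apply: ler_sum => i _; exact: busy_above_le.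
have rV0 : 0 < r^-1 by rewrite invr_gt0.
have X1 : O1 <= \sum_i excess Q i (ep * r^-1) by rewrite /O1 EO le_exc// mulr_gt0.
have X2 : O2 <= \sum_i excess Q i r^-1 by rewrite /O2 EO le_exc.
have O10 : 0 <= O1 by apply: Rintegral_ge0 => x _; exact: overflow_ge0.
have O20 : 0 <= O2 by apply: Rintegral_ge0 => x _; exact: overflow_ge0.
have Gp0 : 0 <= Gp.
  apply: sumr_ge0 => i _; rewrite subr_ge0.
  by have /andP[] := busy_prob_bounds pi i.
move: (\sum_i excess Q i (ep * r^-1)) (\sum_i excess Q i r^-1) X1 X2 => Y1 Y2 X1 X2.
have D0 : 0 <= \sum_i `|del i| by exact: sumr_ge0.
move: (\sum_i `|del i|) D0 => D D0; rewrite -/Gp.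
move: O1 O2 Gp O10 O20 Gp0 X1 X2 {EO Ebg Esp} => O1 O2 Gp O10 O20 Gp0 X1 X2.
have Y10 := le_trans O10 X1; have e0' := ltW e0.
have S0 := normr_ge0 (\sum_i eta i); move: (`|_|) S0 => S S0.
have tr0 : 0 <= th * r by rewrite mulr_ge0// ltW.
have tb0 : 0 <= test_bound by apply: le_trans test_bound_ge1.
have cb0 : 0 <= clock_bound by apply: le_trans clock_bound_ge1.
have os0 := oscillation_ge0; have r0' := ltW r0.
have a0 : 0 <= test_bound * oscillation by exact: mulr_ge0.
rewrite /estimate_const.
have c5 : 0 <= (1 + K) * test_bound * clock_bound.
  by rewrite mulr_ge0// mulr_ge0// addr_ge0.
have c4 : 0 <= K * test_bound by exact: mulr_ge0.
have -> : K * test_bound * oscillation * k.+1%:R =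
  K * (test_bound * oscillation) * k.+1%:R by rewrite !mulrA.
have -> : K * r * (test_bound * oscillation) * (k.+1%:R * ep * Gp + k.+1%:R * O1) =
  (K * (test_bound * oscillation) * k.+1%:R) * (r * (ep * Gp + O1)) by ring.
have -> : K * r * test_bound * O2 = K * test_bound * (r * O2) by ring.
have k1 : 1 <= k.+1%:R :> R by rewrite ler1n.
have c3 : 0 <= K * (test_bound * oscillation) * k.+1%:R.
  by rewrite mulr_ge0// mulr_ge0.
have c1 : 0 <= test_bound * oscillation * k.+1%:R by rewrite mulr_ge0.
have c2 : 0 <= k%:R :> R by rewrite ler0n.
have p1 : S * (test_bound * oscillation * (k.+1%:R * ep + O1) + k%:R * (th * r)) <=
   (test_bound * oscillation * k.+1%:R + k%:R) * (S * (ep + Y1 + th * r)).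
  rewrite [leRHS]mulrCA; apply: ler_wpM2l => //.
  have h1 : test_bound * oscillation * O1 <= test_bound * oscillation * k.+1%:R * Y1.
    rewrite -[leRHS]mulrA; apply: (ler_wpM2l a0); apply: (le_trans X1).
    by rewrite ler_peMl// (le_trans O10).
  have h2 : 0 <= test_bound * oscillation * k.+1%:R * (th * r) by exact: mulr_ge0.
  have h3 : 0 <= k%:R * (ep + Y1).
    by rewrite mulr_ge0// addr_ge0.
  lra.
have q1 : 0 <= S * (ep + Y1 + th * r).
  by rewrite mulr_ge0// addr_ge0// addr_ge0.
have p2 : r * (ep * Gp + O1) <= r * (ep * Gp + Y1 + Y2).
  by apply: ler_wpM2l => //; have := le_trans O20 X2; lra.
have p3 : r * O2 <= r * (ep * Gp + Y1 + Y2).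
  apply: ler_wpM2l => //; have eG : 0 <= ep * Gp by exact: mulr_ge0.
  lra.
have q2 : 0 <= r * (ep * Gp + Y1 + Y2) by apply: le_trans p3; exact: mulr_ge0.
move: (S * (ep + Y1 + th * r)) q1 p1 => s1 q1 p1.
move: (r * (ep * Gp + Y1 + Y2)) q2 p2 p3 => s2 q2 p2 p3.
have p2' := ler_wpM2l c3 p2; have p3' := ler_wpM2l c4 p3.
move: (test_bound * oscillation * k.+1%:R) (K * (test_bound * oscillation) * k.+1%:R)
  (K * test_bound) ((1 + K) * test_bound * clock_bound) c1 c3 c4 c5 p1 p2' p3'.
move=> C1 C3 C4 C5 c1 c3 c4 c5 p1 p2' p3'.
have := mulr_ge0 c1 q2; have := mulr_ge0 c1 D0; have := mulr_ge0 c2 q2.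
have := mulr_ge0 c2 D0; have := mulr_ge0 c3 q1; have := mulr_ge0 c3 D0.
have := mulr_ge0 c4 q1; have := mulr_ge0 c4 D0; have := mulr_ge0 c5 q1.
have := mulr_ge0 c5 q2.
lra.
Qed.

End main_estimate.

(** * Second-order expansions *)

Section laplace_error.
Context d (Om : measurableType d) (R : realType) (P : probability Om R).
Variable T : Om -> R.
Hypothesis mT : measurable_fun setT T.
Hypothesis T_ge0 : forall w, 0 <= T w.
Hypothesis T2_int : P.-integrable setT (EFin \o (fun w => T w ^+ 2)).

Definition tail_moment (a : R) : R := \int[P]_w (T w ^+ 2 * (a < T w)%R%:R).

Lemma integrable_tail a :
  P.-integrable setT (EFin \o (fun w => T w ^+ 2 * (a < T w)%R%:R)).
Proof.
apply: le_integrable T2_int => //.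
  apply/measurable_EFinP; apply: measurable_funM; first exact: measurable_funX.
  suff : bounded_mfun (fun w => (a < T w)%R%:R : R) by case.
  by apply: bounded_mfun_bool; apply: measurable_lt => //; exact: measurable_cst.
move=> w _; rewrite lee_fin normrM ler_piMr//.
by case: (a < _); rewrite ?normr1 ?normr0.
Qed.

Lemma tail_moment_ge0 a : 0 <= tail_moment a.
Proof.
apply: Rintegral_ge0 => w _; rewrite mulr_ge0 ?exprn_ge0//.
Qed.

Lemma tail_moment_le a c : a <= c -> tail_moment c <= tail_moment a.
Proof.
move=> ac; apply: le_Rintegral => //; try exact: integrable_tail.
move=> w _; apply: ler_wpM2l; first exact: exprn_ge0.
have [cT|_] := ltP c (T w); last exact: ler0n.
by rewrite (le_lt_trans ac cT).
Qed.

Lemma integrable_first : P.-integrable setT (EFin \o T).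
Proof.
have i1 : P.-integrable setT (EFin \o (fun w => 1 + T w ^+ 2)).
  rewrite (_ : _ \o _ = ((EFin \o (fun=> 1%R)) \+ (EFin \o (fun w => T w ^+ 2)%R))%E).
    apply: integrableD => //.
    exact: (bounded_mfun_integrable P (bounded_mfun_cst Om 1)).
  by apply/funext.
apply: le_integrable i1 => //; first exact/measurable_EFinP.
move=> w _; rewrite lee_fin ger0_norm// ger0_norm ?addr_ge0 ?exprn_ge0//.
have := sqr_ge0 (T w - 1); have := T_ge0 w; rewrite sqrrB; lra.
Qed.

Lemma clip_gap r w : 0 < r ->
  0 <= T w - clip r^-1 (T w) <= r * (T w ^+ 2 * (r^-1 < T w)%R%:R).
Proof.
move=> r0; have T0 := T_ge0 w.
have [Tb|bT] := leP (T w) r^-1.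
  by rewrite clip_id// subrr !mulr0 lexx.
have b0 : 0 < r^-1 by rewrite invr_gt0.
rewrite clip_gt ?mulr1//; last exact: ltW.
have rT : 1 <= r * T w by rewrite mulrC -ler_pdivrMr// div1r ltW.
rewrite subr_ge0 ltW//=; apply: (@le_trans _ _ (T w)); first by rewrite gerBl ltW.
by rewrite expr2 mulrA ler_peMl.
Qed.

Lemma clip_gap_mean r : 0 < r ->
  \int[P]_w T w - \int[P]_w clip r^-1 (T w) <= r * tail_moment r^-1.
Proof.
move=> r0; have b0 : 0 < r^-1 by rewrite invr_gt0.
have bc : bounded_mfun (fun w => clip r^-1 (T w)).
  by apply: (bounded_mfun_comp mT); exact: bounded_clip.
rewrite -RintegralB//; [|exact: integrable_first|exact: bounded_mfun_integrable].
rewrite -RintegralZl//; last exact: integrable_tail.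
apply: le_Rintegral => //.
- rewrite (_ : _ \o _ = ((EFin \o T) \- (EFin \o (fun w => clip r^-1 (T w))))%E).
    by apply: integrableB => //; [exact: integrable_first|exact: bounded_mfun_integrable].
  by apply/funext.
- exact: (integrableZl measurableT r (integrable_tail r^-1)).
- by move=> w _; have /andP[] := clip_gap w r0.
Qed.

(** Taylor expansion at the clipped time. The tail at [1 / r] pays for returning to the moments of
    [T]; the cubic remainder, with no third moment at hand, is split at a free level [a]. *)
Lemma laplace_error (r eta K a : R) : 0 < r -> 0 <= K -> `|eta| <= K * r -> 0 < a ->
  `|\int[P]_w expR (- (eta * clip r^-1 (T w))) -
    (1 - eta * \int[P]_w T w + eta ^+ 2 * \int[P]_w (T w ^+ 2) / 2)|
  <= r ^+ 2 * ((K + K ^+ 2) * tail_moment r^-1 +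
       K ^+ 3 * expR K * (a * \int[P]_w (T w ^+ 2) * r + tail_moment a)).
Proof.
move=> r0 K0 eK a0; have b0 : 0 < r^-1 by rewrite invr_gt0.
have r0' := ltW r0; have b0' := ltW b0.
have bE : bounded_mfun (fun w => expR (- (eta * clip r^-1 (T w)))).
  split; last first.
    exists (expR (`|eta| * r^-1)) => w; rewrite ger0_norm ?expR_ge0//.
    by have /andP[] := expR_clip_bounds eta b0 (T w).
  apply: measurableT_comp => //; apply: measurableT_comp => //.
  apply: measurable_funM; first exact: measurable_cst.
  by apply: measurableT_comp => //; exact: measurable_clip.
have i1 := integrable_first.
have iE := bounded_mfun_integrable P bE.
have ic := bounded_mfun_integrable P (bounded_mfun_cst Om (1 : R)).
have iZ (h : Om -> R) (c : R) : P.-integrable setT (EFin \o h) ->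
    P.-integrable setT (EFin \o (fun w => c * h w)).
  by move=> ih; exact: (integrableZl measurableT c ih).
have iD (h h' : Om -> R) : P.-integrable setT (EFin \o h) ->
    P.-integrable setT (EFin \o h') ->
    P.-integrable setT (EFin \o (fun w => h w + h' w)).
  move=> ih ih'; rewrite (_ : _ \o _ = ((EFin \o h) \+ (EFin \o h'))%E).
    exact: integrableD.
  by apply/funext.
have iB (h h' : Om -> R) : P.-integrable setT (EFin \o h) ->
    P.-integrable setT (EFin \o h') ->
    P.-integrable setT (EFin \o (fun w => h w - h' w)).
  move=> ih ih'; rewrite (_ : _ \o _ = ((EFin \o h) \- (EFin \o h'))%E).
    exact: integrableB.
  by apply/funext.
have ip : P.-integrable setT (EFin \o
    (fun w => 1 - eta * T w + eta ^+ 2 / 2 * T w ^+ 2)).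
  by apply: (iD); [apply: (iB) => //; exact: iZ|exact: iZ].
have -> : \int[P]_w expR (- (eta * clip r^-1 (T w))) -
    (1 - eta * \int[P]_w T w + eta ^+ 2 * \int[P]_w (T w ^+ 2) / 2) =
  \int[P]_w (expR (- (eta * clip r^-1 (T w))) -
    (1 - eta * T w + eta ^+ 2 / 2 * T w ^+ 2)).
  rewrite RintegralB//; congr (_ - _).
  rewrite RintegralD//; [|by apply: (iB) => //; exact: iZ|exact: iZ].
  rewrite RintegralB//; last exact: iZ.
  by rewrite mean_cst !RintegralZl// mulrAC.
apply: (le_trans (le_normr_Rintegral _ (iB _ _ iE ip))) => //.
have -> : r ^+ 2 * ((K + K ^+ 2) * tail_moment r^-1 +
       K ^+ 3 * expR K * (a * \int[P]_w (T w ^+ 2) * r + tail_moment a)) =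
  \int[P]_w (r ^+ 2 * (K + K ^+ 2) * (T w ^+ 2 * (r^-1 < T w)%R%:R) +
     r ^+ 2 * (K ^+ 3 * expR K) * (a * r * T w ^+ 2 + T w ^+ 2 * (a < T w)%R%:R)).
  have it := integrable_tail.
  rewrite RintegralD//; [|exact: iZ|by apply: (iZ); apply: (iD) => //; exact: iZ].
  rewrite RintegralZl// RintegralZl//; last by apply: (iD) => //; exact: iZ.
  rewrite RintegralD//; last exact: iZ.
  by rewrite RintegralZl// /tail_moment; ring.
have it := integrable_tail.
apply: le_Rintegral => //.
- exact: (integrable_norm (iB _ _ iE ip)).
- apply: (iD); first exact: iZ.
  by apply: (iZ); apply: (iD) => //; exact: iZ.
move=> w _ /=; have T0 := T_ge0 w.
have /andP[g0 g1] := clip_gap w r0.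
have u0 := clip_ge0 (T w) b0'; have ub := clip_le r^-1 (T w).
have uT : clip r^-1 (T w) <= T w by exact: clip_le_id.
set u := clip r^-1 (T w) in g0 g1 u0 ub uT *.
set I1 := (r^-1 < T w)%R%:R in g1 *.
have sqgap : `|T w ^+ 2 - u ^+ 2| <= 2 * (T w ^+ 2 * I1).
  have TT : T w ^+ 2 - u ^+ 2 = (T w - u) * (T w + u) by ring.
  rewrite TT ger0_norm; last by apply: mulr_ge0 => //; exact: addr_ge0.
  rewrite /I1; have [Tb|bT] := leP (T w) r^-1.
    by rewrite /u clip_id// subrr mul0r !mulr0.
  rewrite mulr1; have : (T w - u) * (T w + u) <= T w * (T w + T w).
    apply: ler_pM => //; [exact: addr_ge0|by rewrite gerBl|by rewrite lerD2l].
  by rewrite expr2; lra.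
have t3 : `|expR (- (eta * u)) - (1 + - (eta * u) + (- (eta * u)) ^+ 2 / 2)| <=
    r ^+ 2 * (K ^+ 3 * expR K) * (a * r * T w ^+ 2 + T w ^+ 2 * (a < T w)%R%:R).
  apply: (le_trans (expR_taylor3 _)); rewrite normrN normrM (ger0_norm u0).
  have eu : `|eta| * u <= K.
    apply: (@le_trans _ _ (K * r * r^-1)); first exact: ler_pM.
    by rewrite mulfK// gt_eqF.
  have e1 : expR (`|eta| * u) <= expR K by rewrite ler_expR.
  have p3 : (`|eta| * u) ^+ 3 <= (K * r) ^+ 3 * u ^+ 3.
    rewrite exprMn; apply: ler_wpM2r; first exact: exprn_ge0.
    by apply: lerXn2r => //; rewrite nnegrE// mulr_ge0.
  (* Below the level one factor [u] is at most [a]; above it one uses [r * u <= 1], the effect of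
     the cap. *)
  have u3 : r * u ^+ 3 <= a * r * T w ^+ 2 + T w ^+ 2 * (a < T w)%R%:R.
    have T2 : 0 <= T w ^+ 2 by exact: exprn_ge0.
    have u2 : u ^+ 2 <= T w ^+ 2 by rewrite lerXn2r ?nnegrE.
    have ru : r * u <= 1 by rewrite mulrC -ler_pdivlMr// div1r.
    have [Ta|aT] := leP (T w) a.
      rewrite mulr0 addr0 (_ : a * r * T w ^+ 2 = r * (a * T w ^+ 2)); last by ring.
      apply: ler_wpM2l => //; rewrite exprS; apply: ler_pM => //; first exact: exprn_ge0.
      exact: le_trans Ta.
    rewrite mulr1; apply: (@le_trans _ _ (T w ^+ 2)).
      rewrite exprS mulrA -[leRHS]mul1r; apply: ler_pM => //; first exact: mulr_ge0.
      exact: exprn_ge0.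
    by rewrite lerDr !mulr_ge0// ltW.
  have : (`|eta| * u) ^+ 3 * expR (`|eta| * u) <= (K * r) ^+ 3 * u ^+ 3 * expR K.
    by apply: ler_pM; rewrite ?expR_ge0// exprn_ge0// mulr_ge0.
  move=> h; apply: (le_trans h).
  have -> : (K * r) ^+ 3 * u ^+ 3 * expR K = r ^+ 2 * (K ^+ 3 * expR K) * (r * u ^+ 3) by ring.
  by apply: ler_wpM2l => //; rewrite !mulr_ge0 ?exprn_ge0 ?expR_ge0.
have -> : expR (- (eta * u)) - (1 - eta * T w + eta ^+ 2 / 2 * T w ^+ 2) =
  (expR (- (eta * u)) - (1 + - (eta * u) + (- (eta * u)) ^+ 2 / 2)) +
  (eta * (u - T w) * (-1) - eta ^+ 2 / 2 * (T w ^+ 2 - u ^+ 2)) by ring.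
rewrite [leRHS]addrC; apply: (le_trans (ler_normD _ _)); apply: lerD => //.
rewrite (_ : eta * (u - T w) * -1 = eta * (T w - u)); last by ring.
apply: (le_trans (ler_normB _ _)).
have s1 : `|eta * (T w - u)| <= K * r * (r * (T w ^+ 2 * I1)).
  by rewrite normrM; apply: ler_pM => //; rewrite ger0_norm.
have s2 : `|eta ^+ 2 / 2 * (T w ^+ 2 - u ^+ 2)| <= (K * r) ^+ 2 / 2 * (2 * (T w ^+ 2 * I1)).
  rewrite normrM; apply: ler_pM => //.
  rewrite normrM normfV [`|2|]ger0_norm//; apply: ler_wpM2r; first by rewrite invr_ge0.
  by rewrite normrX; apply: lerXn2r => //; rewrite nnegrE// mulr_ge0.
apply: (le_trans (lerD s1 s2)); rewrite le_eqVlt; apply/orP; left; apply/eqP.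
by field.
Qed.

End laplace_error.

Section asymptotics.
Variable R : realType.

Lemma near_le_of_cvg0 (w : nat -> R) (e : R) : w n @[n --> \oo] --> (0 : R) ->
  0 < e -> \forall n \near \oo, w n <= e.
Proof.
move=> w0 e0; move/cvgrPdist_le : w0 => /(_ e e0); apply: filterS => n.
by rewrite sub0r normrN; apply: le_trans; exact: ler_norm.
Qed.

Lemma cvg0_near_le (x : nat -> R) : (forall e : R, 0 < e ->
  \forall n \near \oo, `|x n| <= e) -> x n @[n --> \oo] --> (0 : R).
Proof.
move=> h; apply/cvgrPdist_le => e e0; have := h e e0; apply: filterS => n.
by rewrite sub0r normrN.
Qed.

(** For each [e] the limit superior of the absolute values is at most [C * e], with [C] independent
    of [e]. *)
Lemma squeeze_cvg0 (x : nat -> R) (C : R) : 0 <= C ->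
  (forall e : R, 0 < e <= 1 -> exists2 w : nat -> R,
     w n @[n --> \oo] --> (0 : R) &
     \forall n \near \oo, `|x n| <= C * e + w n) ->
  x n @[n --> \oo] --> (0 : R).
Proof.
move=> C0 h; apply: cvg0_near_le => e e0.
pose e' := Num.min 1 (e / 2 / (C + 1)).
have C1 : 0 < C + 1 by lra.
have e'0 : 0 < e' by rewrite /e' lt_min ltr01/= divr_gt0// divr_gt0.
have e'1 : e' <= 1 by rewrite /e' ge_min lexx.
have e'2 : C * e' <= e / 2.
  apply: (@le_trans _ _ ((C + 1) * e')); first by apply: ler_wpM2r; [exact: ltW|lra].
  by rewrite mulrC -ler_pdivlMr// /e' ge_min lexx orbT.
have [|w w0 xw] := h e'; first by rewrite e'0 e'1.
have e20 : 0 < e / 2 by rewrite divr_gt0.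
have := near_le_of_cvg0 w0 e20.
move: xw; apply: filterS2 => n xw we.
by apply: (le_trans xw); lra.
Qed.

Variables (r : nat -> R) (U : nat -> R -> R).
Hypothesis r_gt0 : forall n, 0 < r n.
Hypothesis r_cvg : r n @[n --> \oo] --> (0 : R).
Hypothesis U_ge0 : forall n a, 0 <= U n a.
Hypothesis U_le : forall n a c, a <= c -> U n c <= U n a.
Hypothesis U_tight : forall e : R, 0 < e -> exists2 a, 0 < a & forall n, U n a <= e.

Lemma near_le_ratio (c a : R) : 0 < c -> \forall n \near \oo, a <= c / r n.
Proof.
move=> c0; have a1 : 0 < `|a| + 1 by rewrite ltr_wpDl.
have := near_le_of_cvg0 r_cvg (divr_gt0 c0 a1).
apply: filterS => n; rewrite ler_pdivlMr// => h.
have ra := ler_norm a; have := r_gt0 n => r0.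
by rewrite ler_pdivlMr// mulrC; nra.
Qed.

Lemma tail_cvg0 (c : R) : 0 < c -> U n (c / r n) @[n --> \oo] --> (0 : R).
Proof.
move=> c0; apply: cvg0_near_le => e e0; have [a a0 Ua] := U_tight e0.
have := near_le_ratio a c0; apply: filterS => n ac.
by rewrite ger0_norm//; apply: le_trans (U_le n ac) (Ua n).
Qed.

Variables (s th : R) (lam v : nat -> R) (lam0 v0 : R).
Hypothesis s_sign : s = 1 \/ s = -1.
Hypothesis lam_gt0 : forall n, 0 < lam n.
Hypothesis lam0_gt0 : 0 < lam0.
Hypothesis lam_cvg : lam n @[n --> \oo] --> lam0.
Hypothesis v_cvg : v n @[n --> \oo] --> v0.

(* Makes [1 - exponent * m + exponent ^ 2 * E[T ^ 2] / 2] equal to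
   [expR (- (s * th * r))] up to [o(r ^ 2)], where [m = lam^-1]. *)
Definition exponent n : R :=
  s * lam n * th * r n + lam n ^+ 3 * v n * th ^+ 2 * r n ^+ 2 / 2.

Let q n : R := v n + (lam n)^-1 ^+ 2.

Lemma cvg_pow (u : nat -> R) (l : R) p : u n @[n --> \oo] --> l ->
  u n ^+ p @[n --> \oo] --> l ^+ p.
Proof. by move=> ul; exact: (cvg_comp _ _ ul (@exprn_continuous R _ l)). Qed.

Lemma cvg_mul (u1 u2 : nat -> R) (l1 l2 : R) : u1 n @[n --> \oo] --> l1 ->
  u2 n @[n --> \oo] --> l2 -> u1 n * u2 n @[n --> \oo] --> l1 * l2.
Proof. exact: cvgM. Qed.

Lemma cvg_inv (u : nat -> R) (l : R) : l != 0 -> u n @[n --> \oo] --> l ->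
  (u n)^-1 @[n --> \oo] --> l^-1.
Proof. exact: cvgV. Qed.

Lemma cvg_add (u1 u2 : nat -> R) (l1 l2 : R) : u1 n @[n --> \oo] --> l1 ->
  u2 n @[n --> \oo] --> l2 -> u1 n + u2 n @[n --> \oo] --> l1 + l2.
Proof. exact: cvgD. Qed.

Lemma cvg_scale (u : nat -> R) (l c : R) : u n @[n --> \oo] --> l ->
  c * u n @[n --> \oo] --> c * l.
Proof. by move=> ul; apply: cvgM => //; exact: cvg_cst. Qed.

Lemma cvg_sum (I : finType) (u : I -> nat -> R) (l : I -> R) :
  (forall i, u i n @[n --> \oo] --> l i) ->
  \sum_i u i n @[n --> \oo] --> \sum_i l i.
Proof.
move=> ul; elim: (index_enum I) => [|i s' IHs].
  by under eq_cvg do rewrite big_nil; rewrite big_nil; exact: cvg_cst.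
by under eq_cvg do rewrite big_cons; rewrite big_cons; exact: cvg_add.
Qed.

Let lam_v_cvg p p' : lam n ^+ p * v n ^+ p' @[n --> \oo] --> lam0 ^+ p * v0 ^+ p'.
Proof. by apply: cvgM; exact: cvg_pow. Qed.

Lemma exponent_ratio_cvg : exponent n / r n @[n --> \oo] --> s * lam0 * th.
Proof.
rewrite (_ : (fun n => _) = fun n => s * lam n * th +
    lam n ^+ 3 * v n ^+ 1 * (th ^+ 2 / 2 * r n)); last first.
  by apply/funext => n; rewrite /exponent; field; rewrite gt_eqF.
rewrite -[X in _ --> X]addr0; apply: cvgD.
  by apply: cvgM; [exact: cvg_scale|exact: cvg_cst].
rewrite -[X in _ --> X](mulr0 (lam0 ^+ 3 * v0 ^+ 1)); apply: cvgM => //.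
by rewrite -[X in _ --> X](mulr0 (th ^+ 2 / 2)); exact: cvg_scale.
Qed.

Lemma exponent_le K : `|s * lam0 * th| < K ->
  \forall n \near \oo, `|exponent n| <= K * r n.
Proof.
move=> Kl; have h : `|exponent n / r n| @[n --> \oo] --> `|s * lam0 * th|.
  exact: (cvg_comp _ _ exponent_ratio_cvg (@norm_continuous _ R^o _)).
near=> n; have : `|exponent n / r n| <= K by near: n; exact: (cvgr_le _ h).
by rewrite normrM normfV (gtr0_norm (r_gt0 n)) ler_pdivrMr.
Unshelve. all: by end_near.
Qed.

Variable E : nat -> R.
Hypothesis E_expansion : forall n a K, 0 <= K -> `|exponent n| <= K * r n -> 0 < a ->
  `|E n - (1 - exponent n * (lam n)^-1 + exponent n ^+ 2 * q n / 2)| <=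
  r n ^+ 2 * ((K + K ^+ 2) * U n (r n)^-1 +
     K ^+ 3 * expR K * (a * q n * r n + U n a)).

Let rem n : R := r n * ((s * (lam n ^+ 2 * v n ^+ 1) * th ^+ 3 +
  lam n ^+ 4 * v n ^+ 2 * th ^+ 4 * r n / 4) * (lam n ^+ 2 * v n ^+ 1 + 1) / 2).

(** The term [lam ^+ 2 * v * th ^+ 2 * r ^+ 2 / 2] occurs with opposite signs in the linear and the
    quadratic part and cancels. As [s ^+ 2 = 1], the expansion of [expR (- (s * th * r))] to second
    order is left. *)
Let expansionE n : 1 - exponent n * (lam n)^-1 + exponent n ^+ 2 * q n / 2 =
  1 - s * th * r n + (s * th * r n) ^+ 2 / 2 + r n ^+ 2 * rem n.
Proof.
have l0 : lam n != 0 by rewrite gt_eqF.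
by rewrite /exponent /q /rem; case: s_sign => ->; field.
Qed.

Lemma rem_cvg0 : rem n @[n --> \oo] --> (0 : R).
Proof.
rewrite -[X in _ --> X](mul0r ((s * (lam0 ^+ 2 * v0 ^+ 1) * th ^+ 3 +
  lam0 ^+ 4 * v0 ^+ 2 * th ^+ 4 * 0 / 4) * (lam0 ^+ 2 * v0 ^+ 1 + 1) / 2)).
have cc (c : R) : (fun _ : nat => c) n @[n --> \oo] --> c by exact: cvg_cst.
have cA := cvg_mul (cvg_scale (c := s) (@lam_v_cvg 2 1)) (cc (th ^+ 3)).
have cB := cvg_mul (cvg_mul (cvg_mul (@lam_v_cvg 4 2) (cc (th ^+ 4))) r_cvg) (cc 4^-1).
exact: (cvg_mul r_cvg (cvg_mul (cvg_mul (cvg_add cA cB)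
  (cvg_add (@lam_v_cvg 2 1) (cc 1))) (cc 2^-1))).
Qed.

(** The numerator here is the defect in the mean of the pure exponential. The linear correction of
    the clock is proportional to it, so it is [o(r ^+ 2)] as well. *)
Lemma delta_negligible :
  (expR (- (s * th * r n)) - E n) / r n ^+ 2 @[n --> \oo] --> (0 : R).
Proof.
pose K := `|s * lam0 * th| + 1.
have K0 : 0 <= K by rewrite addr_ge0.
have Kl : `|s * lam0 * th| < K by rewrite /K ltrDl.
have eK := exponent_le Kl.
pose C := (K + K ^+ 2) + K ^+ 3 * expR K + 1.
have C1 : 0 <= K + K ^+ 2 by rewrite addr_ge0// exprn_ge0.
have C2 : 0 <= K ^+ 3 * expR K by rewrite mulr_ge0 ?exprn_ge0 ?expR_ge0.
have C0 : 0 < C by rewrite /C; lra.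
apply: cvg0_near_le => e e0.
have e2 : 0 < e / 2 / C by rewrite !divr_gt0.
(* The level is fixed by [e] alone, uniformly in [n]; only afterwards does [n] grow, so the term
   with [a * r n] vanishes. *)
have [a a0 Ua] := U_tight e2.
have e1 : 0 < e / 2 by rewrite divr_gt0.
pose w n := `|th| ^+ 3 * r n * expR (`|th| * r n) + `|rem n| +
  K ^+ 3 * expR K * (a * q n * r n).
have w0 : w n @[n --> \oo] --> (0 : R).
  rewrite -[X in _ --> X]addr0 -[X in _ --> X + _]addr0; apply: cvgD; first apply: cvgD.
  - rewrite -[X in _ --> X](mul0r (expR (`|th| * 0))); apply: cvgM.
      by rewrite -[X in _ --> X](mulr0 (`|th| ^+ 3)); exact: cvg_scale.
    exact: (cvg_comp _ _ (cvg_scale (c := `|th|) r_cvg) (@continuous_expR R _)).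
  - by rewrite -(normr0 R); exact: (cvg_comp _ _ rem_cvg0 (@norm_continuous _ R^o _)).
  - rewrite -[X in _ --> X](mulr0 (K ^+ 3 * expR K)); apply: cvg_scale.
    rewrite -[X in _ --> X](mulr0 (a * (v0 + lam0^-1 ^+ 2))); apply: cvgM => //.
    apply: cvg_scale; apply: cvgD => //; apply: cvg_pow; apply: cvgV => //.
    by rewrite gt_eqF.
have a1 : \forall n \near \oo, a <= (r n)^-1.
  by have := near_le_ratio a ltr01; apply: filterS => n; rewrite div1r.
have wn := near_le_of_cvg0 w0 e1.
near=> n.
have r0 := r_gt0 n; have r20 : 0 < r n ^+ 2 by rewrite exprn_gt0.
rewrite normrM normfV (gtr0_norm r20) ler_pdivrMr//.
have h1 : `|E n - (1 - exponent n * (lam n)^-1 + exponent n ^+ 2 * q n / 2)| <=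
  r n ^+ 2 * ((K + K ^+ 2) * U n (r n)^-1 +
     K ^+ 3 * expR K * (a * q n * r n + U n a)).
  by apply: E_expansion => //; near: n.
have h2 := expR_taylor3 (- (s * th * r n)).
have ns : `|s| = 1 by case: s_sign => ->; rewrite ?normrN normr1.
have nst : `|- (s * th * r n)| = `|th| * r n.
  by rewrite normrN !normrM ns mul1r (gtr0_norm r0).
rewrite nst sqrrN in h2.
rewrite expansionE in h1.
have Ur : U n (r n)^-1 <= U n a by apply: U_le; near: n.
have we : w n <= e / 2 by near: n.
have UC : C * U n a <= e / 2 by rewrite mulrC -ler_pdivlMr.
rewrite (_ : expR _ - E n =
  (expR (- (s * th * r n)) - (1 + - (s * th * r n) + (s * th * r n) ^+ 2 / 2))
  - (E n - (1 - s * th * r n + (s * th * r n) ^+ 2 / 2 + r n ^+ 2 * rem n))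
  - r n ^+ 2 * rem n); last by ring.
apply: (le_trans (ler_normB _ _)); apply: (le_trans (lerD (ler_normB _ _) (lexx _))).
apply: (le_trans (lerD (lerD h2 h1) (lexx _))).
rewrite normrM (gtr0_norm r20).
have U0 := U_ge0 n a.
have k1 : (K + K ^+ 2) * U n (r n)^-1 <= (K + K ^+ 2) * U n a by exact: ler_wpM2l.
have -> : (`|th| * r n) ^+ 3 * expR (`|th| * r n) =
  r n ^+ 2 * (`|th| ^+ 3 * r n * expR (`|th| * r n)) by ring.
rewrite -!mulrDr mulrC; apply: ler_wpM2r; first exact: ltW.
move: we UC k1; rewrite /w /C.
move: (`|th| ^+ 3 * r n * expR _) (`|rem n|) (K ^+ 3 * expR K) C2.
move=> x1 x2 x3 x30; lra.
Unshelve. all: by end_near.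
Qed.

End asymptotics.

Section second_moment.
Context d (Om : measurableType d) (R : realType) (P : probability Om R).
Variables (k : nat) (Q : hetero_queue P k) (i : 'I_k.+1).
Hypothesis var_fin : ('V_P[gtime Q i])%E \is a fin_num.

Notation T := (gtime Q i).
Notation m := (\int[P]_w T w).

Lemma variance_gtimeE : ('V_P[T] = \int[P]_w ((T w - m) ^+ 2)%:E)%E.
Proof.
rewrite /variance unlock [in LHS]unlock.
by apply: eq_integral => w _; rewrite expr2.
Qed.

Lemma integrable_centered : P.-integrable setT (EFin \o (fun w => (T w - m) ^+ 2)).
Proof.
apply/integrableP; split.
  apply/measurable_EFinP; apply: measurable_funX; apply: measurable_funB => //.
under eq_integral do rewrite /= ger0_norm ?sqr_ge0//.
by rewrite -variance_gtimeE ltey_eq var_fin.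
Qed.

Lemma integrable_gtime_sq : P.-integrable setT (EFin \o (fun w => T w ^+ 2)).
Proof.
have i2 : P.-integrable setT (EFin \o (fun w => 2 * (T w - m) ^+ 2 + 2 * m ^+ 2)).
  rewrite (_ : _ \o _ = ((EFin \o (fun w => 2 * (T w - m) ^+ 2)%R) \+
     (EFin \o (fun=> 2 * m ^+ 2)%R))%E); last by apply/funext.
  apply: integrableD => //; first exact: (integrableZl measurableT 2 integrable_centered).
  exact: (bounded_mfun_integrable P (bounded_mfun_cst Om _)).
apply: le_integrable i2 => //.
  by apply/measurable_EFinP; apply: measurable_funX; exact: measurable_funP.
move=> w _; rewrite lee_fin ger0_norm ?sqr_ge0// ger0_norm; last first.
  by apply: addr_ge0; apply: mulr_ge0 => //; exact: sqr_ge0.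
have := sqr_ge0 (T w - m - m); rewrite !expr2; lra.
Qed.

Lemma second_momentE : \int[P]_w (T w ^+ 2) = stddev Q i ^+ 2 + (rate Q i)^-1 ^+ 2.
Proof.
have -> : stddev Q i ^+ 2 = \int[P]_w ((T w - m) ^+ 2).
  rewrite /stddev sqr_sqrtr; last by apply: fine_ge0; exact: variance_ge0.
  by rewrite variance_gtimeE.
rewrite rateE invrK.
have i1 := integrable_gtime Q i; have i2 := integrable_gtime_sq.
have ic c := bounded_mfun_integrable P (bounded_mfun_cst Om (c : R)).
have iB : P.-integrable setT (EFin \o (fun w => T w ^+ 2 - 2 * m * T w)).
  rewrite (_ : _ \o _ = ((EFin \o (fun w => T w ^+ 2)%R) \-
     (EFin \o (fun w => 2 * m * T w)%R))%E); last by apply/funext.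
  by apply: integrableB => //; exact: (integrableZl measurableT (2 * m) i1).
have -> : \int[P]_w ((T w - m) ^+ 2) = \int[P]_w ((T w ^+ 2 - 2 * m * T w) + m ^+ 2).
  by apply: eq_Rintegral => w _; ring.
rewrite RintegralD// mean_cst RintegralB//; last exact: (integrableZl measurableT (2 * m) i1).
by rewrite RintegralZl//; ring.
Qed.

Lemma tail_momentE (a : R) :
  (\int[P]_(w in [set w | (a < T w)%R]) (T w ^+ 2)%:E)%E = (tail_moment P T a)%:E.
Proof.
rewrite /tail_moment /Rintegral fineK; last first.
  apply: integrable_fin_num => //.
  exact: (integrable_tail (measurable_funP T) integrable_gtime_sq).
rewrite [LHS]integral_mkcond; apply: eq_integral => w _ /=.
rewrite /patch; have [aT|Ta] := ltP a (T w); first by rewrite mem_set// mulr1.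
by rewrite memNset ?mulr0//= ltNge Ta.
Qed.

Lemma clock_laplace (r eta K a : R) : 0 < r -> 0 <= K -> `|eta| <= K * r -> 0 < a ->
  `|\int[P]_w expR (- (eta * clip r^-1 (T w))) -
    (1 - eta * (rate Q i)^-1 +
       eta ^+ 2 * (stddev Q i ^+ 2 + (rate Q i)^-1 ^+ 2) / 2)|
  <= r ^+ 2 * ((K + K ^+ 2) * tail_moment P T r^-1 +
       K ^+ 3 * expR K * (a * (stddev Q i ^+ 2 + (rate Q i)^-1 ^+ 2) * r
         + tail_moment P T a)).
Proof.
move=> r0 K0 eK a0; have mT : measurable_fun setT T := measurable_funP T.
have := laplace_error mT (gtime_ge0 Q i) integrable_gtime_sq r0 K0 eK a0.
by rewrite second_momentE (_ : m = (rate Q i)^-1)// rateE invrK.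
Qed.

(** On [T > c] one has [T - c <= T ^+ 2 / c]. At [c = ep / r] the division supplies a factor [r]
    while the truncated moment tends to 0, so the excess is [o(r)]. *)
Lemma excess_le (c : R) : 0 < c -> excess Q i c <= rate Q i * tail_moment P T c / c.
Proof.
move=> c0; have c0' : 0 < c^-1 by rewrite invr_gt0.
have := clip_gap_mean (measurable_funP T) (gtime_ge0 Q i) integrable_gtime_sq c0'.
rewrite invrK => h; have l0 := rate_gt0 Q i.
have -> : excess Q i c = rate Q i * (m - \int[P]_w clip c (T w)).
  by rewrite /excess mulrBr rateE mulVf// gt_eqF// mean_gtime_gt0.
by rewrite -mulrA; apply: ler_wpM2l; [exact: ltW|rewrite mulrC].
Qed.

End second_moment.

(** * Limit of the Laplace transforms *)

Section laplace_limit.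
Unset Implicit Arguments.
Variables (R : realType) (k : nat).
Variables (d : nat -> measure_display) (Om : forall n, measurableType (d n)).
Variable P : forall n, probability (Om n) R.
Variable Q : forall n, hetero_queue (P n) k.
Hypothesis time_pos : forall n i, (0 < P n [set w | (0 < gtime (Q n) i w)%R])%E.
Hypothesis var_fin : forall n i, ('V_(P n)[gtime (Q n) i])%E \is a fin_num.
Variable pi : nat -> probability (mstate R k) R.
Hypothesis pi_stationary : forall n, stationary_distribution (Q n) (pi n).
Variables lambda sigma : 'I_k.+1 -> R.
Hypothesis lambda_gt0 : forall i, 0 < lambda i.
Hypothesis rate_cvg : forall i, rate (Q n) i @[n --> \oo] --> lambda i.
Hypothesis load_lt1 : forall n, 0 < load (Q n) < 1.
Hypothesis load_cvg : load (Q n) @[n --> \oo] --> (1 : R).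
Hypothesis stddev_cvg : forall i, stddev (Q n) i @[n --> \oo] --> sigma i.
Hypothesis tail_tight : forall i (e : R), 0 < e -> exists2 a : R, 0 < a &
  forall n, tail_moment (P n) (gtime (Q n) i) a <= e.

Let r (n : nat) : R := 1 - load (Q n).
Let lam (i : 'I_k.+1) (n : nat) : R := rate (Q n) i.
Let v (i : 'I_k.+1) (n : nat) : R := stddev (Q n) i ^+ 2.
Let U (i : 'I_k.+1) (n : nat) (a : R) : R := tail_moment (P n) (gtime (Q n) i) a.
Let A (n : nat) : R := \sum_(j < k) rate (Q n) (lift ord0 j).

Let r_gt0 n : 0 < r n. Proof. by rewrite subr_gt0; case/andP: (load_lt1 n). Qed.

Let r_le1 n : r n <= 1.
Proof. by rewrite gerBl; case/andP: (load_lt1 n) => /ltW. Qed.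

Let r_cvg : r n @[n --> \oo] --> (0 : R).
Proof. by rewrite -(subrr (1 : R)); apply: cvgB => //; exact: cvg_cst. Qed.

Let A_gt0 n : 0 < A n.
Proof.
have /andP[l0 _] := load_lt1 n; rewrite lt_neqAle; apply/andP; split.
  by apply: contraTneq l0 => A0; rewrite /load -/(A n) -A0 invr0 mulr0 ltxx.
by apply: sumr_ge0 => j _; exact/ltW/rate_gt0.
Qed.

Let loadE n : load (Q n) * A n = lam ord0 n.
Proof. by rewrite /load -/(A n) divfK// gt_eqF. Qed.

Let A_gap n : A n - lam ord0 n = r n * A n.
Proof. by rewrite -loadE /r mulrBl mul1r. Qed.

Let A_cvg : A n @[n --> \oo] --> lambda ord0.
Proof.
rewrite (_ : (fun n => _) = fun n => lam ord0 n * (load (Q n))^-1); last first.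
  apply/funext => n; rewrite -loadE mulrAC divff ?mul1r// gt_eqF//.
  by case/andP: (load_lt1 n).
by have := cvg_mul (rate_cvg ord0) (cvg_inv (oner_neq0 R) load_cvg); rewrite invr1 mulr1.
Qed.

Let cst_cvg (c : R) : (fun _ : nat => c) n @[n --> \oo] --> c.
Proof. exact: cvg_cst. Qed.

Let v_cvg i : v i n @[n --> \oo] --> sigma i ^+ 2.
Proof. exact: cvg_pow. Qed.

Let lam_gt0 i n : 0 < lam i n. Proof. exact: rate_gt0. Qed.

Let mT (i : 'I_k.+1) (n : nat) : measurable_fun setT (gtime (Q n) i) := measurable_funP (gtime (Q n) i).

Let U_ge0 i n a : 0 <= U i n a.
Proof. apply: tail_moment_ge0; exact: gtime_ge0. Qed.

Let U_le i n a c : a <= c -> U i n c <= U i n a.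
Proof.
by apply: tail_moment_le; [exact: mT|exact: gtime_ge0|exact: integrable_gtime_sq].
Qed.

Variable th : R.
Hypothesis th_gt0 : 0 < th.

(** The required mean is [expR (- (s i * th * r))]: it is [z^-1] for the arrival clock and [z] for
    the service clocks. *)
Let s (i : 'I_k.+1) : R := if i == ord0 then -1 else 1.

Let s_sign i : s i = 1 \/ s i = -1.
Proof. by rewrite /s; case: ifP; [right|left]. Qed.

Let s_lift (j : 'I_k) : s (lift ord0 j) = 1.
Proof. by rewrite /s eq_sym eq_liftF. Qed.

Let eta (n : nat) (i : 'I_k.+1) : R := exponent r (s i) th (lam i) (v i) n.
Let M (n : nat) (i : 'I_k.+1) : R := clipped_mean (Q n) i (r n)^-1.
Let E (i : 'I_k.+1) (n : nat) : R := \int[P n]_w expR (- (eta n i * clip (r n)^-1 (gtime (Q n) i w))).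
(** The solution of the linear equation saying that [E i n + del n i * M n i] is the required
    mean. *)
Let del (n : nat) (i : 'I_k.+1) : R := (expR (- (s i * th * r n)) - E i n) / M n i.
Let z (n : nat) : R := expR (- (th * r n)).

Let rV_gt0 n : 0 < (r n)^-1. Proof. by rewrite invr_gt0. Qed.

Let M_gt0 n i : 0 < M n i. Proof. exact: clipped_mean_gt0. Qed.

Let excess_tail (c : R) n i : 0 < c ->
  excess (Q n) i (c * (r n)^-1) <= r n * (lam i n * U i n (c / r n) / c).
Proof.
move=> c0; have c1 : 0 < c * (r n)^-1 by exact: mulr_gt0.
apply: (le_trans (excess_le (var_fin n i) c1)).
rewrite le_eqVlt; apply/orP; left; apply/eqP; rewrite /lam /U; field.
by rewrite !gt_eqF// r_gt0.
Qed.

Let tail_cvg i c : 0 < c -> lam i n * U i n (c / r n) / c @[n --> \oo] --> (0 : R).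
Proof.
move=> c0.
have := cvg_mul (cvg_mul (rate_cvg i) (tail_cvg0 r_gt0 r_cvg (U_ge0 i) (U_le i) (tail_tight i) c0))
  (cst_cvg c^-1).
by rewrite mulr0 mul0r.
Qed.

Let M_cvg i : M n i @[n --> \oo] --> (lambda i)^-1.
Proof.
have ex0 : excess (Q n) i (r n)^-1 @[n --> \oo] --> (0 : R).
  apply: cvg0_near_le => e e0.
  have h0 := cvg_mul r_cvg (tail_cvg i 1 ltr01); rewrite mul0r in h0.
  have := near_le_of_cvg0 h0 e0; apply: filterS => n h.
  rewrite ger0_norm; last exact: excess_ge0.
  by rewrite -[(r n)^-1]mul1r; apply: le_trans h; exact: excess_tail.
rewrite (_ : (fun n => _) = fun n => (1 - excess (Q n) i (r n)^-1) * (lam i n)^-1).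
  have := cvg_mul (cvg_add (cst_cvg 1) (cvg_scale (c := -1) ex0))
    (cvg_inv (lt0r_neq0 (lambda_gt0 i)) (rate_cvg i)).
  by rewrite mulr0 addr0 mul1r; under eq_cvg do rewrite mulN1r.
apply/funext => n; rewrite /excess opprB addrC subrK /lam mulrAC divff ?mul1r//.
by rewrite gt_eqF// rate_gt0.
Qed.

Let del_cvg i : del n i / r n ^+ 2 @[n --> \oo] --> (0 : R).
Proof.
rewrite (_ : (fun n => _) = fun n =>
  (expR (- (s i * th * r n)) - E i n) / r n ^+ 2 * (M n i)^-1); last first.
  by apply/funext => n; rewrite /del mulrAC.
rewrite -[X in _ --> X](mul0r (lambda i)); apply: cvg_mul; last first.
  rewrite -[X in _ --> X]invrK; apply: cvg_inv => //.
  by rewrite invr_eq0 gt_eqF.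
apply: (delta_negligible r_gt0 r_cvg (U_ge0 i) (U_le i) (tail_tight i)
  (s_sign i) (lam_gt0 i) (lambda_gt0 i) (rate_cvg i) (v_cvg i)).
by move=> n a K K0 eK a0; exact: (clock_laplace (var_fin n i)).
Qed.

(** Strictly above the limit of [|eta n i| / r n] for every clock, and at least 1 as [main_estimate]
    demands. *)
Let K : R := 1 + \sum_i (`|s i * lambda i * th| + 1).

Let K1 : 1 <= K.
Proof. by rewrite lerDl; apply: sumr_ge0 => i _; rewrite addr_ge0. Qed.

Let K_gt i : `|s i * lambda i * th| < K.
Proof.
rewrite /K (bigD1 i)//=.
have : 0 <= \sum_(j < k.+1 | j != i) (`|s j * lambda j * th| + 1).
  by apply: sumr_ge0 => j _; rewrite addr_ge0.
by move: (\sum_(_ < _ | _) _) (`|_|) => a b; lra.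
Qed.

Let eta_near : \forall n \near \oo, forall i, `|eta n i| <= K * r n.
Proof.
apply: filter_forall => i.
exact: (exponent_le r_gt0 r_cvg (rate_cvg i) (v_cvg i) (K_gt i)).
Qed.

Let del_near : \forall n \near \oo, forall i, `|del n i| * expR K <= r n / 2.
Proof.
apply: filter_forall => i.
have h1 : \forall n \near \oo, `|del n i / r n ^+ 2| <= 1.
  have c0 : `|del n i / r n ^+ 2| @[n --> \oo] --> (0 : R).
    by rewrite -(normr0 R); exact: (cvg_comp _ _ (del_cvg i) (@norm_continuous _ R^o _)).
  exact: (near_le_of_cvg0 c0 ltr01).
have h2 : \forall n \near \oo, r n <= (2 * expR K)^-1.
  by apply: (near_le_of_cvg0 r_cvg); rewrite invr_gt0 mulr_gt0// expR_gt0.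
move: h1 h2; apply: filterS2 => n h1 h2.
have r0 := r_gt0 n; have r20 : 0 < r n ^+ 2 by rewrite exprn_gt0.
move: h1; rewrite normrM normfV (gtr0_norm r20) ler_pdivrMr// mul1r => h1.
apply: (le_trans (ler_wpM2r (expR_ge0 K) h1)).
rewrite expr2 -mulrA; apply: ler_wpM2l; first exact: ltW.
by move: h2; rewrite invfM -ler_pdivrMr ?invr_gt0 ?expR_gt0// invrK.
Qed.

Let mean_clock n i :
  \int[P n]_w clock (eta n) (del n) (fun=> (r n)^-1) i (gtime (Q n) i w) =
  expR (- (s i * th * r n)).
Proof.
have bc := bounded_clip_time (Q n) i (rV_gt0 n).
rewrite /clock /clock_fun meanD; last 2 first.
- split; last first.
    exists (expR (`|eta n i| * (r n)^-1)) => w; rewrite ger0_norm ?expR_ge0//.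
    by have /andP[] := expR_clip_bounds (eta n i) (rV_gt0 n) (gtime (Q n) i w).
  apply: measurableT_comp => //; apply: measurableT_comp => //.
  by apply: measurable_funM; [exact: measurable_cst|case: bc].
- by apply: bounded_mfunM => //; exact: bounded_mfun_cst.
rewrite meanZ// -/(clipped_mean (Q n) i (r n)^-1) -/(M n i) -/(E i n).
by rewrite /del divfK ?gt_eqF// addrC subrK.
Qed.

Let X (n : nat) : R := \int[pi n]_x z n ^+ customers x.
Let p (n : nat) (i : 'I_k.+1) : R := busy_prob (pi n) i.
Let S (n : nat) : R := \sum_i lam i n ^+ 3 * v i n.
Let B (n : nat) : R := th * A n + th ^+ 2 * S n / 2.

(** The signed rates add up to [A n - lam ord0 n = r n * A n], which lifts the first-order parts to
    order [r n ^+ 2], alongside the variance terms. *)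
Let sum_eta n : \sum_i eta n i = r n ^+ 2 * B n.
Proof.
rewrite /eta /exponent big_split/= big_ord_recl /= {1}/s eqxx.
under eq_bigr do rewrite s_lift mul1r.
rewrite -!mulr_suml -/(A n) /B /S.
have := A_gap n; move: (\sum_(_ < _) _ * _) => y h.
have -> : lam ord0 n = A n - r n * A n by rewrite -h; ring.
by field.
Qed.

Let p0E n : p n ord0 = 1. Proof. exact: busy_prob0. Qed.

Let sum_gap n : \sum_(j < k) lam (lift ord0 j) n * (1 - p n (lift ord0 j)) = r n * A n.
Proof.
rewrite -A_gap /lam -(busy_prob_balance (time_pos n) (pi_stationary n)) -sumrB.
by apply: eq_bigr => j _; rewrite mulrBr mulr1.
Qed.

Let gap_ge0 n i : 0 <= 1 - p n i.
Proof. by rewrite subr_ge0; case/andP: (busy_prob_bounds (pi n) i). Qed.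

(** All terms of [sum_gap] are nonnegative, so each of them is at most the total. The arrival clock
    always runs and has no gap. *)
Let gap_le n i : 1 - p n i <= r n * (A n / lam i n).
Proof.
case: (unliftP ord0 i) => [j ->|->]; last first.
  by rewrite p0E subrr mulr_ge0 ?divr_ge0// ltW.
rewrite mulrA ler_pdivlMr// mulrC -sum_gap (bigD1 j)//= lerDl.
by apply: sumr_ge0 => l _; rewrite mulr_ge0// ltW.
Qed.

(** The first-order part is evaluated exactly by [sum_gap] and produces the constant term
    [th * A n]; the second-order part carries the vanishing gaps. *)
Let sum_eta_gap n : \sum_i eta n i * (1 - p n i) =
  r n ^+ 2 * (th * A n + th ^+ 2 / 2 * \sum_i lam i n ^+ 3 * v i n * (1 - p n i)).
Proof.
rewrite mulrDr; transitivity (\sum_i s i * lam i n * th * r n * (1 - p n i) +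
   \sum_i lam i n ^+ 3 * v i n * th ^+ 2 * r n ^+ 2 / 2 * (1 - p n i)).
  by rewrite -big_split/=; apply: eq_bigr => i _; rewrite /eta /exponent mulrDl.
congr (_ + _).
  rewrite big_ord_recl p0E subrr mulr0 add0r.
  transitivity (th * r n * \sum_(j < k) lam (lift ord0 j) n * (1 - p n (lift ord0 j))).
    by rewrite mulr_sumr; apply: eq_bigr => j _; rewrite s_lift; ring.
  by rewrite sum_gap; ring.
by rewrite !mulr_sumr; apply: eq_bigr => i _; field.
Qed.

(** [main_estimate] divided by [r n ^+ 2]: the excesses and the idle probabilities each supply one
    factor [r n], by [excess_tail] and [gap_le]. *)
Let estimate n (ep : R) : 0 < ep <= 1 ->
  (forall i, `|eta n i| <= K * r n) -> (forall i, `|del n i| * expR K <= r n / 2) ->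
  `|B n * X n - (th * A n + th ^+ 2 / 2 * \sum_i lam i n ^+ 3 * v i n * (1 - p n i))| <=
  estimate_const k K * (`|B n| * (ep + r n * \sum_i lam i n * U i n (ep / r n) / ep + th * r n)
    + (ep * \sum_i A n / lam i n + \sum_i lam i n * U i n (ep / r n) / ep
       + \sum_i lam i n * U i n (1 / r n) / 1)
    + \sum_i `|del n i / r n ^+ 2|).
Proof.
move=> ep01 eK dK; have /andP[ep0 ep1] := ep01.
have r0 := r_gt0 n; have r20 : 0 < r n ^+ 2 by rewrite exprn_gt0.
have r01 : 0 < r n <= 1 by rewrite r0 r_le1.
have m0 : \int[P n]_w clock (eta n) (del n) (fun=> (r n)^-1) ord0 (gtime (Q n) ord0 w) = (z n)^-1.
  by rewrite mean_clock /s eqxx /z -expRN opprK mulN1r mulNr opprK.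
have m1 j : \int[P n]_w clock (eta n) (del n) (fun=> (r n)^-1) (lift ord0 j)
    (gtime (Q n) (lift ord0 j) w) = z n.
  by rewrite mean_clock s_lift mul1r.
have := main_estimate K1 (time_pos n) (pi_stationary n) r01 (ltW th_gt0) ep01 eK dK m0 m1.
rewrite -/(X n) sum_eta sum_eta_gap.
have C0 : 0 <= estimate_const k K.
  have tb0 : 0 <= test_bound k K by apply: le_trans (test_bound_ge1 k K1).
  have cb0 : 0 <= clock_bound K by apply: le_trans (clock_bound_ge1 K1).
  have os0 := oscillation_ge0 K1; have K0 : 0 <= K by apply: le_trans K1.
  rewrite /estimate_const; do 4 (apply: addr_ge0; last by rewrite ?mulr_ge0// addr_ge0).
  by rewrite !mulr_ge0.
rewrite -mulrA -mulrBr normrM (gtr0_norm r20) mulrC -ler_pdivlMr// => /le_trans; apply.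
rewrite -mulrA; apply: ler_wpM2l => //.
rewrite ler_pdivrMr// normrM (gtr0_norm r20).
have e1 : \sum_i excess (Q n) i (ep * (r n)^-1) <= r n * \sum_i lam i n * U i n (ep / r n) / ep.
  by rewrite mulr_sumr; apply: ler_sum => i _; exact: excess_tail.
have e2 : \sum_i excess (Q n) i (r n)^-1 <= r n * \sum_i lam i n * U i n (1 / r n) / 1.
  rewrite mulr_sumr; apply: ler_sum => i _; by have := excess_tail 1 n i ltr01; rewrite !mul1r.
have e3 : \sum_i (1 - busy_prob (pi n) i) <= r n * \sum_i A n / lam i n.
  by rewrite mulr_sumr; apply: ler_sum => i _; exact: gap_le.
have e4 : \sum_i `|del n i| = (\sum_i `|del n i / r n ^+ 2|) * r n ^+ 2.
  rewrite mulr_suml; apply: eq_bigr => i _.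
  by rewrite [in RHS]normrM normfV (gtr0_norm r20) divfK// gt_eqF.
rewrite e4.
move: e1 e2 e3; move: (\sum_i excess _ _ _) (\sum_i excess _ _ _) => y1 y2.
move: (\sum_i lam i n * U i n (ep / r n) / ep) (\sum_i lam i n * U i n (1 / r n) / 1) => w1 w2.
move: (\sum_i (1 - _)) (\sum_i A n / lam i n) (\sum_i `|del n i / _|) => y3 w3 w4 e1 e2 e3.
rewrite [leRHS]mulrDl lerD2r [leRHS]mulrDl; apply: lerD.
  rewrite [`|B n| * _ * _]mulrC mulrA; apply: ler_wpM2l; first by rewrite mulr_ge0// ltW.
  by rewrite lerD2r lerD2l.
rewrite expr2 mulrA [leRHS]mulrC; apply: ler_wpM2l; first exact: ltW.
have := ler_wpM2l (ltW ep0) e3.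
by move: e1 e2; lra.
Qed.

(** By [estimate], [B n * X n] equals [th * A n] up to terms that vanish when first [n] grows and
    then [ep] tends to 0; the limit of [B n] is positive. *)
Lemma laplace_cvg : X n @[n --> \oo] -->
  th * lambda ord0 /
  (th * lambda ord0 + th ^+ 2 * (\sum_i lambda i ^+ 3 * sigma i ^+ 2) / 2).
Proof.
pose S0 : R := \sum_i lambda i ^+ 3 * sigma i ^+ 2.
pose B0 : R := th * lambda ord0 + th ^+ 2 * S0 / 2.
have S00 : 0 <= S0.
  apply: sumr_ge0 => i _; apply: mulr_ge0; last exact: sqr_ge0.
  by rewrite exprn_ge0// ltW.
have B00 : 0 < B0.
  by rewrite /B0 ltr_pwDl ?mulr_gt0// mulr_ge0// mulr_ge0// exprn_ge0// ltW.
have S_cvg : S n @[n --> \oo] --> S0.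
  by apply: cvg_sum => i; exact: (cvg_mul (cvg_pow (p := 3) (rate_cvg i)) (v_cvg i)).
have B_cvg : B n @[n --> \oo] --> B0.
  exact: (cvg_add (cvg_scale (c := th) A_cvg)
    (cvg_mul (cvg_scale (c := th ^+ 2) S_cvg) (cst_cvg 2^-1))).
pose rest n := \sum_i lam i n ^+ 3 * v i n * (1 - p n i).
have gap0 i : 1 - p n i @[n --> \oo] --> (0 : R).
  apply: cvg0_near_le => e e0.
  have Al : A n / lam i n @[n --> \oo] --> lambda ord0 / lambda i.
    exact: (cvg_mul A_cvg (cvg_inv (lt0r_neq0 (lambda_gt0 i)) (rate_cvg i))).
  have h := cvg_mul r_cvg Al; rewrite mul0r in h.
  have := near_le_of_cvg0 h e0; apply: filterS => n hn.
  by rewrite ger0_norm//; apply: le_trans hn; exact: gap_le.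
have rest0 : rest n @[n --> \oo] --> (0 : R).
  have := cvg_sum (fun i =>
    cvg_mul (cvg_mul (cvg_pow (p := 3) (rate_cvg i)) (v_cvg i)) (gap0 i)).
  by rewrite big1// => i _; rewrite mulr0.
pose x n := B n * X n - (th * A n + th ^+ 2 / 2 * rest n).
have x0 : x n @[n --> \oo] --> (0 : R).
  pose G0 : R := \sum_i lambda ord0 / lambda i.
  have G_cvg : \sum_i A n / lam i n @[n --> \oo] --> G0.
    apply: cvg_sum => i.
    exact: (cvg_mul A_cvg (cvg_inv (lt0r_neq0 (lambda_gt0 i)) (rate_cvg i))).
  have G00 : 0 <= G0 by apply: sumr_ge0 => i _; rewrite divr_ge0// ltW.
  (* [C] collects the coefficients of [ep], with [B0 + 1] and [G0 + 1] as eventual bounds of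
     convergent sequences; [w] collects what vanishes for fixed [ep]. *)
  pose C := `|estimate_const k K| * (B0 + 1 + (G0 + 1)).
  have nB : `|B n| @[n --> \oo] --> B0.
    rewrite -(gtr0_norm B00).
    exact: (cvg_comp _ _ B_cvg (@norm_continuous _ R^o _)).
  have C0 : 0 <= C by apply: mulr_ge0 => //; have B0' := ltW B00; lra.
  apply: (squeeze_cvg0 C0).
  move=> ep ep01; have /andP[ep0 ep1] := ep01.
  pose w n := `|estimate_const k K| *
    (`|B n| * (r n * \sum_i lam i n * U i n (ep / r n) / ep + th * r n)
     + (\sum_i lam i n * U i n (ep / r n) / ep
       + \sum_i lam i n * U i n (1 / r n) / 1)
     + \sum_i `|del n i / r n ^+ 2|).
  have t1 c : 0 < c -> \sum_i lam i n * U i n (c / r n) / c @[n --> \oo] --> (0 : R).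
    by move=> c0; have := cvg_sum (fun i => tail_cvg i c c0); rewrite big1.
  have t2 : \sum_i `|del n i / r n ^+ 2| @[n --> \oo] --> (0 : R).
    have n0 i : `|del n i / r n ^+ 2| @[n --> \oo] --> (0 : R).
      by rewrite -(normr0 R); exact: (cvg_comp _ _ (del_cvg i) (@norm_continuous _ R^o _)).
    by have := cvg_sum n0; rewrite big1.
  exists w.
    have := cvg_scale (c := `|estimate_const k K|) (cvg_add (cvg_add (cvg_mul nB (cvg_add
      (cvg_mul r_cvg (t1 _ ep0)) (cvg_scale (c := th) r_cvg)))
      (cvg_add (t1 _ ep0) (t1 1 ltr01))) t2).
    by rewrite !(mulr0, mul0r, addr0).
  have b1 : \forall n \near \oo, `|B n| <= B0 + 1.
    near=> n; near: n; apply: (cvgr_le _ nB); by rewrite ltrDl.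
  have b2 : \forall n \near \oo, \sum_i A n / lam i n <= G0 + 1.
    near=> n; near: n; apply: (cvgr_le _ G_cvg); by rewrite ltrDl.
  near=> n.
  have en : forall i, `|eta n i| <= K * r n by near: n.
  have dn : forall i, `|del n i| * expR K <= r n / 2 by near: n.
  have Bn : `|B n| <= B0 + 1 by near: n.
  have Gn : \sum_i A n / lam i n <= G0 + 1 by near: n.
  apply: (le_trans (estimate n ep ep01 en dn)).
  have s1 c : 0 < c -> 0 <= \sum_i lam i n * U i n (c / r n) / c.
    move=> c0; apply: sumr_ge0 => i _; apply: divr_ge0; last exact: ltW.
    by apply: mulr_ge0; [exact/ltW|].
  have s2 : 0 <= \sum_i A n / lam i n.
    by apply: sumr_ge0 => i _; apply: divr_ge0; exact: ltW.
  have s3 : 0 <= \sum_i `|del n i / r n ^+ 2| by exact: sumr_ge0.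
  have s4 := normr_ge0 (B n); have r0 := ltW (r_gt0 n); have th0 := ltW th_gt0.
  have ep0' := ltW ep0.
  move: (s1 ep ep0) (s1 1 ltr01) s2 s3 s4 Bn Gn; rewrite /C /w.
  move: (\sum_i lam i n * U i n (ep / r n) / ep) (\sum_i lam i n * U i n (1 / r n) / 1) => y1 y2.
  move: (\sum_i A n / lam i n) (\sum_i `|del n i / _|) (`|B n|) => y3 y4 y5.
  move=> y10 y20 y30 y40 y50 Bn Gn; move: (r n) r0 => rn r0.
  apply: (le_trans (ler_wpM2r _ (ler_norm _))).
    by do 6?[apply: addr_ge0 | apply: mulr_ge0].
  rewrite -mulrA -mulrDr; apply: ler_wpM2l => //.
  have := ler_wpM2r ep0' Bn; have := ler_wpM2r ep0' Gn; lra.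
rewrite -/S0 -/B0 (_ : X = fun n => (x n + (th * A n + th ^+ 2 / 2 * rest n)) / B n).
  have := cvg_mul (cvg_add x0 (cvg_add (cvg_scale (c := th) A_cvg)
    (cvg_scale (c := th ^+ 2 / 2) rest0))) (cvg_inv _ B_cvg).
  by rewrite mulr0 addr0 add0r; apply; rewrite gt_eqF.
apply/funext => n; rewrite /x subrK mulrAC divff ?mul1r// gt_eqF//.
rewrite /B ltr_pwDl ?mulr_gt0// mulr_ge0// mulr_ge0 ?exprn_ge0//; first exact: ltW.
apply: sumr_ge0 => i _; apply: mulr_ge0; last exact: sqr_ge0.
by rewrite exprn_ge0// ltW.
Unshelve. all: by end_near.
Qed.

Set Implicit Arguments.
End laplace_limit.

(** * From Laplace transforms to distribution functions *)

Section step_polynomial.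
Variable R : realType.

Lemma bernoulli_le (u : R) n : 0 <= u <= 1 -> 1 - n%:R * u <= (1 - u) ^+ n.
Proof.
move=> /andP[u0 u1]; elim: n => [|n IHn]; first by rewrite mul0r subr0.
have u1' : 0 <= 1 - u by rewrite subr_ge0.
rewrite exprS; apply: le_trans (ler_wpM2l u1' IHn).
have : 0 <= n%:R * (u * u) by rewrite !mulr_ge0.
by rewrite -natr1; lra.
Qed.

(* At [expR (- (th * s))] this is close to the indicator of [s <= x] when [th]
   is large: the power is about [expR (th * x)]. *)
Definition step_poly (th x : R) : {poly R} :=
  1 - (1 - 'X) ^+ (Num.truncn (expR (th * x))).+1.

Lemma horner_step_poly th x u :
  (step_poly th x).[u] = 1 - (1 - u) ^+ (Num.truncn (expR (th * x))).+1.
Proof. by rewrite /step_poly !hornerE. Qed.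

Variables th s : R.
Hypotheses (th_gt0 : 0 < th) (s_ge0 : 0 <= s).

Let u := expR (- (th * s)).

Let u01 : 0 <= u <= 1.
Proof. by rewrite expR_ge0 -expR0 ler_expR oppr_le0 mulr_ge0// ltW. Qed.

Lemma step_poly_bounds x : 0 <= (step_poly th x).[u] <= 1.
Proof.
have /andP[u0 u1] := u01; rewrite horner_step_poly subr_ge0 gerBl.
by rewrite exprn_ile1 ?exprn_ge0 ?subr_ge0// gerBl.
Qed.

(** With [m] the power, [(1 - u) ^+ m <= expR (- (m%:R * u))] and [m%:R * u >= expR (th * dl)]; two
    uses of [expR y >= 1 + y] then give the rate. *)
Lemma step_poly_ge x dl : 0 < dl -> s + dl <= x ->
  1 - (th * dl)^-1 <= (step_poly th x).[u].
Proof.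
move=> dl0 sx; rewrite horner_step_poly lerD2l lerN2.
set m := (Num.truncn _).+1.
have /andP[u0 u1] := u01; have u1' : 0 <= 1 - u by rewrite subr_ge0.
have um : (1 - u) ^+ m <= expR (- (m%:R * u)).
  rewrite -mulrN expRM_natl; apply: lerXn2r; rewrite ?nnegrE ?expR_ge0//.
  exact: expR_ge1Dx.
apply: (le_trans um); rewrite expRN lef_pV2 ?posrE ?expR_gt0 ?mulr_gt0//.
have mu : expR (th * dl) <= m%:R * u.
  apply: (@le_trans _ _ (expR (th * x) * u)); last first.
    by apply: ler_wpM2r => //; exact/ltW/truncnS_gt.
  rewrite /u -expRD ler_expR -mulrBr ler_pM2l//; lra.
have := expR_ge1Dx (th * dl); have := expR_ge1Dx (m%:R * u); lra.
Qed.

(** Bernoulli bounds the value by [m%:R * u]. The factor 2 absorbs the rounding of the power: [m%:R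
    <= expR (th * x) + 1 <= 2 * expR (th * x)] as [x >= 0]. *)
Lemma step_poly_le x dl : 0 <= x -> 0 < dl -> x + dl <= s ->
  (step_poly th x).[u] <= 2 / (th * dl).
Proof.
move=> x0 dl0 xs; rewrite horner_step_poly lerBlDr -lerBlDl.
set m := (Num.truncn _).+1.
apply: le_trans (bernoulli_le m u01); rewrite lerD2l lerN2.
have e1 : 1 <= expR (th * x) by rewrite -expR0 ler_expR mulr_ge0// ltW.
have m2 : m%:R <= 2 * expR (th * x).
  rewrite /m -natr1; have := truncn_le (expR (th * x)).
  by rewrite expR_ge0; lra.
have /andP[u0 _] := u01.
apply: (le_trans (ler_wpM2r u0 m2)); rewrite -mulrA; apply: ler_wpM2l => //.
rewrite /u -expRD -[leLHS]invrK lef_pV2 ?posrE ?mulr_gt0 ?invr_gt0 ?expR_gt0//.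
rewrite -expRN; apply: (@le_trans _ _ (expR (th * dl))).
  by have := expR_ge1Dx (th * dl); lra.
rewrite ler_expR -mulrBr -mulrN ler_pM2l//; lra.
Qed.

End step_polynomial.

Section exponential_limit.
Variables (R : realType) (al : R).
Hypothesis al_gt0 : 0 < al.

Notation leb := (@lebesgue_measure R).

(** Integrability and value are kept together, so that the linear rules below establish both at
    once. *)
Definition lebesgue_mean (h : R -> R) (l : R) : Prop :=
  leb.-integrable setT (EFin \o h) /\ \int[leb]_x h x = l.

Lemma lebesgue_meanD f g l m : lebesgue_mean f l -> lebesgue_mean g m ->
  lebesgue_mean (fun x => f x + g x) (l + m).
Proof.
move=> [fi fl] [gi gm]; split; last by rewrite RintegralD// fl gm.
rewrite (_ : _ \o _ = ((EFin \o f) \+ (EFin \o g))%E); last by apply/funext.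
exact: integrableD.
Qed.

Lemma lebesgue_meanZ f l c : lebesgue_mean f l -> lebesgue_mean (fun x => c * f x) (c * l).
Proof.
move=> [fi fl]; split; last by rewrite RintegralZl// fl.
exact: (integrableZl measurableT c fi).
Qed.

Lemma lebesgue_mean_ext f g l : lebesgue_mean f l -> (forall x, g x = f x) ->
  lebesgue_mean g l.
Proof. by move=> fl /funext ->. Qed.

Lemma lebesgue_mean_le f g l m : lebesgue_mean f l -> lebesgue_mean g m ->
  (forall x, f x <= g x) -> l <= m.
Proof. by move=> [fi <-] [gi <-] fg; exact: le_Rintegral. Qed.

Lemma lebesgue_mean_pdf b : 0 < b -> lebesgue_mean (exponential_pdf b) 1.
Proof.
move=> b0; split; first exact: integrable_exponential_pdf.
by rewrite /Rintegral integral_exponential_pdf.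
Qed.

(** The integrand is [al / (al + t)] times the exponential density of rate [al + t]. *)
Lemma exponential_laplace t : 0 <= t ->
  lebesgue_mean (fun x => expR (- (t * x)) * exponential_pdf al x) (al / (al + t)).
Proof.
move=> t0; have at0 : 0 < al + t by rewrite ltr_pwDl.
have := lebesgue_meanZ (al / (al + t)) (lebesgue_mean_pdf at0); rewrite mulr1.
move/lebesgue_mean_ext; apply => x; have [x0|x0] := ltP x 0.
  by rewrite !lt0_exponential_pdf// !mulr0.
rewrite !exponential_pdfE// [RHS]mulrA divfK ?gt_eqF// mulrCA -expRD.
by congr (_ * expR _); ring.
Qed.

Lemma exponential_poly (p : {poly R}) th : 0 <= th ->
  lebesgue_mean (fun x => p.[expR (- (th * x))] * exponential_pdf al x)
    (\sum_(i < size p) p`_i * (al / (al + i%:R * th))).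
Proof.
move=> th0.
suff h n : lebesgue_mean
    (fun x => (\sum_(i < n) p`_i * expR (- (th * x)) ^+ i) * exponential_pdf al x)
    (\sum_(i < n) p`_i * (al / (al + i%:R * th))).
  by apply: lebesgue_mean_ext (h (size p)) _ => x; rewrite horner_coef.
elim: n => [|n IHn].
  rewrite big_ord0 -(mul0r 1); apply: lebesgue_mean_ext
    (lebesgue_meanZ 0 (lebesgue_mean_pdf al_gt0)) _ => x.
  by rewrite big_ord0 !mul0r.
have nth0 : 0 <= n%:R * th by rewrite mulr_ge0.
rewrite big_ord_recr /=.
apply: lebesgue_mean_ext (lebesgue_meanD IHn
  (lebesgue_meanZ p`_n (exponential_laplace nth0))) _ => x.
rewrite big_ord_recr /= mulrDl; congr (_ + _).
by rewrite -expRM_natl mulrN !mulrA.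
Qed.

Lemma exponential_cdf c : 0 < c ->
  lebesgue_mean (fun x => (x <= c)%R%:R * exponential_pdf al x) (1 - expR (- (al * c))).
Proof.
move=> c0; have [pi _] := lebesgue_mean_pdf al_gt0.
have p0 x : 0 <= exponential_pdf al x by apply: exponential_pdf_ge0; exact: ltW.
have mc : measurable [set x : R | x <= c].
  by rewrite -set_itvNyc.
split.
  apply: le_integrable pi => //.
    apply/measurable_EFinP; apply: measurable_funM.
      by have [] := @bounded_mfun_bool _ R R (fun x => x <= c) mc.
    exact: measurable_exponential_pdf.
  move=> x _; rewrite lee_fin normrM; apply: ler_piMl => //.
  by case: (x <= c); rewrite ?normr1 ?normr0.
have := exponential_prob_itv0c al c0; rewrite /exponential_prob => h.
rewrite /Rintegral -mulNr (_ : 1 - expR (- al * c) = fine (1 - (expR (- al * c))%:E)%E)//.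
rewrite -h [in RHS]integral_mkcond; congr fine; apply: eq_integral => x _.
rewrite /patch; have [x0|x0] := ltP x 0.
  by rewrite lt0_exponential_pdf// mulr0; case: ifP.
have [xc|xc] := leP x c.
  by rewrite mem_set ?mul1r//= in_itv/= x0 xc.
by rewrite memNset ?mul0r//= in_itv/= x0 leNgt xc.
Qed.

Variables (d : measure_display) (T : measurableType d).
Variables (mu : nat -> probability T R) (S : nat -> T -> R).
Hypothesis S_measurable : forall n, measurable_fun setT (S n).
Hypothesis S_ge0 : forall n w, 0 <= S n w.
Hypothesis laplace : forall th, 0 < th ->
  \int[mu n]_w expR (- (th * S n w)) @[n --> \oo] --> al / (al + th).

Lemma bounded_laplace n th : 0 <= th -> bounded_mfun (fun w => expR (- (th * S n w))).
Proof.
move=> th0; split; last first.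
  exists 1 => w; rewrite ger0_norm ?expR_ge0// -expR0 ler_expR oppr_le0.
  exact: mulr_ge0.
apply: measurableT_comp => //; apply: measurableT_comp => //.
exact: measurable_funM.
Qed.

Lemma horner_laplace (p : {poly R}) n th w : p.[expR (- (th * S n w))] =
  \sum_(i < size p) p`_i * expR (- (i%:R * th * S n w)).
Proof.
by rewrite horner_coef; apply: eq_bigr => i _; rewrite -expRM_natl mulrN mulrA.
Qed.

Lemma bounded_horner_laplace (p : {poly R}) n th : 0 <= th ->
  bounded_mfun (fun w => p.[expR (- (th * S n w))]).
Proof.
move=> th0; under eq_fun do rewrite horner_laplace.
apply: bounded_mfun_sum => i; apply: bounded_mfunM; first exact: bounded_mfun_cst.
by apply: bounded_laplace; rewrite mulr_ge0.
Qed.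

Lemma mean_poly_cvg (p : {poly R}) th l : 0 < th ->
  lebesgue_mean (fun x => p.[expR (- (th * x))] * exponential_pdf al x) l ->
  \int[mu n]_w p.[expR (- (th * S n w))] @[n --> \oo] --> l.
Proof.
move=> th0 [_ <-]; have th0' := ltW th0.
have [_ ->] := exponential_poly p th0'.
rewrite (_ : (fun n => _) = fun n => \sum_(i < size p) p`_i *
  \int[mu n]_w expR (- (i%:R * th * S n w))); last first.
  apply/funext => n; under eq_Rintegral do rewrite horner_laplace.
  have bi (i : 'I_(size p)) : bounded_mfun (fun w => expR (- (i%:R * th * S n w))).
    by apply: bounded_laplace; rewrite mulr_ge0.
  rewrite mean_sum; last by move=> i; apply: bounded_mfunM => //; exact: bounded_mfun_cst.
  by apply: eq_bigr => i _; rewrite meanZ.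
apply: cvg_sum => i; apply: cvg_scale.
case: i => -[|i] /= ilt.
  rewrite mul0r addr0 divff ?gt_eqF//.
  rewrite (_ : (fun n => _) = fun=> 1); first exact: cvg_cst.
  apply/funext => n; under eq_Rintegral do rewrite !mul0r oppr0 expR0.
  exact: mean_cst.
by apply: laplace; rewrite mulr_gt0.
Qed.

(** Step polynomials at [x + dl] and [x - dl] sandwich the indicator up to a small error. Their
    means converge by [mean_poly_cvg], and the limits are compared with the exponential distribution
    function at [x + 2 * dl] and [x - 2 * dl]. *)
Lemma cdf_cvg x : 0 <= x ->
  \int[mu n]_w (S n w <= x)%R%:R @[n --> \oo] --> 1 - expR (- (al * x)).
Proof.
move=> x0; apply/cvgrPdist_le => e e0.
(* The distribution function grows by at most [2 * al * dl = e / 4] over an interval of length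
   [2 * dl]. *)
pose dl := e / 4 / (2 * al).
have dl0 : 0 < dl by rewrite !divr_gt0// mulr_gt0.
have dlE : 2 * al * dl = e / 4 by rewrite /dl mulrC divfK// gt_eqF// mulr_gt0.
(* Makes the larger of the two step polynomial errors, [2 / (th * dl)], equal to [e / 4]. *)
pose th := 8 / (e * dl).
have th0 : 0 < th by rewrite divr_gt0// mulr_gt0.
have thE : 2 / (th * dl) = e / 4 by rewrite /th; field; rewrite !gt_eqF.
have thE' : (th * dl)^-1 <= e / 4 by rewrite -thE ler_peMl ?ler1n// invr_ge0 mulr_ge0// ltW.
pose F y := 1 - expR (- (al * y)).
have F_gap y : 0 <= y -> F (y + 2 * dl) <= F y + e / 4.
  move=> y0; rewrite /F mulrDr opprD expRD.
  have -> : al * (2 * dl) = e / 4 by rewrite -dlE; ring.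
  have e1 : expR (- (al * y)) <= 1 by rewrite -expR0 ler_expR oppr_le0 mulr_ge0// ltW.
  have := expR_ge1Dx (- (e / 4)); have := expR_ge0 (- (al * y)).
  move: (expR (- (al * y))) (expR (- (e / 4))) e1 => a b a1 a0 b1; nra.
have pdf0 s : 0 <= exponential_pdf al s by apply: exponential_pdf_ge0; exact: ltW.
pose st y s := (step_poly th y).[expR (- (th * s))].
have st_mean y : lebesgue_mean (fun s => st y s * exponential_pdf al s)
    (\int[leb]_s (st y s * exponential_pdf al s)).
  by split=> //; have [] := exponential_poly (step_poly th y) (ltW th0).
have mle n y : measurable [set w | S n w <= y].
  by have := S_measurable n measurableT (measurable_itv `]-oo, y]); rewrite setTI set_itvNyc.
have b_ind n : bounded_mfun (fun w => (S n w <= x)%R%:R : R).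
  exact: bounded_mfun_bool.
have b_st n y : bounded_mfun (fun w => st y (S n w)).
  by apply: bounded_horner_laplace; exact: ltW.
have upper : \forall n \near \oo, \int[mu n]_w (S n w <= x)%R%:R <= F x + e.
  pose l := \int[leb]_s (st (x + dl) s * exponential_pdf al s).
  have l_le : l <= F (x + 2 * dl) + e / 4.
    have c0 : 0 < x + 2 * dl by lra.
    have h := lebesgue_meanD (exponential_cdf c0)
      (lebesgue_meanZ (e / 4) (lebesgue_mean_pdf al_gt0)).
    rewrite mulr1 in h; apply: (lebesgue_mean_le (st_mean _) h) => s.
    have [s0|s0] := ltP s 0; first by rewrite lt0_exponential_pdf// !mulr0 addr0.
    rewrite -mulrDl; apply: ler_wpM2r => //; rewrite /st.
    have /andP[_ st1] := step_poly_bounds th0 s0 (x + dl).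
    have [sc|sc] := leP s (x + 2 * dl); first by rewrite /=; lra.
    rewrite add0r -thE; apply: step_poly_le => //; lra.
  have c := mean_poly_cvg th0 (st_mean (x + dl)); rewrite -/l in c.
  have : \forall n \near \oo, \int[mu n]_w st (x + dl) (S n w) <= l + e / 4.
    by near=> n; near: n; apply: (cvgr_le _ c); rewrite ltrDl divr_gt0.
  apply: filterS => n hn.
  have : \int[mu n]_w (S n w <= x)%R%:R <= \int[mu n]_w (st (x + dl) (S n w) + e / 4).
    apply: le_mean => //; first by apply: bounded_mfunD => //; exact: bounded_mfun_cst.
    move=> w; have /andP[st0 _] := step_poly_bounds th0 (S_ge0 n w) (x + dl).
    rewrite /st; have [sx|sx] := leP (S n w) x; last by rewrite addr_ge0// divr_ge0// ltW.
    have := step_poly_ge th0 (S_ge0 n w) dl0 (_ : S n w + dl <= x + dl).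
    by rewrite lerD2r => /(_ sx); rewrite /=; lra.
  rewrite meanD ?mean_cst//; last exact: bounded_mfun_cst.
  by have := F_gap x x0; lra.
have lower : \forall n \near \oo, F x - e <= \int[mu n]_w (S n w <= x)%R%:R.
  (* In the first case the level [x - 2 * dl] is not positive, but [F x <= al * x <= e / 4] and the
     lower bound is trivial. *)
  have [xd|xd] := leP x (2 * dl).
    apply: nearW => n; apply: (@le_trans _ _ 0).
      rewrite /F; have := expR_ge1Dx (- (al * x)).
      have := ler_wpM2l (ltW al_gt0) xd; lra.
    rewrite -(mean_cst (mu n) 0); apply: le_mean => //.
    by exact: bounded_mfun_cst.
  pose l := \int[leb]_s (st (x - dl) s * exponential_pdf al s).
  have l_ge : F (x - 2 * dl) - e / 4 <= l.
    have c0 : 0 < x - 2 * dl by lra.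
    have h := lebesgue_meanD (exponential_cdf c0)
      (lebesgue_meanZ (- (e / 4)) (lebesgue_mean_pdf al_gt0)).
    rewrite mulr1 in h; apply: (lebesgue_mean_le h (st_mean _)) => s.
    have [s0|s0] := ltP s 0; first by rewrite lt0_exponential_pdf// !mulr0 addr0.
    rewrite -mulrDl; apply: ler_wpM2r => //; rewrite /st.
    have /andP[st0 _] := step_poly_bounds th0 s0 (x - dl).
    have [sc|sc] := leP s (x - 2 * dl); last by rewrite /=; lra.
    have := step_poly_ge th0 s0 dl0 (_ : s + dl <= x - dl).
    by rewrite /= => /(_ ltac:(lra)); lra.
  have c := mean_poly_cvg th0 (st_mean (x - dl)); rewrite -/l in c.
  have : \forall n \near \oo, l - e / 4 <= \int[mu n]_w st (x - dl) (S n w).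
    by near=> n; near: n; apply: (cvgr_ge _ c); rewrite ltrBlDr ltrDl divr_gt0.
  apply: filterS => n hn.
  have : \int[mu n]_w (st (x - dl) (S n w) - e / 4) <= \int[mu n]_w (S n w <= x)%R%:R.
    apply: le_mean => //; first by apply: bounded_mfunB => //; exact: bounded_mfun_cst.
    move=> w; have /andP[st0 st1] := step_poly_bounds th0 (S_ge0 n w) (x - dl).
    rewrite /st; have [sx|sx] := leP (S n w) x; first by rewrite /=; lra.
    rewrite subr_le0 -thE; apply: step_poly_le => //; lra.
  rewrite meanB ?mean_cst//; last exact: bounded_mfun_cst.
  have := F_gap (x - 2 * dl) (ltac:(lra)); rewrite subrK; lra.
move: upper lower; apply: filterS2 => n u1 l1.
by rewrite distrC ler_distl -/(F x) l1 u1.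
Unshelve. all: by end_near.
Qed.

End exponential_limit.

(** * The limit law of the stationary number of customers *)

Theorem theorem3p3 (R : realType) (k : nat) (k_ge1 : (1 <= k)%N)
  (d : nat -> measure_display) (Om : forall n, measurableType (d n))
  (P : forall n, probability (Om n) R)
  (Q : forall n, hetero_queue (P n) k)
  (time_pos : forall n i, (0 < P n [set w | (0 < gtime (Q n) i w)%R])%E)
  (var_fin : forall n i, ('V_(P n)[gtime (Q n) i])%E \is a fin_num)
  (pi : forall n, probability (mstate R k) R)
  (pi_stationary : forall n, stationary_distribution (Q n) (pi n))
  (rate_lt : forall n,
    rate (Q n) ord0 < \sum_(i < k) rate (Q n) (lift ord0 i))
  (lambda sigma : 'I_k.+1 -> R)
  (lambda_gt0 : forall i, 0 < lambda i)
  (rate_cvg : forall i, rate (Q n) i @[n --> \oo] --> lambda i)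
  (load_lt1 : forall n, 0 < load (Q n) < 1)
  (load_cvg : load (Q n) @[n --> \oo] --> (1 : R))
  (sigma_ge0 : forall i, 0 <= sigma i)
  (stddev_cvg : forall i, stddev (Q n) i @[n --> \oo] --> sigma i)
  (sigma_gt0 : 0 < \sum_(i < k.+1) sigma i)
  (time_sq_ui : forall i,
    ereal_sup (range (fun n =>
      (\int[P n]_(w in [set w | (a < gtime (Q n) i w)%R])
         ((gtime (Q n) i w) ^+ 2)%:E)%E)) @[a --> +oo] --> 0%E)
  (dL : nat -> measure_display) (OmL : forall n, measurableType (dL n))
  (PL : forall n, probability (OmL n) R)
  (L : forall n, {RV PL n >-> nat})
  (L_stationary : forall n (B : set nat),
    distribution (PL n) (L n) B = pi n (@customers R k @^-1` B))
  (x : R) (x_ge0 : 0 <= x) :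
  PL n [set w | (1 - load (Q n)) * (L n w)%:R <= x] @[n --> \oo] -->
  (1 - expR (- ((2 * lambda ord0) /
       (\sum_(i < k.+1) lambda i ^+ 3 * sigma i ^+ 2) * x)))%:E.
Proof.
set S := \sum_(i < k.+1) lambda i ^+ 3 * sigma i ^+ 2.
have term_ge0 i : 0 <= lambda i ^+ 3 * sigma i ^+ 2.
  by apply: mulr_ge0; [rewrite exprn_ge0// ltW|exact: sqr_ge0].
have S_gt0 : 0 < S.
  rewrite lt_neqAle sumr_ge0// andbT eq_sym; apply: contraTneq sigma_gt0 => S0.
  rewrite big1 ?ltxx// => i _; apply/eqP; rewrite -sqrf_eq0.
  have /eqP := S0; rewrite psumr_eq0// => /allP /(_ i (mem_index_enum i)).
  by rewrite /= mulf_eq0 [_ ^+ 3 == 0]expf_eq0 /= (gt_eqF (lambda_gt0 i)).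
have r_gt0 n : 0 < 1 - load (Q n) by rewrite subr_gt0; case/andP: (load_lt1 n).
have tail_tight i (e : R) : 0 < e -> exists2 a : R, 0 < a &
    forall n, tail_moment (P n) (gtime (Q n) i) a <= e.
  move=> e0; have e0' : (0%E < e%:E)%E by rewrite lte_fin.
  have h : \forall a \near +oo, (ereal_sup (range (fun n =>
      (\int[P n]_(w in [set w | (a < gtime (Q n) i w)%R])
         ((gtime (Q n) i w) ^+ 2)%:E)%E)) < e%:E)%E.
    exact: time_sq_ui i [set y | (y < e%:E)%E]
      (open_nbhs_nbhs (conj (@open_ereal_lt_ereal R e%:E) e0')).
  have [a [ae a0]] := filter_ex (filterI h (nbhs_pinfty_gt (num_real (0 : R)))).
  exists a => // n; rewrite -lee_fin -(tail_momentE (var_fin n i)).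
  by apply: le_trans (ltW ae); apply: ereal_sup_ubound; exists n.
(* With this rate, [th * lambda ord0 / (th * lambda ord0 + th ^+ 2 * S / 2)] becomes
   [al / (al + th)], the transform of an exponential law. *)
pose al := 2 * lambda ord0 / S.
have al_gt0 : 0 < al by rewrite divr_gt0// mulr_gt0.
pose Sn n (y : mstate R k) : R := (1 - load (Q n)) * (customers y)%:R.
have mSn n : measurable_fun setT (Sn n).
  have [mL _ _] := mstate_fun_id R k.
  exact: (discrete_fun_mfun (fun m : nat => (1 - load (Q n)) * m%:R) mL).
have Sn_ge0 n y : 0 <= Sn n y by rewrite mulr_ge0// ltW.
have laplace th : 0 < th ->
    \int[pi n]_y expR (- (th * Sn n y)) @[n --> \oo] --> al / (al + th).
  move=> th0; have := laplace_cvg _ _ _ _ P Q time_pos var_fin pi pi_stationary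
    lambda sigma lambda_gt0 rate_cvg load_lt1 load_cvg stddev_cvg tail_tight th th0.
  rewrite -/S (_ : _ / _ = al / (al + th)); last first.
    have l0 := lambda_gt0 ord0; rewrite /al; field.
    by rewrite !gt_eqF// ?addr_gt0 ?mulr_gt0.
  rewrite (_ : (fun n => _) = fun n => \int[pi n]_y expR (- (th * Sn n y)))//.
  apply/funext => n; apply: eq_Rintegral => y _; rewrite -expRM_natl /Sn.
  by congr expR; ring.
have := cdf_cvg al_gt0 mSn Sn_ge0 laplace x_ge0.
rewrite (_ : (fun n => PL n _) = fun n => (\int[pi n]_y (Sn n y <= x)%R%:R)%:E).
  by move=> h; apply: cvg_EFin => //; exact: nearW.
apply/funext => n.
have mle : measurable [set y | Sn n y <= x].
  by have := mSn n measurableT _ (measurable_itv `]-oo, x]); rewrite setTI set_itvNyc.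
rewrite mean_bool// fineK ?fin_num_measure//.
exact: (L_stationary n [set m | (1 - load (Q n)) * m%:R <= x]).
Qed.
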